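(* For $1<p<\infty$, $\bm{h}^p_e(\mathbb{B})=\bm{H}^p_e(\mathbb{B})$.
   Context: $\mathbb{B}$ is the open unit ball of $\mathbb{R}^3$, $\mathbb{S}$ the unit sphere, $\sigma$ surface measure. Lamé constants $\mu>0$, $2\mu+\lambda>0$; $\Delta^*\bm{u}=\mu\Delta\bm{u}+(\lambda+\mu)\nabla\,\mathrm{div}\,\bm{u}$. $\bm{h}^p_e(\mathbb{B})$ ($1\le p<\infty$) is the space of solutions $\bm{u}:\mathbb{B}\to\mathbb{R}^3$ of $\Delta^*\bm{u}=0$ with $\sup_{0\le r<1}(\int_{\mathbb{S}}|\bm{u}(rw)|^pd\sigma(w))^{1/p}<\infty$. For $\xi\in\mathbb{S}$, $\Gamma_\xi=\mathbb{B}\cap\mathrm{conv}(\{\xi\}\cup\{x:|x|\le1/2\})$ and $\mathcal{N}\bm{u}(\xi)=\sup_{x\in\Gamma_\xi}|\bm{u}(x)|$. $\bm{H}^p_e(\mathbb{B})$ is the space of solutions $\bm{u}$ of $\Delta^*\bm{u}=0$ in $\mathbb{B}$ with $\mathcal{N}\bm{u}\in L^p(\mathbb{S})$. *)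

(* Defs.v *)
From HB Require Import structures.
From mathcomp Require Import all_boot all_order all_algebra.
From mathcomp Require Import all_classical all_reals all_analysis measurable_realfun.
Set Implicit Arguments. Unset Strict Implicit. Unset Printing Implicit Defensive.
Import Order.TTheory GRing.Theory Num.Theory.
Import numFieldNormedType.Exports.
Local Open Scope classical_set_scope.
Local Open Scope ring_scope.

Section Defs.
Variable R : realType.
Local Notation V := 'rV[R]_3.

Definition ebase (i : 'I_3) : V := delta_mx 0 i.

(* Euclidean norm on R^3 (the library norm on matrices is the sup norm) *)
Definition enorm (x : V) : R := Num.sqrt (\sum_(i < 3) x 0 i ^+ 2).

Definition unit_ball : set V := [set x | enorm x < 1].
Definition half_cball : set V := [set x | enorm x <= 2^-1].
Definition unit_sphere : set V := [set x | enorm x = 1].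

Definition convex3 (A : set V) : Prop :=
  forall x y (t : R), 0 <= t <= 1 -> A x -> A y -> A (t *: x + (1 - t) *: y).
Definition conv_hull (A : set V) : set V :=
  [set x | forall C : set V, convex3 C -> A `<=` C -> C x].

Definition Gamma (xi : V) : set V :=
  unit_ball `&` conv_hull ([set xi] `|` half_cball).

Definition pd (i : 'I_3) (u : V -> V) : V -> V := fun x => 'D_(ebase i) u x.
Definition pds (i : 'I_3) (g : V -> R) : V -> R := fun x => 'D_(ebase i) g x.

Definition laplacian (u : V -> V) (x : V) : V := \sum_(j < 3) pd j (pd j u) x.
Definition divergence (u : V -> V) (y : V) : R := \sum_(j < 3) (pd j u y) 0 j.
Definition gradient (g : V -> R) (x : V) : V := \row_(k < 3) pds k g x.

Definition lame_op (mu lam : R) (u : V -> V) (x : V) : V :=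
  mu *: laplacian u x + (lam + mu) *: gradient (divergence u) x.

Definition lame_solution (mu lam : R) (u : V -> V) : Prop :=
  (forall x, unit_ball x ->
     [/\ differentiable u x,
         (forall i, differentiable (pd i u) x),
         (forall i j, {for x, continuous (pd j (pd i u))}),
         differentiable (divergence u) x &
         lame_op mu lam u x = 0]).

Definition sph (z : R * R) : V :=
  \row_(k < 3) (if k == 0 :> nat then sin z.1 * cos z.2
                else if k == 1 :> nat then sin z.1 * sin z.2
                else cos z.1).

Definition sph_dom : set (R * R) := `[0, pi]%classic `*` `[0, pi *+ 2]%classic.

(* ∫_S f dσ for f : S -> [0, +oo], σ = surface measure (dσ = sinθ dθ dφ) *)
Definition sphere_integral (f : V -> \bar R) : \bar R :=
  (\int[(@lebesgue_measure R) \x (@lebesgue_measure R)]_(z in sph_dom)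
      (f (sph z) * (sin z.1)%:E))%E.

Definition int_mean (p : R) (u : V -> V) (r : R) : \bar R :=
  poweR (sphere_integral (fun w => (enorm (u (r *: w)) `^ p)%:E)) p^-1.

Definition hpe (mu lam p : R) : set (V -> V) :=
  [set u | lame_solution mu lam u /\
     exists C : R, forall r : R, 0 <= r < 1 -> (int_mean p u r <= C%:E)%E].

Definition ntmax (u : V -> V) (xi : V) : \bar R :=
  ereal_sup [set (enorm (u x))%:E | x in Gamma xi].

Definition in_Lp_sphere (p : R) (f : V -> \bar R) : Prop :=
  measurable_fun sph_dom (fun z => f (sph z)) /\
  (sphere_integral (fun w => poweR `|f w|%E p) < +oo)%E.

Definition Hpe (mu lam p : R) : set (V -> V) :=
  [set u | lame_solution mu lam u /\ in_Lp_sphere p (ntmax u)].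

End Defs.

(* Main.v *)
Require Import Defs.
From HB Require Import structures.
From mathcomp Require Import all_boot all_order all_algebra.
From mathcomp Require Import all_classical all_reals all_analysis measurable_realfun.
From mathcomp Require Import ring lra.
Set Implicit Arguments. Unset Strict Implicit. Unset Printing Implicit Defensive.
Import Order.TTheory GRing.Theory Num.Theory.
Import numFieldNormedType.Exports.
Local Open Scope classical_set_scope.
Local Open Scope ring_scope.

(** Let [u] solve the Lame system with bounded [L^p] means. The dilates
    [u (rho x)], [rho < 1], regularised by Steklov averages, are smooth solutions
    [U] beyond the closed ball, so it suffices to bound their nontangential maximal
    functions in [L^p] uniformly in [rho] and to let [rho] tend to [1].

    Write [U = v + (1 - |x|^2) q] with [v] and [q] harmonic, so that [U = v] on the
    sphere. The identity
    [kappa d_k (div v) = (6 + 2 kappa) q_k + (4 + 2 kappa) (x . grad) q_k] bounds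
    [(1 - |x|) |q|] by the second derivatives of [v] along the ray through [x], hence
    by the values of [v] in a wider cone. By the maximum principle [v] is dominated
    by the Poisson integral of [f = |u (rho .)| + 1], and in a cone this Poisson
    integral is dominated by the Hardy-Littlewood maximal function of [f] over
    spherical caps. Vitali's covering argument and a dyadic summation over level sets
    (Marcinkiewicz) give the [L^p] bound. The other inclusion holds because the radius
    to [w] lies in the cone at [w]. *)

(** * The Euclidean norm on R^3 and the topology it induces *)

Section euclidean_norm.
Context {R : realType}.
Local Notation V := 'rV[R]_3.
Implicit Types (x y : V) (r t : R).

(** The components of a Lame solution obey in general no scalar maximum principle. The harmonic [v]
    with the same values on the sphere does, and the price is a bound on the correction
    [(1 - |x|^2) q]. Building [q] and checking its properties consumes four derivatives of [U],
    while a solution is only known to be of class C^2: hence six segment averages, two in each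
    direction, and hence the dilation, which leaves room around the closed ball for them. The
    Poisson integral serves as a positive harmonic majorant: on a sphere slightly smaller than the
    unit sphere a fixed multiple of it exceeds [|v|], because a cap of radius [d] has measure of
    order [d^2]. The maximal function over caps is never formed; a number [t] bounding every cap
    integral by [t * rho^2] stands for it, so that only concrete sets and functions have to be shown
    measurable. The restriction [1 < p] enters through a geometric sum of ratio [2^(p - 1)] in the
    interpolation argument, which is dominated by its last term. *)

Definition o0 : 'I_3 := @Ordinal 3 0 isT.
Definition o1 : 'I_3 := @Ordinal 3 1 isT.
Definition o2 : 'I_3 := @Ordinal 3 2 isT.

Lemma sum3 (M : nmodType) (F : 'I_3 -> M) :
  \sum_(i < 3) F i = F o0 + F o1 + F o2.
Proof.
rewrite !big_ord_recl big_ord0 addr0 addrA.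
by congr (F _ + F _ + F _); apply/val_inj.
Qed.

Lemma ord3P (P : 'I_3 -> Prop) : P o0 -> P o1 -> P o2 -> forall i, P i.
Proof.
move=> P0 P1 P2 [[|[|[|//]]] h].
- by rewrite (_ : Ordinal h = o0)//; apply/val_inj.
- by rewrite (_ : Ordinal h = o1)//; apply/val_inj.
- by rewrite (_ : Ordinal h = o2)//; apply/val_inj.
Qed.

Lemma enorm_ge0 x : 0 <= enorm x. Proof. exact: sqrtr_ge0. Qed.

Lemma enorm_sqr x : enorm x ^+ 2 = \sum_(i < 3) x 0 i ^+ 2.
Proof. by rewrite sqr_sqrtr// sumr_ge0// => i _; exact: sqr_ge0. Qed.

Lemma enorm_sqr3 x : enorm x ^+ 2 = x 0 o0 ^+ 2 + x 0 o1 ^+ 2 + x 0 o2 ^+ 2.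
Proof. by rewrite enorm_sqr sum3. Qed.

Lemma enorm_le x r : 0 <= r -> (enorm x <= r) = (enorm x ^+ 2 <= r ^+ 2).
Proof. by move=> r0; rewrite ler_sqr// nnegrE// enorm_ge0. Qed.

Lemma enorm0 : enorm (0 : V) = 0.
Proof. by apply/eqP; rewrite -sqrf_eq0 enorm_sqr3 !mxE expr0n/= !addr0. Qed.

Lemma enormZ t x : enorm (t *: x) = `|t| * enorm x.
Proof.
apply/eqP; rewrite -(@eqrXn2 _ 2)// ?enorm_ge0 ?mulr_ge0 ?enorm_ge0//.
rewrite exprMn real_normK ?num_real// !enorm_sqr3 !mxE.
by apply/eqP; ring.
Qed.

Lemma enormN x : enorm (- x) = enorm x.
Proof. by rewrite -scaleN1r enormZ normrN1 mul1r. Qed.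

Lemma enormB x y : enorm (x - y) = enorm (y - x).
Proof. by rewrite -enormN opprB. Qed.

Lemma cauchy_schwarz3 x y :
  x 0 o0 * y 0 o0 + x 0 o1 * y 0 o1 + x 0 o2 * y 0 o2 <= enorm x * enorm y.
Proof.
apply: (le_trans (ler_norm _)).
rewrite -ler_sqr ?nnegrE ?mulr_ge0 ?enorm_ge0 ?normr_ge0//.
rewrite real_normK ?num_real// exprMn !enorm_sqr3.
set a := x 0 o0; set b := x 0 o1; set c := x 0 o2.
set d := y 0 o0; set e := y 0 o1; set f := y 0 o2.
rewrite -subr_ge0 (_ : _ - _ = (a * e - b * d) ^+ 2 + (a * f - c * d) ^+ 2
  + (b * f - c * e) ^+ 2); last by ring.
by rewrite !addr_ge0 ?sqr_ge0.
Qed.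

Lemma enormD x y : enorm (x + y) <= enorm x + enorm y.
Proof.
rewrite enorm_le ?addr_ge0 ?enorm_ge0// sqrrD !enorm_sqr3 !mxE.
have := cauchy_schwarz3 x y.
move: (enorm x * enorm y) => m h.
by rewrite mulr2n; nra.
Qed.

Lemma enormBD x y : enorm (x - y) <= enorm x + enorm y.
Proof. by rewrite -(enormN y) enormD. Qed.

Lemma enorm_dist x y : enorm x <= enorm y + enorm (x - y).
Proof. by rewrite -{1}(subrK y x) addrC enormD// addrC. Qed.

Lemma enorm_tri x y z : enorm (x - z) <= enorm (x - y) + enorm (y - z).
Proof. by rewrite -[x - z](subrKA y) enormD. Qed.

Lemma coord_le_enorm x i : `|x 0 i| <= enorm x.
Proof.
rewrite -ler_sqr ?nnegrE ?enorm_ge0// real_normK ?num_real// enorm_sqr3.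
by apply: (ord3P (P := fun i => x 0 i ^+ 2 <= _)) => {i};
  rewrite ?lerDr ?lerDl ?addr_ge0 ?sqr_ge0// -?addrA ?lerDl ?lerDr ?addr_ge0 ?sqr_ge0//
  addrCA lerDl addr_ge0 ?sqr_ge0.
Qed.

Lemma coord_le_norm x i : `|x 0 i| <= `|x|.
Proof.
by rewrite [leRHS]/Num.norm/= mx_normrE; apply/bigmax_geP; right; exists (0, i).
Qed.

Lemma norm_leP x r : 0 <= r -> (forall i, `|x 0 i| <= r) -> `|x| <= r.
Proof.
move=> r0 h; rewrite [leLHS]/Num.norm/= mx_normrE; apply/bigmax_leP; split=> //.
by case=> i j _ /=; rewrite ord1.
Qed.

Lemma norm_le_enorm x : `|x| <= enorm x.
Proof. by apply: norm_leP; [exact: enorm_ge0|exact: coord_le_enorm]. Qed.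

(** The factor [2] replaces the sharp [sqrt 3]; it reappears in the cube estimates and in the
    passage from components to [u]. *)
Lemma enorm_le_norm x : enorm x <= 2 * `|x|.
Proof.
rewrite enorm_le ?mulr_ge0// enorm_sqr3.
have h i : x 0 i ^+ 2 <= `|x| ^+ 2.
  rewrite -(real_normK (num_real (x 0 i))) ler_sqr ?nnegrE//.
  exact: coord_le_norm.
have := h o0; have := h o1; have := h o2.
have := sqr_ge0 `|x|.
by move: (`|x|) => m; rewrite exprMn; lra.
Qed.

(** The library topology comes from the sup norm; equivalence of the norms lets the later epsilon
    arguments use [enorm]. *)
Lemma nbhs_enormP x (P : set V) :
  nbhs x P <-> exists2 e : R, 0 < e & forall y : V, enorm (y - x) < e -> P y.
Proof.
split=> [/nbhs_ballP[e /= e0 h]|[e e0 h]].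
  exists e => // y yx; apply: h; rewrite mx_norm_ball /ball_/= -normrN opprB.
  exact: le_lt_trans (norm_le_enorm _) yx.
apply/nbhs_ballP; exists (e / 2) => /=; first by rewrite divr_gt0.
move=> y; rewrite mx_norm_ball /ball_/= => yx; apply: h.
apply: le_lt_trans (enorm_le_norm _) _.
by rewrite -normrN opprB mulrC -ltr_pdivlMr.
Qed.

Lemma cont_enormP (f : V -> R) x : {for x, continuous f} <->
  forall e : R, 0 < e -> exists2 d : R, 0 < d &
    forall y : V, enorm (y - x) < d -> `|f y - f x| < e.
Proof.
split=> [fx e e0|h].
  have /nbhs_enormP[d d0 hd] : nbhs x (f @^-1` (ball (f x) e)).
    by apply: fx; exact: nbhsx_ballx.
  by exists d => // y /hd; rewrite /= /ball/= distrC.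
move=> A /nbhs_ballP[e /= e0 hA]; have [d d0 hd] := h e e0.
apply/nbhs_enormP; exists d => // y /hd yx; apply: hA.
by rewrite /ball/= distrC.
Qed.

Lemma enorm_lip x y : `|enorm x - enorm y| <= enorm (x - y).
Proof.
rewrite ler_norml; apply/andP; split.
  rewrite lerNl opprB lerBlDl; apply: le_trans (enorm_dist y x) _.
  by rewrite enormB lerD2l.
by rewrite lerBlDl; exact: le_trans (enorm_dist x y) _.
Qed.

Lemma continuous_enorm : continuous (@enorm R).
Proof.
move=> x; apply/cont_enormP => e e0; exists e => // y yx.
exact: le_lt_trans (enorm_lip _ _) yx.
Qed.

Definition eball r : set V := [set x | enorm x < r].

Lemma open_eball r : open (eball r).
Proof.
by apply: (open_comp (f := @enorm R) (D := [set t | t < r]));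
  [move=> *; exact: continuous_enorm|exact: open_lt].
Qed.

Lemma enorm_ebase i : enorm (ebase R i) = 1.
Proof.
apply/eqP; rewrite -(@eqrXn2 _ 2)// ?enorm_ge0// enorm_sqr.
rewrite (bigD1 i)//= big1 ?addr0 => [|j /negPf ji]; rewrite !mxE/=.
  by rewrite eqxx/= expr1n.
by rewrite eq_sym eq_sym ji/= expr0n.
Qed.

Lemma compact_eball r : compact [set x | enorm x <= r].
Proof.
apply: bounded_closed_compact.
  exists r; split; first exact: num_real.
  by move=> s rs x /= xr; apply: le_trans (norm_le_enorm _) (le_trans xr (ltW rs)).
apply: (closed_comp (f := @enorm R) (D := [set t | t <= r])) => //.
by move=> *; exact: continuous_enorm.
Qed.

End euclidean_norm.

(* A sealed copy of [pds]: unification would otherwise unfold it down to limits. *)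
HB.lock Definition dd (R : realType) (i : 'I_3) (f : 'rV[R]_3 -> R) : 'rV[R]_3 -> R :=
  pds i f.

(** * Partial and directional derivatives, symmetry of second derivatives *)

Section partial_derivatives.
Context {R : realType}.
Local Notation V := 'rV[R]_3.
Local Notation e_ := (ebase R).
Implicit Types (f g : V -> R) (x y v : V) (r t h : R) (i j : 'I_3).

(** The two difference quotients are the same function of [h], so one-variable theorems apply along
    lines. *)
Lemma is_derive_line f x v t (d : R) : is_derive (x + t *: v) v f d <->
  is_derive t (1 : R) (fun s : R => f (x + s *: v)) d.
Proof.
pose g (s : R) := f (x + s *: v).
have E : (fun h : R => h^-1 *: ((f \o shift (x + t *: v)) (h *: v) - f (x + t *: v)))
    = (fun h : R => h^-1 *: ((g \o shift t) (h *: (1 : R)) - g t)).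
  apply/funext => h /=; congr (_ *: (f _ - _)).
  by rewrite addrCA -scalerDl [h *: 1]mulr1.
have D1 : derivable f (x + t *: v) v = derivable g t 1 by rewrite /derivable E.
have D2 : 'D_v f (x + t *: v) = 'D_1 g t by rewrite /derive E.
split=> -[a b]; apply: DeriveDef.
- by rewrite -[derivable _ _ _]D1.
- exact: etrans (esym D2) b.
- by rewrite [derivable _ _ _]D1.
- exact: etrans D2 b.
Qed.

Lemma is_derive_shiftV f x v (c : V) (d : R) :
  is_derive (x + c) v f d <-> is_derive x v (fun z : V => f (z + c)) d.
Proof.
pose g (z : V) := f (z + c).
have E : (fun h : R => h^-1 *: ((f \o shift (x + c)) (h *: v) - f (x + c)))
    = (fun h : R => h^-1 *: ((g \o shift x) (h *: v) - g x)).
  by apply/funext => h /=; rewrite /g addrA.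
have D1 : derivable f (x + c) v = derivable g x v by rewrite /derivable E.
have D2 : 'D_v f (x + c) = 'D_v g x by rewrite /derive E.
split=> -[a b]; apply: DeriveDef.
- by rewrite -[derivable _ _ _]D1.
- exact: etrans (esym D2) b.
- by rewrite [derivable _ _ _]D1.
- exact: etrans D2 b.
Qed.

Lemma is_derive_eps f x v (L : R) :
  (forall e : R, 0 < e -> exists2 d : R, 0 < d & forall h : R, h != 0 -> `|h| < d ->
     `|h^-1 * (f (x + h *: v) - f x) - L| <= e) -> is_derive x v f L.
Proof.
move=> H.
have C : h^-1 *: ((f \o shift x) (h *: v) - f x) @[h --> 0^'] --> L.
  apply/cvgrPdist_le => e e0; have [d d0 hd] := H e e0.
  near=> h; rewrite distrC /= [h *: v + x]addrC; apply: hd.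
    by near: h; exact: nbhs_dnbhs_neq.
  by near: h; apply: dnbhs0_lt.
by apply: DeriveDef; [apply/cvg_ex; exists L|exact: cvg_lim].
Unshelve. all: by end_near. Qed.


Lemma dd_isd f i x : derivable f x (e_ i) -> is_derive x (e_ i) f (dd i f x).
Proof. by rewrite dd.unlock; exact: derivableP. Qed.

Lemma isd_dd f i x (d : R) : is_derive x (e_ i) f d -> dd i f x = d.
Proof. by case=> ? <-; rewrite dd.unlock. Qed.

Lemma mvt_line f i x t : (forall s : R, `|s| <= `|t| -> derivable f (x + s *: e_ i) (e_ i)) ->
  exists2 s : R, `|s| <= `|t| & f (x + t *: e_ i) - f x = t * dd i f (x + s *: e_ i).
Proof.
move=> df; pose phi (s : R) := f (x + s *: e_ i).
have dphi (s : R) : `|s| <= `|t| -> is_derive s 1 phi (dd i f (x + s *: e_ i)).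
  by move=> st; apply/is_derive_line/dd_isd/df.
have phi0 : phi 0 = f x by rewrite /phi scale0r addr0.
have [t0|t0] := leP 0 t.
  have [||s] := @MVT_segment _ phi (fun s => dd i f (x + s *: e_ i)) 0 t t0.
  - move=> s; rewrite in_itv/= => /andP[s0 st]; apply: dphi.
    by rewrite !ger0_norm// ltW.
  - apply: derivable_within_continuous => s; rewrite in_itv/= => /andP[s0 st].
    by have [] := dphi s _; rewrite // !ger0_norm.
  rewrite in_itv/= => /andP[s0 st]; rewrite phi0 subr0 mulrC => E.
  by exists s; rewrite // !ger0_norm.
have [||s] := @MVT_segment _ phi (fun s => dd i f (x + s *: e_ i)) t 0 (ltW t0).
- move=> s; rewrite in_itv/= => /andP[s0 st]; apply: dphi.
  by rewrite !ltr0_norm// lerN2 ltW.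
- apply: derivable_within_continuous => s; rewrite in_itv/= => /andP[s0 st].
  by have [] := dphi s _; rewrite // !ler0_norm ?lerN2// ltW.
rewrite in_itv/= => /andP[s0 st]; rewrite phi0 sub0r => E.
exists s; first by rewrite !ler0_norm ?lerN2// ltW.
by rewrite -[LHS]opprB E mulrN opprK mulrC.
Qed.

Lemma row3E v : v = v 0 o0 *: e_ o0 + v 0 o1 *: e_ o1 + v 0 o2 *: e_ o2.
Proof.
apply/rowP => k; rewrite !mxE/=.
by move: k; apply: ord3P; rewrite !(eqxx, mulr1, mulr0, addr0, add0r)//=
  ?(mulr1, mulr0, addr0, add0r).
Qed.

Lemma enormDe x i t : enorm (x + t *: e_ i) <= enorm x + `|t|.
Proof.
by apply: le_trans (enormD _ _) _; rewrite enormZ enorm_ebase mulr1.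
Qed.

Lemma lin3_bound (a b c p q s e : R) : `|p| <= e -> `|q| <= e -> `|s| <= e ->
  `|a * p + b * q + c * s| <= (`|a| + `|b| + `|c|) * e.
Proof.
move=> pe qe se; rewrite !mulrDl; apply: le_trans (ler_normD _ _) _.
apply: lerD; last by rewrite normrM ler_wpM2l.
by apply: le_trans (ler_normD _ _) _; rewrite !normrM lerD// ler_wpM2l.
Qed.

(** The increment is split into three moves parallel to the axes, each handled by the mean value
    theorem; continuity of the partial derivatives at [y] alone brings the intermediate points back
    to [y]. *)
Lemma directional_derivative f y r v : 0 < r ->
  (forall i (z : V), enorm (z - y) < r -> derivable f z (e_ i)) ->
  (forall i, {for y, continuous (dd i f)}) ->
  is_derive y v f (\sum_i v 0 i * dd i f y).
Proof.
move=> r0 df cf; apply: is_derive_eps => e e0.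
(* The [l^1] norm of [v]; dividing by [m + 1] below also covers [v = 0]. *)
pose m : R := `|v 0 o0| + `|v 0 o1| + `|v 0 o2|.
have m0 : 0 <= m by rewrite !addr_ge0.
have e'0 : 0 < e / (m + 1) by rewrite divr_gt0// ltr_wpDl.
have [da da0 ha] := (cont_enormP _ _).1 (cf o0) _ e'0.
have [db db0 hb] := (cont_enormP _ _).1 (cf o1) _ e'0.
have [dc dc0 hc] := (cont_enormP _ _).1 (cf o2) _ e'0.
pose d : R := Num.min r (Num.min da (Num.min db dc)).
have d0 : 0 < d by rewrite !lt_min r0 da0 db0.
exists (d / (m + 1)); first by rewrite divr_gt0// ltr_wpDl.
move=> h hn0 hd.
have hm : `|h| * m < d.
  have [m00|mn0] := eqVneq m 0; first by rewrite m00 mulr0.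
  apply: lt_le_trans (_ : d / (m + 1) * m <= _).
    by rewrite ltr_pM2r// lt_neqAle eq_sym mn0.
  by rewrite mulrAC ler_pdivrMr ?ltr_wpDl// ler_pM2l// lerDl.
have small (x0 x1 x2 : R) : `|x0| <= `|h * v 0 o0| -> `|x1| <= `|h * v 0 o1| ->
    `|x2| <= `|h * v 0 o2| ->
    enorm (y + x0 *: e_ o0 + x1 *: e_ o1 + x2 *: e_ o2 - y) < d.
  move=> l0 l1 l2; apply: le_lt_trans hm; rewrite /m !mulrDr -!normrM.
  rewrite (_ : _ - y = x0 *: e_ o0 + x1 *: e_ o1 + x2 *: e_ o2); last first.
    by rewrite addrC !addrA addNr add0r.
  apply: le_trans (enormDe _ _ _) _; rewrite lerD//.
  apply: le_trans (enormDe _ _ _) _; rewrite lerD//.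
  by rewrite enormZ enorm_ebase mulr1.
have dr (z : V) : enorm (z - y) < d -> enorm (z - y) < r by move=> /lt_le_trans; apply; rewrite ge_min lexx.
have [|s0 s0h E0] := @mvt_line f o0 y (h * v 0 o0).
  move=> s hs; apply/df/dr; have := small s 0 0 hs.
  by rewrite !scale0r !addr0 normr0; apply.
pose y1 := y + (h * v 0 o0) *: e_ o0.
have [|s1 s1h E1] := @mvt_line f o1 y1 (h * v 0 o1).
  move=> s hs; apply/df/dr; have := small (h * v 0 o0) s 0 _ hs.
  by rewrite !scale0r !addr0 normr0; apply.
pose y2 := y1 + (h * v 0 o1) *: e_ o1.
have [|s2 s2h E2] := @mvt_line f o2 y2 (h * v 0 o2).
  by move=> s hs; apply/df/dr/small.
have -> : f (y + h *: v) - f y = h * (v 0 o0 * dd o0 f (y + s0 *: e_ o0)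
   + v 0 o1 * dd o1 f (y1 + s1 *: e_ o1) + v 0 o2 * dd o2 f (y2 + s2 *: e_ o2)).
  rewrite !mulrDr !mulrA -E0 -E1 -E2 [in LHS](row3E v) !scalerDr !scalerA !addrA.
  by rewrite -/y1 -/y2; ring.
rewrite mulKf// sum3.
have A0 : `|dd o0 f (y + s0 *: e_ o0) - dd o0 f y| < e / (m + 1).
  apply: ha; have := small s0 0 0 s0h; rewrite !scale0r !addr0 !normr0 => H.
  by apply: lt_le_trans (H _ _) _ => //; rewrite !ge_min lexx orbT.
have A1 : `|dd o1 f (y1 + s1 *: e_ o1) - dd o1 f y| < e / (m + 1).
  apply: hb; have := small (h * v 0 o0) s1 0 _ s1h; rewrite !scale0r !addr0 !normr0 => H.
  by apply: lt_le_trans (H _ _) _ => //; rewrite !ge_min lexx !orbT.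
have A2 : `|dd o2 f (y2 + s2 *: e_ o2) - dd o2 f y| < e / (m + 1).
  apply: hc; apply: lt_le_trans (small (h * v 0 o0) (h * v 0 o1) s2 _ _ s2h) _ => //.
  by rewrite !ge_min lexx !orbT.
rewrite (_ : _ - _ = v 0 o0 * (dd o0 f (y + s0 *: e_ o0) - dd o0 f y) +
  v 0 o1 * (dd o1 f (y1 + s1 *: e_ o1) - dd o1 f y) +
  v 0 o2 * (dd o2 f (y2 + s2 *: e_ o2) - dd o2 f y)); last by ring.
apply: le_trans (_ : m * (e / (m + 1)) <= _); last first.
  by rewrite mulrCA ler_piMr ?(ltW e0)// ler_pdivrMr ?mul1r ?lerDl// ltr_wpDl.
exact: lin3_bound (ltW A0) (ltW A1) (ltW A2).
Qed.

(** The mean value theorem is used in direction [e_ i] for the first difference in direction [e_ j],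
    then in direction [e_ j] for [dd i f]. *)
Let second_difference f y r i j h : 0 < h -> h *+ 2 < r ->
  (forall z : V, enorm (z - y) < r -> derivable f z (e_ i)) ->
  (forall z : V, enorm (z - y) < r -> derivable (dd i f) z (e_ j)) ->
  exists a b : R, [/\ `|a| <= h, `|b| <= h &
   f (y + h *: e_ i + h *: e_ j) - f (y + h *: e_ i) - f (y + h *: e_ j) + f y =
   h ^+ 2 * dd j (dd i f) (y + a *: e_ i + b *: e_ j)].
Proof.
move=> h0 hr df ddf.
have near (a b : R) : `|a| <= h -> `|b| <= h -> enorm (y + a *: e_ i + b *: e_ j - y) < r.
  move=> ah bh; apply: le_lt_trans hr.
  rewrite addrAC [y + _]addrC addrK; apply: le_trans (enormDe _ _ _) _.
  by rewrite enormZ enorm_ebase mulr1 mulr2n lerD.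
pose F (z : V) := f (z + h *: e_ j) - f z.
have dF (a : R) : `|a| <= h -> is_derive (y + a *: e_ i) (e_ i) F
    (dd i f (y + a *: e_ i + h *: e_ j) - dd i f (y + a *: e_ i)).
  move=> ah; apply: is_deriveB; last first.
    apply/dd_isd/df; have := near a 0 ah; rewrite scale0r addr0 normr0; apply.
    exact: ltW.
  apply: (is_derive_shiftV _ _ _ _ _).1; apply: dd_isd; apply/df/near => //.
  by rewrite ger0_norm// ltW.
have hh : `|h| = h by rewrite ger0_norm// ltW.
have [|a ah Ea] := @mvt_line F i y h; first by move=> s; rewrite hh => /dF[].
rewrite hh in ah.
have [|b bh Eb] := @mvt_line (dd i f) j (y + a *: e_ i) h.
  by move=> s; rewrite hh => sh; exact/ddf/near.
rewrite hh in bh.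
exists a, b; split=> //.
move: Ea; rewrite (isd_dd (dF a ah)) Eb mulrA -expr2 => <-; rewrite /F.
ring.
Qed.

(** Up to the factor [h^2], one second difference equals both mixed derivatives at points close to
    [y]. The step [d / 3] keeps the total displacement, at most [2 * d / 3], inside the ball of
    radius [d]. *)
Lemma schwarz f y r i j : 0 < r ->
  (forall k (z : V), enorm (z - y) < r -> derivable f z (e_ k)) ->
  (forall k l (z : V), enorm (z - y) < r -> derivable (dd k f) z (e_ l)) ->
  {for y, continuous (dd i (dd j f))} ->
  {for y, continuous (dd j (dd i f))} ->
  dd i (dd j f) y = dd j (dd i f) y.
Proof.
move=> r0 df ddf c1 c2; apply/eqP; rewrite -subr_eq0 -normr_le0.
apply/ler_addgt0Pl => /= e e0; rewrite addr0.
have e20 : 0 < e / 2 by rewrite divr_gt0.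
have [d1 d10 h1] := (cont_enormP _ _).1 c1 _ e20.
have [d2 d20 h2] := (cont_enormP _ _).1 c2 _ e20.
pose d : R := Num.min r (Num.min d1 d2).
have d0 : 0 < d by rewrite !lt_min r0 d10.
have h0 : 0 < d / 3 by rewrite divr_gt0.
have hd : (d / 3) *+ 2 < d by rewrite mulr2n; lra.
have near k l (a b : R) : `|a| <= d / 3 -> `|b| <= d / 3 ->
    enorm (y + a *: e_ k + b *: e_ l - y) < d.
  move=> ah bh; apply: le_lt_trans hd.
  rewrite addrAC [y + _]addrC addrK; apply: le_trans (enormDe _ _ _) _.
  by rewrite enormZ enorm_ebase mulr1 mulr2n lerD.
have hr : (d / 3) *+ 2 < r by apply: lt_le_trans hd _; rewrite ge_min lexx.
have [a [b [ah bh E1]]] := second_difference h0 hr (df i) (ddf i j).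
have [a' [b' [ah' bh' E2]]] := second_difference h0 hr (df j) (ddf j i).
have E : dd j (dd i f) (y + a *: e_ i + b *: e_ j) =
         dd i (dd j f) (y + a' *: e_ j + b' *: e_ i).
  apply: (@mulfI _ ((d / 3) ^+ 2)); first by rewrite expf_neq0// gt_eqF.
  have P : y + (d / 3) *: e_ j + (d / 3) *: e_ i =
      y + (d / 3) *: e_ i + (d / 3) *: e_ j by exact: addrAC.
  rewrite P in E2; apply: etrans (esym E1) _; apply: etrans _ E2.
  by congr (_ + _); exact: addrAC.
have dd1 : d <= d1 by rewrite !ge_min lexx !orbT.
have dd2 : d <= d2 by rewrite !ge_min lexx !orbT.
have B1 := h2 _ (lt_le_trans (near i j a b ah bh) dd2).
have B2 := h1 _ (lt_le_trans (near j i a' b' ah' bh') dd1).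
rewrite E in B1; move: B1 B2.
move: (dd i (dd j f) (y + a' *: e_ j + b' *: e_ i)) => Z.
move: (dd j (dd i f) y) (dd i (dd j f) y) => A B.
by rewrite !ltr_norml ler_norml; lra.
Qed.

End partial_derivatives.

(** * Functions of class C^n on an open set *)

Section smooth_functions.
Context {R : realType}.
Local Notation V := 'rV[R]_3.
Local Notation e_ := (ebase R).
Implicit Types (f g : V -> R) (x y v : V) (r t h : R) (i j : 'I_3) (A : set V).

(** Class C^n through iterated partial derivatives, with continuity at every order; [smooth_dir]
    recovers all directional derivatives on open sets. *)
Fixpoint smooth A (n : nat) f : Prop :=
  (forall x : V, A x -> {for x, continuous f}) /\
  if n is m.+1 then
    forall i, (forall x : V, A x -> derivable f x (e_ i)) /\ smooth A m (dd i f)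
  else True.

Definition lap f (x : V) : R := \sum_i dd i (dd i f) x.

Lemma smooth_cont A n f x : smooth A n f -> A x -> {for x, continuous f}.
Proof. by case: n => [|n] [h _] Ax; exact: h. Qed.

Lemma smooth_isd A n f i x : smooth A n.+1 f -> A x ->
  is_derive x (e_ i) f (dd i f x).
Proof. by move=> [_ h] Ax; apply: dd_isd; exact: (h i).1. Qed.

Lemma smooth_dd A n f i : smooth A n.+1 f -> smooth A n (dd i f).
Proof. by move=> [_ h]; exact: (h i).2. Qed.

Lemma smoothS A n f : smooth A n.+1 f -> smooth A n f.
Proof.
elim: n f => [|n IH] f [h1 h2]; split=> // i; split; first exact: (h2 i).1.
by apply: IH; exact: (h2 i).2.
Qed.

Lemma smooth_le A m n f : (m <= n)%N -> smooth A n f -> smooth A m f.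
Proof.
move=> /subnK <-; elim: (n - m)%N => [//|k IH] H; apply: IH; exact: smoothS.
Qed.

Lemma smooth_sub A B n f : B `<=` A -> smooth A n f -> smooth B n f.
Proof.
move=> BA; elim: n f => [|n IH] f [h1 h2]; (split; first by move=> x /BA; exact: h1) => // i.
by split=> [x /BA|]; [exact: (h2 i).1|exact/IH/(h2 i).2].
Qed.

Lemma near_open A x (P : V -> Prop) : open A -> A x -> (forall y : V, A y -> P y) ->
  \forall y \near x, P y.
Proof.
move=> oA Ax h; have : nbhs x A by exact: open_nbhs_nbhs.
by apply: filterS.
Qed.

Lemma isd_ext A f g x v (d : R) : open A -> A x -> (forall y : V, A y -> f y = g y) ->
  is_derive x v f d -> is_derive x v g d.
Proof.
by move=> oA Ax fg; apply: near_eq_is_derive; exact: (near_open oA).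
Qed.

Lemma dd_ext A f g i x : open A -> (forall y : V, A y -> f y = g y) -> A x ->
  dd i f x = dd i g x.
Proof.
move=> oA fg Ax; rewrite dd.unlock /pds; apply: near_eq_derive.
exact: (near_open oA).
Qed.

Lemma cont_ext A f g x : open A -> (forall y : V, A y -> f y = g y) -> A x ->
  {for x, continuous f} -> {for x, continuous g}.
Proof.
move=> oA fg Ax /cont_enormP h; apply/cont_enormP => e /h[d d0 hd].
have /nbhs_enormP[d' d'0 hd'] : nbhs x A by exact: open_nbhs_nbhs.
exists (Num.min d d'); first by rewrite lt_min d0.
by move=> y; rewrite lt_min => /andP[/hd + /hd' yA]; rewrite !fg.
Qed.

Lemma smooth_ext A n f g : open A -> (forall y : V, A y -> f y = g y) ->
  smooth A n f -> smooth A n g.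
Proof.
move=> oA; elim: n f g => [|n IH] f g fg [h1 h2];
  (split; first by move=> x Ax; exact: (cont_ext oA fg Ax) (h1 x Ax)) => // i.
split=> [x Ax|].
  by have [] := isd_ext oA Ax fg (dd_isd ((h2 i).1 x Ax)).
by apply: IH (h2 i).2 => y Ay; exact: (dd_ext _ oA fg).
Qed.

Lemma isdD f g x v (a b : R) : is_derive x v f a -> is_derive x v g b ->
  is_derive x v (fun z => f z + g z) (a + b).
Proof. exact: is_deriveD. Qed.

Lemma isdN f x v (a : R) : is_derive x v f a -> is_derive x v (fun z => - f z) (- a).
Proof. exact: is_deriveN. Qed.

Lemma isdB f g x v (a b : R) : is_derive x v f a -> is_derive x v g b ->
  is_derive x v (fun z => f z - g z) (a - b).
Proof. exact: is_deriveB. Qed.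

Lemma isdM f g x v (a b : R) : is_derive x v f a -> is_derive x v g b ->
  is_derive x v (fun z => f z * g z) (a * g x + f x * b).
Proof.
move=> fa gb; apply: (is_derive_eq (is_deriveM fa gb)).
by rewrite /= addrC; congr (_ + _); exact: mulrC.
Qed.

Lemma isdZ (c : R) f x v (a : R) : is_derive x v f a ->
  is_derive x v (fun z => c * f z) (c * a).
Proof. by move=> fa; exact: (is_deriveZ c fa). Qed.

Lemma isd_cst (c : R) x v : is_derive x v (fun=> c) 0.
Proof. exact: is_derive_cst. Qed.

Lemma isd_coord x v k : is_derive x v (fun z : V => z 0 k) (v 0 k).
Proof.
apply: is_derive_eps => e e0; exists 1 => // h h0 _.
by rewrite !mxE addrAC subrr add0r mulKf// subrr normr0 ltW.
Qed.

Lemma isd_sum (F : 'I_3 -> V -> R) x v (a : 'I_3 -> R) :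
  (forall k, is_derive x v (F k) (a k)) ->
  is_derive x v (fun z => \sum_k F k z) (\sum_k a k).
Proof.
move=> h; rewrite sum3.
rewrite (_ : (fun z => _) = (fun z => F o0 z + F o1 z + F o2 z)); last first.
  by apply/funext => z; rewrite sum3.
by apply: isdD => //; apply: isdD.
Qed.

Lemma ebase_coord i k : e_ i 0 k = (k == i)%:R.
Proof. by rewrite mxE eqxx/= eq_sym eq_sym. Qed.

Lemma contD f g x : {for x, continuous f} -> {for x, continuous g} ->
  {for x, continuous (fun z => f z + g z)}.
Proof. by move=> fx gx; exact: continuousD. Qed.

Lemma contN f x : {for x, continuous f} -> {for x, continuous (fun z => - f z)}.
Proof. by move=> fx; exact: continuousN. Qed.

Lemma contM f g x : {for x, continuous f} -> {for x, continuous g} ->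
  {for x, continuous (fun z => f z * g z)}.
Proof. by move=> fx gx; exact: continuousM. Qed.

Lemma smooth_cst A n (c : R) : open A -> smooth A n (fun=> c).
Proof.
move=> oA; elim: n c => [|n IH] c; (split; first by move=> x _; exact: cst_continuous) => // i.
split=> [x _|]; first by have [] := isd_cst c x (e_ i).
by apply: smooth_ext (IH 0) => // y _; rewrite (isd_dd (isd_cst c y (e_ i))).
Qed.

Lemma smooth_coord A n k : open A -> smooth A n (fun z => z 0 k).
Proof.
move=> oA; case: n => [|n]; (split; first by move=> x _; exact: coord_continuous) => // i.
split=> [x _|]; first by have [] := isd_coord x (e_ i) k.
apply: smooth_ext (smooth_cst n (e_ i 0 k) oA) => // y _.
by rewrite (isd_dd (isd_coord y (e_ i) k)).
Qed.

Lemma smoothD A n f g : open A -> smooth A n f -> smooth A n g ->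
  smooth A n (fun z => f z + g z).
Proof.
move=> oA; elim: n f g => [|n IH] f g hf hg; (split; first by move=> x Ax; apply: contD;
  [exact: (smooth_cont hf)|exact: (smooth_cont hg)]) => // i.
have D y : A y -> is_derive y (e_ i) (fun z => f z + g z) (dd i f y + dd i g y).
  by move=> Ay; apply: isdD; [exact: smooth_isd hf Ay|exact: smooth_isd hg Ay].
split=> [x Ax|]; first by have [] := D x Ax.
apply: smooth_ext (IH _ _ (smooth_dd i hf) (smooth_dd i hg)) => // y Ay.
by rewrite (isd_dd (D y Ay)).
Qed.

Lemma smoothM A n f g : open A -> smooth A n f -> smooth A n g ->
  smooth A n (fun z => f z * g z).
Proof.
move=> oA; elim: n f g => [|n IH] f g hf hg; (split; first by move=> x Ax; apply: contM;
  [exact: (smooth_cont hf)|exact: (smooth_cont hg)]) => // i.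
have D y : A y -> is_derive y (e_ i) (fun z => f z * g z)
    (dd i f y * g y + f y * dd i g y).
  by move=> Ay; apply: isdM; [exact: smooth_isd hf Ay|exact: smooth_isd hg Ay].
split=> [x Ax|]; first by have [] := D x Ax.
apply: smooth_ext (smoothD oA (IH _ _ (smooth_dd i hf) (smoothS hg))
  (IH _ _ (smoothS hf) (smooth_dd i hg))) => // y Ay.
by rewrite (isd_dd (D y Ay)).
Qed.

Lemma smoothZ A n (c : R) f : open A -> smooth A n f -> smooth A n (fun z => c * f z).
Proof. by move=> oA hf; apply: smoothM => //; exact: smooth_cst. Qed.

Lemma smoothB A n f g : open A -> smooth A n f -> smooth A n g ->
  smooth A n (fun z => f z - g z).
Proof.
move=> oA hf hg; apply: smooth_ext (smoothD oA hf (smoothZ (-1) oA hg)) => // y _.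
by rewrite mulN1r.
Qed.

Lemma smooth_sum A n (F : 'I_3 -> V -> R) : open A -> (forall k, smooth A n (F k)) ->
  smooth A n (fun z => \sum_k F k z).
Proof.
move=> oA h; apply: smooth_ext (smoothD oA (smoothD oA (h o0) (h o1)) (h o2)) => //.
by move=> y _; rewrite sum3.
Qed.

Lemma smooth_schwarz A n f i j x : open A -> smooth A n.+2 f -> A x ->
  dd i (dd j f) x = dd j (dd i f) x.
Proof.
move=> oA hf Ax.
have /nbhs_enormP[r r0 hr] : nbhs x A by exact: open_nbhs_nbhs.
apply: (schwarz r0).
- by move=> k z /hr Az; have [] := smooth_isd k hf Az.
- by move=> k l z /hr Az; have [] := smooth_isd l (smooth_dd k hf) Az.
- exact: smooth_cont (smooth_dd i (smooth_dd j hf)) Ax.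
- exact: smooth_cont (smooth_dd j (smooth_dd i hf)) Ax.
Qed.

Lemma smooth_dir A n f v x : open A -> smooth A n.+1 f -> A x ->
  is_derive x v f (\sum_i v 0 i * dd i f x).
Proof.
move=> oA hf Ax.
have /nbhs_enormP[r r0 hr] : nbhs x A by exact: open_nbhs_nbhs.
apply: (directional_derivative (r := r)) => // [i z /hr Az|i].
  by have [] := smooth_isd i hf Az.
exact: smooth_cont (smooth_dd i hf) Ax.
Qed.

(** For [L] linear the two difference quotients coincide, so a derivative along the single direction
    [L v] is enough. *)
Lemma isd_affine (L : V -> V) c f x v (d : R) :
  (forall (h : R) (y z : V), L (h *: y + z) = h *: L y + L z) ->
  is_derive (c + L x) (L v) f d -> is_derive x v (fun z => f (c + L z)) d.
Proof.
move=> HL [a b]; pose g (z : V) := f (c + L z).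
have E : (fun h : R => h^-1 *: ((f \o shift (c + L x)) (h *: L v) - f (c + L x)))
    = (fun h : R => h^-1 *: ((g \o shift x) (h *: v) - g x)).
  by apply/funext => h /=; rewrite /g HL addrCA.
have D1 : derivable f (c + L x) (L v) = derivable g x v by rewrite /derivable E.
have D2 : 'D_(L v) f (c + L x) = 'D_v g x by rewrite /derive E.
apply: DeriveDef; first by rewrite -[derivable _ _ _]D1.
exact: etrans (esym D2) b.
Qed.

Lemma cont_lip (G : V -> V) (K : R) f x :
  (forall y z : V, enorm (G y - G z) <= K * enorm (y - z)) ->
  {for G x, continuous f} -> {for x, continuous (fun z => f (G z))}.
Proof.
move=> HG /cont_enormP h; apply/cont_enormP => e /h[d d0 hd].
have K0 : 0 < `|K| + 1 by rewrite ltr_wpDl.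
exists (d / (`|K| + 1)); first by rewrite divr_gt0.
move=> y yx; apply: hd; apply: le_lt_trans (HG _ _) _.
apply: le_lt_trans (_ : (`|K| + 1) * enorm (y - x) < d).
  by rewrite ler_wpM2r ?enorm_ge0// (le_trans (ler_norm _))// lerDl.
by rewrite mulrC -ltr_pdivlMr.
Qed.

Lemma isd2 A f i x (f1 : V -> R) (d : R) : open A -> A x ->
  (forall y : V, A y -> is_derive y (e_ i) f (f1 y)) ->
  is_derive x (e_ i) f1 d -> dd i (dd i f) x = d.
Proof.
move=> oA Ax h1 h2; rewrite -(isd_dd h2); apply: (dd_ext _ oA) => // y Ay.
exact/isd_dd/h1.
Qed.

Lemma lapZ A (c : R) f x : open A -> smooth A 2 f -> A x ->
  lap (fun z => c * f z) x = c * lap f x.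
Proof.
move=> oA hf Ax; rewrite /lap mulr_sumr; apply: eq_bigr => i _.
apply: (isd2 oA Ax (f1 := fun y => c * dd i f y)) => [y Ay|].
  by apply: isdZ; exact: smooth_isd hf Ay.
by apply: isdZ; exact: smooth_isd (smooth_dd i hf) Ax.
Qed.

Lemma lapB A f g x : open A -> smooth A 2 f -> smooth A 2 g -> A x ->
  lap (fun z => f z - g z) x = lap f x - lap g x.
Proof.
move=> oA hf hg Ax; rewrite /lap -sumrB/=; apply: eq_bigr => i _.
apply: (isd2 oA Ax (f1 := fun y => dd i f y - dd i g y)) => [y Ay|].
  by apply: isdB; [exact: smooth_isd hf Ay|exact: smooth_isd hg Ay].
by apply: isdB; [exact: smooth_isd (smooth_dd i hf) Ax|
  exact: smooth_isd (smooth_dd i hg) Ax].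
Qed.


End smooth_functions.

(** * The weak maximum principle *)

Section maximum_principle.
Context {R : realType}.
Local Notation V := 'rV[R]_3.
Local Notation e_ := (ebase R).
Implicit Types (f g : V -> R) (x y v : V) (i j : 'I_3) (A K : set V).

Lemma is_derive_eps1 (f : R -> R) (x L : R) : is_derive x (1 : R) f L ->
  forall e : R, 0 < e -> exists2 d : R, 0 < d &
    forall h : R, `|h| < d -> `|f (x + h) - f x - h * L| <= e * `|h|.
Proof.
move=> [dfx <-] e e0; move: dfx => /cvgrPdist_lt /(_ e e0).
rewrite near_withinE => /nbhs_ballP[d /= d0 hd]; exists d => // h hd'.
have [->|h0] := eqVneq h 0.
  by rewrite addr0 mul0r subrr subr0 normr0 mulr0.
have := hd h; rewrite /ball/= sub0r normrN => /(_ hd' h0).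
rewrite distrC [h *: 1]mulr1 [h + x]addrC => /ltW H.
have {H} : `|h^-1 * (f (x + h) - f x) - 'D_1 f x| * `|h| <= e * `|h|.
  by rewrite ler_wpM2r.
by rewrite -normrM mulrBl mulrAC mulVf// mul1r [_ * h]mulrC.
Qed.

Lemma exists_pos_lt2 (a b : R) : 0 < a -> 0 < b ->
  exists t : R, [/\ 0 < t, t < a & t < b].
Proof.
move=> a0 b0; exists (Num.min a b / 2); split.
- by rewrite divr_gt0// lt_min a0.
- by rewrite ltr_pdivrMr// (@le_lt_trans _ _ a)// ?ge_min ?lexx// ltr_pMr// ltr1n.
- by rewrite ltr_pdivrMr// (@le_lt_trans _ _ b)// ?ge_min ?lexx ?orbT// ltr_pMr// ltr1n.
Qed.

(** If [c] were positive, [f - c / 4 * s^2] would increase away from [0] on one side, and [f] would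
    exceed [f 0] there. The sign of [f1 0] selects the side. *)
Lemma second_derivative_max (f f1 : R -> R) (d c : R) : 0 < d ->
  (forall s : R, `|s| < d -> is_derive s (1 : R) f (f1 s)) ->
  is_derive (0 : R) (1 : R) f1 c ->
  (forall s : R, `|s| < d -> f s <= f 0) -> c <= 0.
Proof.
move=> d0 df df1 fmax; rewrite leNgt; apply/negP => c0.
have [d' d'0 hd'] := is_derive_eps1 df1 (divr_gt0 c0 (ltr0n _ 4)).
have [t [t0 td td']] := exists_pos_lt2 d0 d'0.
pose g s := f s - c / 4 * s ^+ 2.
have dg (s : R) : `|s| <= t -> is_derive s (1 : R) g (f1 s - c / 2 * s).
  move=> st; apply: is_deriveB; first exact/df/(le_lt_trans st).
  by apply: is_derive_eq; rewrite /GRing.scale /= ?mulr1 ?expr1; lra.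
have cg (a b : R) : - t <= a -> b <= t -> {within `[a, b], continuous g}.
  move=> ta bt; apply: derivable_within_continuous => s; rewrite in_itv/= => /andP[sa sb].
  by have [] := dg s _; rewrite // ler_norml; lra.
have [f10|f10] := leP 0 (f1 0).
  have [||s] := @MVT_segment _ g (fun s => f1 s - c / 2 * s) 0 t (ltW t0).
  - move=> s; rewrite in_itv/= => /andP[sa sb]; apply: dg.
    by rewrite ger0_norm ltW.
  - by apply: cg; rewrite // oppr_le0 ltW.
  rewrite in_itv/= => /andP[s0 st].
  have := hd' s; rewrite add0r ger0_norm// => /(_ (le_lt_trans st td')).
  rewrite ler_norml => /andP[H _] E.
  have gt0 : 0 <= (f1 s - c / 2 * s) * (t - 0) by apply: mulr_ge0; nra.
  rewrite -E /g expr0n/= mulr0 subr0 in gt0.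
  have := fmax t; rewrite ger0_norm ?(ltW t0)// => /(_ td).
  have : 0 < c / 4 * t ^+ 2 by rewrite mulr_gt0 ?divr_gt0// exprn_gt0.
  lra.
have [|||s] := @MVT_segment _ g (fun s => f1 s - c / 2 * s) (- t) 0.
- by rewrite oppr_le0 ltW.
- move=> s; rewrite in_itv/= => /andP[sa sb]; apply: dg.
  by rewrite ler_norml; lra.
- by apply: cg; rewrite // ltW.
rewrite in_itv/= => /andP[s0 st].
have := hd' s; rewrite add0r ler0_norm// => H.
have {H} := H ltac:(lra); rewrite ler_norml => /andP[_ H] E.
have gt0 : (f1 s - c / 2 * s) * (0 - - t) <= 0 by apply: mulr_le0_ge0; nra.
rewrite -E /g expr0n/= mulr0 subr0 in gt0.
have := fmax (- t); rewrite normrN ger0_norm ?(ltW t0)// => /(_ td).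
have : 0 < c / 4 * (- t) ^+ 2 by rewrite mulr_gt0 ?divr_gt0// sqrrN exprn_gt0.
lra.
Qed.

Lemma isd_enorm_sqr x v :
  is_derive x v (fun z : V => enorm z ^+ 2) (2 * \sum_k x 0 k * v 0 k).
Proof.
rewrite (_ : (fun z => _) = (fun z : V => \sum_k (z 0 k * z 0 k))); last first.
  by apply/funext => z; rewrite enorm_sqr; apply: eq_bigr => k _; rewrite expr2.
apply: is_derive_eq.
  by apply: isd_sum => k; apply: isdM; exact: isd_coord.
by rewrite !sum3; ring.
Qed.

Lemma cont_enorm_sqr x : {for x, continuous (fun z : V => enorm z ^+ 2)}.
Proof. by apply: contM; exact: continuous_enorm. Qed.

(** Adding [ep * |x|^2] makes the sum of the second derivatives strictly positive, which excludes a
    maximum off [B]. Derivatives are passed as explicit functions [f1] and numbers [f2], so that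
    barriers and Poisson integrals fit directly. *)
Theorem max_principle K (B : set V) f : compact K ->
  (forall x, K x -> {for x, continuous f}) ->
  (forall x, K x -> B x -> f x <= 0) ->
  (forall x, K x -> ~ B x -> exists A (f1 : 'I_3 -> V -> R) (f2 : 'I_3 -> R),
     [/\ open A, A x /\ A `<=` K,
         forall i y, A y -> is_derive y (e_ i) f (f1 i y),
         forall i, is_derive x (e_ i) (f1 i) (f2 i) & 0 <= \sum_i f2 i]) ->
  forall x, K x -> f x <= 0.
Proof.
move=> cK cf fB fK x0 Kx0; rewrite leNgt; apply/negP => fx0.
have K0 : K !=set0 by exists x0.
have [xm _ Mm] : exists2 c, c \in K & forall t, t \in K -> enorm t <= enorm c.
  apply: compact_EVT_max => //; apply: continuous_subspaceT; exact: continuous_enorm.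
pose M := enorm xm ^+ 2.
have M0 : 0 <= M by exact: sqr_ge0.
have hM (x : V) : K x -> enorm x ^+ 2 <= M.
  by move=> Kx; rewrite -enorm_le ?enorm_ge0// Mm// inE.
(* Small enough that [ep * M < f x0]: the perturbed function at [x0] still exceeds all its values on
   [B]. *)
pose ep := f x0 / (2 * (M + 1)).
have ep0 : 0 < ep by rewrite divr_gt0// mulr_gt0// ltr_wpDl.
pose g (x : V) := f x + ep * enorm x ^+ 2.
have cg : {within K, continuous g}.
  apply: continuous_in_subspaceT => x; rewrite inE => Kx.
  apply: contD; first exact: cf.
  apply: contM; first exact: cst_continuous.
  exact: cont_enorm_sqr.
have [xs] := compact_EVT_max K0 cK cg; rewrite inE => Kxs maxg.
have gxs : f x0 <= g xs.
  apply: le_trans (maxg x0 _); last by rewrite inE.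
  by rewrite lerDl mulr_ge0 ?(ltW ep0)// sqr_ge0.
have [Bxs|nBxs] := pselect (B xs).
  have : g xs <= ep * M.
    have := fB _ Kxs Bxs; have : ep * enorm xs ^+ 2 <= ep * M.
      by rewrite ler_pM2l// hM.
    by rewrite /g; lra.
  have : ep * M < f x0.
    rewrite /ep mulrAC ltr_pdivrMr ?mulr_gt0 ?ltr_wpDl// ltr_pM2l//.
    lra.
  by move: gxs; lra.
have [A [f1 [f2 [oA [Axs AK] df df1 sf2]]]] := fK _ Kxs nBxs.
have /nbhs_enormP[d d0 hd] : nbhs xs A by exact: open_nbhs_nbhs.
have key i : f2 i + ep * 2 <= 0.
  pose F (s : R) := g (xs + s *: e_ i).
  have nearA (s : R) : `|s| < d -> A (xs + s *: e_ i).
    by move=> sd; apply: hd; rewrite addrAC subrr add0r enormZ enorm_ebase mulr1.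
  pose g1 (y : V) := f1 i y + ep * (2 * y 0 i).
  apply: (@second_derivative_max F (fun s => g1 (xs + s *: e_ i)) d) => //.
  - move=> s /nearA As; apply/(is_derive_line g xs).
    apply: isdD; first exact: df.
    apply: is_derive_eq; first exact: isdZ (isd_enorm_sqr _ _).
    congr (_ * (_ * _)); rewrite (bigD1 i)//= big1 => [|k ki].
      by rewrite ebase_coord eqxx mulr1 addr0.
    by rewrite ebase_coord (negPf ki) mulr0.
  - apply/(is_derive_line g1 xs); rewrite scale0r addr0.
    apply: isdD (df1 i) _; apply: is_derive_eq; first exact/isdZ/isdZ/isd_coord.
    by rewrite ebase_coord eqxx mulr1.
  - move=> s /nearA As; rewrite /F scale0r addr0; apply: maxg.
    by rewrite inE; exact: AK.
have := key o0; have := key o1; have := key o2; rewrite sum3 in sf2.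
lra.
Qed.

End maximum_principle.

(** * Interior derivative estimates for harmonic functions, by barriers *)

Section harmonic_difference_estimate.
Context {R : realType}.
Local Notation V := 'rV[R]_3.
Local Notation e_ := (ebase R).
Implicit Types (f g : V -> R) (x y v : V) (i j : 'I_3) (A K : set V).

Definition cube y (d : R) : set V := [set z | forall j, `|z 0 j - y 0 j| <= d].

Definition refl i x : V := x - (2 * x 0 i) *: e_ i.

Let sgn_refl i j : R := if j == i then -1 else 1.

Lemma refl_linear i (h : R) y x : refl i (h *: y + x) = h *: refl i y + refl i x.
Proof.
by apply/rowP => k; rewrite !mxE; case: eqP => _ /=; ring.
Qed.

Lemma refl_coord i x j : refl i x 0 j = sgn_refl i j * x 0 j.
Proof.
rewrite !mxE /sgn_refl eqxx/= eq_sym; case: eqP => [->|_] /=; last by ring.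
by rewrite mulr1 mulN1r; ring.
Qed.

Lemma refl_ebase i j : refl i (e_ j) = sgn_refl i j *: e_ j.
Proof.
apply/rowP => k; rewrite refl_coord [in RHS]mxE.
by have [->//|kj] := eqVneq k j; rewrite ebase_coord (negPf kj) !mulr0.
Qed.

Lemma enorm_refl i x : enorm (refl i x) = enorm x.
Proof.
apply/eqP; rewrite -(@eqrXn2 _ 2)// ?enorm_ge0// !enorm_sqr; apply/eqP.
apply: eq_bigr => k _; rewrite refl_coord exprMn /sgn_refl.
by case: eqP; rewrite ?sqrrN expr1n mul1r.
Qed.

Lemma isd_refl A n f i j y x : open A -> smooth A n.+1 f -> A (y + refl i x) ->
  is_derive x (e_ j) (fun z => f (y + refl i z)) (sgn_refl i j * dd j f (y + refl i x)).
Proof.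
move=> oA hf Ax; apply: isd_affine; first exact: refl_linear.
apply: is_derive_eq; first exact: (smooth_dir _ oA hf Ax).
rewrite (bigD1 j)//= big1 => [|k kj]; rewrite refl_ebase mxE ebase_coord.
  by rewrite eqxx mulr1 addr0.
by rewrite (negPf kj) mulr0 mul0r.
Qed.

Lemma isd_trans A n f j y x : smooth A n.+1 f -> A (y + x) ->
  is_derive x (e_ j) (fun z => f (y + z)) (dd j f (y + x)).
Proof.
move=> hf Ax; apply: (isd_affine (L := id)) => //.
exact: smooth_isd hf Ax.
Qed.

(* Comparison with the barrier of Gilbarg-Trudinger, Theorem 3.9, on the half
   cube [0 <= x_i <= d]; the barrier is harmonic because [6 = 3 * 2]. *)
Let one_sided A f y i (d M h : R) : open A -> smooth A 2 f ->
  (forall x, A x -> lap f x = 0) -> 0 < d -> cube y d `<=` A ->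
  (forall x, cube y d x -> `|f x| <= M) -> 0 <= h <= d ->
  f (y + h *: e_ i) - f (y - h *: e_ i) <= 6 * M * h / d.
Proof.
move=> oA hf lf d0 QA fM /andP[h0 hd].
have M0 : 0 <= M.
  by apply: le_trans (fM y _) => // j; rewrite subrr normr0 ltW.
(* That is, the squares of the other coordinates plus [x_i * (3 * d - 2 * x_i)]: nonnegative on the
   half cube, at least [d^2] on the faces where some [|x_j| = d], and at most [3 * d * h] at
   [h *: e_ i]. With this [c], [c * q] dominates the difference, at most [2 * M], on those faces. *)
pose q (x : V) := enorm x ^+ 2 - 3 * (x 0 i * x 0 i) + 3 * d * x 0 i.
pose c := 2 * M / d ^+ 2.
have c0 : 0 <= c by apply: divr_ge0; [exact: mulr_ge0|exact: sqr_ge0].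
pose phi (x : V) := f (y + x) - f (y + refl i x) - c * q x.
pose K : set V := cube 0 d `&` [set x | 0 <= x 0 i].
have Kc x j : K x -> `|x 0 j| <= d by move=> [/(_ j)]; rewrite mxE subr0.
have KA x : K x -> A (y + x).
  by move=> Kx; apply: QA => j; rewrite mxE addrAC subrr add0r Kc.
have KA' x : K x -> A (y + refl i x).
  move=> Kx; apply: QA => j; rewrite mxE addrAC subrr add0r refl_coord normrM.
  rewrite (_ : `|sgn_refl i j| = 1) ?mul1r ?Kc// /sgn_refl.
  by case: eqP; rewrite ?normrN normr1.
have fMK x : K x -> f (y + x) - f (y + refl i x) <= 2 * M.
  move=> Kx; have : `|f (y + x)| <= M.
    by apply: fM => j; rewrite mxE addrAC subrr add0r Kc.
  have : `|f (y + refl i x)| <= M.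
    apply: fM => j; rewrite mxE addrAC subrr add0r refl_coord normrM.
    rewrite (_ : `|sgn_refl i j| = 1) ?mul1r ?Kc// /sgn_refl.
    by case: eqP; rewrite ?normrN normr1.
  by rewrite !ler_norml; lra.
have cK : compact K.
  apply: bounded_closed_compact.
    exists d; split; first exact: num_real.
    move=> s ds x Kx; apply: norm_leP; first by rewrite ltW// (lt_trans d0).
    by move=> j; apply: le_trans (Kc _ j Kx) (ltW ds).
  apply: closedI.
    rewrite (_ : cube 0 d = \bigcap_j [set z : V | `|z 0 j| <= d]); last first.
      apply/seteqP; split=> z /= h' j; first by move=> _; have := h' j; rewrite mxE subr0.
      by rewrite mxE subr0; exact: h'.
    apply: closed_bigI => j _.
    apply: (closed_comp (f := fun z : V => `|z 0 j|) (D := [set t | t <= d])) => //.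
    by move=> z _; apply: continuous_comp; [exact: coord_continuous|exact: norm_continuous].
  apply: (closed_comp (f := fun z : V => z 0 i) (D := [set t | 0 <= t])) => //.
  by move=> z _; exact: coord_continuous.
have cphi x : K x -> {for x, continuous phi}.
  move=> Kx.
  apply: contD; last apply: contN.
    apply: contD; last apply: contN.
      apply: (cont_lip (G := fun z => y + z) (K := 1)) (smooth_cont hf (KA _ Kx)).
      by move=> a b; rewrite mul1r opprD addrACA subrr add0r.
    apply: (cont_lip (G := fun z => y + refl i z) (K := 1)) (smooth_cont hf (KA' _ Kx)).
    move=> a b; rewrite mul1r opprD addrACA subrr add0r.
    have -> : refl i a - refl i b = refl i (a - b).
      have := refl_linear i (-1) b a; rewrite !scaleN1r addrC => ->.
      by rewrite addrC.
    by rewrite enorm_refl.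
  apply: contM; first exact: cst_continuous.
  apply: contD; last first.
    by apply: contM; [exact: cst_continuous|exact: coord_continuous].
  apply: contD; first exact: cont_enorm_sqr.
  apply: contN; apply: contM; first exact: cst_continuous.
  by apply: contM; exact: coord_continuous.
pose B : set V := [set x | x 0 i = 0 \/ (exists j, `|x 0 j| = d)].
have q0 x : K x -> 0 <= q x - \sum_(k | k != i) x 0 k ^+ 2.
  move=> Kx; rewrite /q enorm_sqr (bigD1 i)//=.
  have := Kc x i Kx; rewrite ger0_norm; last by case: Kx.
  case: Kx => _ /=; move: (x 0 i) => t; move: (\sum_(_ | _) _) => S.
  by rewrite expr2; nra.
have Sge0 x : 0 <= \sum_(k | k != i) x 0 k ^+ 2 by apply: sumr_ge0 => k _; exact: sqr_ge0.
have phiB x : K x -> B x -> phi x <= 0.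
  move=> Kx [xi0|[j xj]].
    have -> : phi x = - (c * q x).
      rewrite /phi (_ : refl i x = x) ?subrr ?sub0r//.
      by rewrite /refl xi0 mulr0 scale0r subr0.
    rewrite oppr_le0 mulr_ge0//; have := q0 x Kx; have := Sge0 x; lra.
  rewrite subr_le0; apply: le_trans (fMK _ Kx) _.
  rewrite /c mulrAC ler_pdivlMr ?exprn_gt0// ler_wpM2l ?mulr_ge0//.
  have [ji|ji] := eqVneq j i; last first.
    have := q0 x Kx; have : d ^+ 2 <= \sum_(k | k != i) x 0 k ^+ 2.
      rewrite (bigD1 j)//= -xj real_normK ?num_real// lerDl.
      by apply: sumr_ge0 => k _; exact: sqr_ge0.
    lra.
  have xid : x 0 i = d.
    by rewrite -xj ji ger0_norm//; case: Kx.
  rewrite /q enorm_sqr (bigD1 i)//= xid; have := Sge0 x.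
  by move: (\sum_(_ | _) _) => S; rewrite expr2; nra.
have Khe : K (h *: e_ i).
  split=> [j|] /=; rewrite !mxE ?subr0.
    rewrite eqxx/=; case: eqP => _; last by rewrite mulr0 normr0 ltW.
    by rewrite mulr1 ger0_norm.
  by rewrite !eqxx mulr1.
have : phi (h *: e_ i) <= 0.
  apply: (max_principle (K := K) (B := B)) => // x Kx nBx.
  pose C j : set V := [set z : V | `|z 0 j| < d].
  have oC j : open (C j).
    apply: (open_comp (f := fun z : V => `|z 0 j|) (D := [set t | t < d])) => //.
    by move=> z _; apply: continuous_comp; [exact: coord_continuous|exact: norm_continuous].
  pose U : set V := [set z : V | A (y + z)] `&` [set z : V | A (y + refl i z)] `&`
    [set z : V | 0 < z 0 i] `&` (C o0 `&` C o1 `&` C o2).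
  pose f1 j (z : V) := dd j f (y + z) - sgn_refl i j * dd j f (y + refl i z)
    - c * (2 * z 0 j - 3 * (2 * (j == i)%:R * z 0 i) + 3 * d * (j == i)%:R).
  pose f2 j := dd j (dd j f) (y + x) - dd j (dd j f) (y + refl i x)
    - c * (2 - 3 * (2 * (j == i)%:R) ).
  exists U, f1, f2; split.
  - apply: openI; last by apply: openI => //; exact: openI.
    apply: openI; first apply: openI.
    + apply: (open_comp (f := fun z => y + z)) oA => z _.
      by apply: continuousD; [exact: cst_continuous|exact: id].
    + apply: (open_comp (f := fun z => y + refl i z)) oA => z _.
      apply: continuousD; first exact: cst_continuous.
      apply: continuousB; first exact: id.
      apply: continuousZl.
      by apply: contM; [exact: cst_continuous|exact: coord_continuous].
    + apply: (open_comp (f := fun z : V => z 0 i) (D := [set t | 0 < t])) => //.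
      by move=> z _; exact: coord_continuous.
  - have Cx j : C j x.
      by rewrite /C/= lt_neqAle Kc// andbT; apply/eqP => ?; apply: nBx; right; exists j.
    split; first split => //.
      split; first by split; [exact: KA|exact: KA'].
      rewrite /= lt_neqAle; case: (Kx) => _ /= ->; rewrite andbT.
      by apply/eqP => /esym ?; apply: nBx; left.
    move=> z [[_ z0] [[c0' c1'] c2']]; split; last exact: ltW.
    by move=> j; rewrite mxE subr0; apply: ltW; move: j; exact: ord3P.
  - move=> j z [[[Az Az'] _] _]; apply: isdB.
      by apply: isdB; [exact: (isd_trans _ hf)|apply: (isd_refl (A := A) (n := 1))].
    apply: isdZ; apply: isdD; last first.
      apply: is_derive_eq; first exact/isdZ/isd_coord.
      by rewrite ebase_coord eq_sym.
    apply: isdB.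
      apply: is_derive_eq; first exact: isd_enorm_sqr.
      congr (_ * _); rewrite (bigD1 j)//= big1 => [|k kj]; rewrite ebase_coord.
        by rewrite eqxx mulr1 addr0.
      by rewrite (negPf kj) mulr0.
    apply: is_derive_eq.
      by apply: isdZ; apply: isdM; exact: isd_coord.
    by rewrite ebase_coord eq_sym; ring.
  - move=> j; apply: isdB.
      apply: isdB; first exact: (isd_trans _ (smooth_dd j hf)) (KA _ Kx).
      apply: is_derive_eq.
        by apply: isdZ; apply: (isd_refl (A := A) (n := 0)) => //;
          [exact: smooth_dd|exact: KA'].
      by rewrite mulrA /sgn_refl; case: eqP => _; rewrite ?mulrNN !mul1r.
    apply: isdZ; apply: is_derive_eq.
      exact: (isdD (isdB (isdZ 2 (isd_coord x (e_ j) j))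
        (isdZ 3 (isdZ (2 * (j == i)%:R) (isd_coord x (e_ j) i)))) (isd_cst _ _ _)).
    rewrite !ebase_coord eqxx [i == j]eq_sym; case: eqP => _ /=; ring.
  - have L1 := lf _ (KA _ Kx); have L2 := lf _ (KA' _ Kx).
    rewrite /lap in L1 L2.
    rewrite /f2 !sumrB L1 L2 subrr sub0r -mulr_sumr sumrB oppr_ge0.
    rewrite (_ : \sum_k 3 * _ = 6); last first.
      rewrite (bigD1 i)//= eqxx big1 => [|k /negPf->]; last by rewrite !mulr0.
      by rewrite /=; ring.
    by rewrite sum3 (_ : 2 + 2 + 2 - 6 = 0) ?mulr0//; ring.
rewrite subr_le0 => /le_trans.
rewrite (_ : y + refl i (h *: e_ i) = y - h *: e_ i); last first.
  congr (_ + _); apply/rowP => k; rewrite refl_coord !mxE /sgn_refl eqxx/=.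
  by case: eqP => _ /=; rewrite ?mulr0 ?oppr0// mulr1 mulN1r.
apply.
have -> : q (h *: e_ i) = 3 * d * h - 2 * h ^+ 2.
  rewrite /q enormZ enorm_ebase mulr1 ger0_norm// !mxE !eqxx/=; ring.
rewrite -subr_ge0 (_ : _ - _ = 4 * M * h ^+ 2 / d ^+ 2); last first.
  by rewrite /c; field; rewrite gt_eqF.
by apply: divr_ge0; [apply: mulr_ge0; [exact: mulr_ge0|exact: sqr_ge0]|exact: sqr_ge0].
Qed.

Lemma harmonic_difference A f y i (d M h : R) : open A -> smooth A 2 f ->
  (forall x, A x -> lap f x = 0) -> 0 < d -> cube y d `<=` A ->
  (forall x, cube y d x -> `|f x| <= M) -> 0 <= h <= d ->
  `|f (y + h *: e_ i) - f (y - h *: e_ i)| <= 6 * M * h / d.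
Proof.
move=> oA hf lf d0 QA fM hd; rewrite ler_norml; apply/andP; split; last first.
  exact: (one_sided _ oA hf lf).
have := @one_sided A (fun z => -1 * f z) y i d M h oA (smoothZ (-1) oA hf) _ d0 QA _ hd.
rewrite !mulN1r opprK => H; rewrite lerNl opprB addrC; apply: H.
  by move=> x Ax; rewrite (lapZ _ oA hf Ax) lf// mulr0.
by move=> x Qx; rewrite mulN1r normrN fM.
Qed.

Lemma open_trans A c : open A -> open [set x | A (c + x)].
Proof.
move=> oA; apply: (open_comp (f := fun z => c + z)) oA => z _.
by apply: continuousD; [exact: cst_continuous|exact: id].
Qed.

Lemma dd_trans A n f c j x : smooth A n.+1 f -> A (c + x) ->
  dd j (fun z => f (c + z)) x = dd j f (c + x).
Proof. by move=> hf Ax; exact/isd_dd/(isd_trans j hf Ax). Qed.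

Lemma dd_trans2 A n f c j x : open A -> smooth A n.+2 f -> A (c + x) ->
  dd j (dd j (fun z => f (c + z))) x = dd j (dd j f) (c + x).
Proof.
move=> oA hf Ax; rewrite -(dd_trans j (smooth_dd j hf) Ax).
apply: (dd_ext (A := [set z | A (c + z)])) => //; first exact: open_trans.
by move=> z Az; exact: dd_trans hf Az.
Qed.

Lemma smooth_trans A n f c : open A -> smooth A n f ->
  smooth [set x | A (c + x)] n (fun z => f (c + z)).
Proof.
move=> oA.
elim: n f => [|n IH] f hf.
  split=> // x Ax; apply: (cont_lip (G := fun z => c + z) (K := 1)) (smooth_cont hf Ax).
  by move=> a b; rewrite mul1r opprD addrACA subrr add0r.
split=> [x Ax|i].
  apply: (cont_lip (G := fun z => c + z) (K := 1)) (smooth_cont hf Ax).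
  by move=> a b; rewrite mul1r opprD addrACA subrr add0r.
split=> [x Ax|]; first by have [] := isd_trans i hf Ax.
apply: smooth_ext (IH _ (smooth_dd i hf)); first exact: open_trans.
by move=> z Az; rewrite (dd_trans _ hf Az).
Qed.

(** Symmetric differences are what the reflected barrier controls; divided by [2 * t] they tend to
    the derivative. *)
Lemma derive_symmetric_bound (F : R -> R) (L C d : R) : 0 < d ->
  is_derive (0 : R) (1 : R) F L ->
  (forall t : R, 0 <= t <= d -> `|F t - F (- t)| <= 2 * C * t) -> `|L| <= C.
Proof.
move=> d0 dF hF; apply/ler_addgt0Pr => /= e e0.
have [d' d'0 hd'] := is_derive_eps1 dF e0.
have [t [t0 td td']] := exists_pos_lt2 d0 d'0.
have := hd' t; rewrite gtr0_norm// => /(_ td'); rewrite add0r.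
have := hd' (- t); rewrite normrN gtr0_norm// => /(_ td'); rewrite add0r.
have := hF t; rewrite (ltW t0) (ltW td) => /(_ isT).
rewrite !ler_norml; move: (F t) (F (- t)) (F 0) => a b c /andP[h1 h2] /andP[h3 h4] /andP[h5 h6].
have e1 : t * L <= t * (C + e) by lra.
have e2 : t * - (C + e) <= t * L by lra.
by move: e1 e2; rewrite !ler_pM2l// => -> ->.
Qed.

(** The difference bound is used twice: for [f] in direction [k], then in direction [j] for the
    harmonic function [w h], which the first use bounds by [6 * M * h / d]. Halving at each passage
    to a derivative gives [9 = (6 / 2)^2]. Each use consumes one [d] of the half-side [2 * d]. *)
Lemma harmonic_second_derivative A f y j k (d M : R) : open A -> smooth A 2 f ->
  (forall x, A x -> lap f x = 0) -> 0 < d -> cube y (2 * d) `<=` A ->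
  (forall x, cube y (2 * d) x -> `|f x| <= M) ->
  `|dd k (dd j f) y| <= 9 * M / d ^+ 2.
Proof.
move=> oA hf lf d0 QA fM.
have cubeD x z : cube y d x -> cube x d z -> cube y (2 * d) z.
  move=> hx hz l; have := hx l; have := hz l; rewrite !ler_norml; lra.
have cube0 (x : V) : cube x d x by move=> l; rewrite subrr normr0 ltW.
have cubeh (x : V) l (h : R) : `|h| <= d -> cube x d (x + h *: e_ l).
  move=> hd m; rewrite mxE addrAC subrr add0r mxE ebase_coord.
  by case: eqP => _; rewrite ?mulr1// mulr0 normr0 ltW.
have yA (h : R) l : `|h| <= d -> A (y + h *: e_ l).
  by move=> hd; apply: QA; apply: cubeD (cube0 _); exact: cubeh.
pose w (h : R) x := f (h *: e_ k + x) - f ((- h) *: e_ k + x).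
have step1 (h : R) : 0 < h -> h <= d -> `|dd j f (y + h *: e_ k) - dd j f (y + (- h) *: e_ k)|
    <= 18 * M * h / d ^+ 2.
  move=> h0 hd.
  have nh : `|h| <= d by rewrite gtr0_norm.
  have nh' : `|- h| <= d by rewrite normrN.
  pose A1 : set V := [set x | A (h *: e_ k + x)].
  pose A2 : set V := [set x | A ((- h) *: e_ k + x)].
  have oA12 : open (A1 `&` A2) by apply: openI; exact: open_trans.
  have s1 : smooth (A1 `&` A2) 2 (fun z => f (h *: e_ k + z)).
    by apply: smooth_sub (smooth_trans _ oA hf); exact: subIsetl.
  have s2 : smooth (A1 `&` A2) 2 (fun z => f ((- h) *: e_ k + z)).
    by apply: smooth_sub (smooth_trans _ oA hf); exact: subIsetr.
  have QA12 : cube y d `<=` A1 `&` A2.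
    move=> x Qx; split; rewrite /A1 /A2 /= addrC; apply: QA; apply: cubeD Qx _; exact: cubeh.
  have lapt (c x : V) : A (c + x) -> lap (fun z => f (c + z)) x = 0.
    move=> Ax; rewrite -(lf _ Ax); apply: eq_bigr => l _.
    by rewrite (dd_trans2 _ oA hf Ax).
  have bound t : 0 <= t <= d ->
      `|w h (y + t *: e_ j) - w h (y - t *: e_ j)| <= 2 * (18 * M * h / d ^+ 2) * t.
    move=> td.
    apply: le_trans (harmonic_difference j oA12 (smoothB oA12 s1 s2) (M := 6 * M * h / d) _ d0 QA12 _ td) _.
    - move=> x [Ax1 Ax2]; rewrite (lapB oA12 s1 s2)//.
      by rewrite !lapt// subrr.
    - move=> x Qx; rewrite [h *: e_ k + x]addrC [(- h) *: e_ k + x]addrC scaleNr.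
      apply: (harmonic_difference k oA hf lf d0).
      + by move=> z Qz; apply: QA; exact: cubeD Qz.
      + by move=> z Qz; apply: fM; exact: cubeD Qz.
      + by rewrite (ltW h0).
    - by rewrite le_eqVlt; apply/orP; left; apply/eqP; field; rewrite gt_eqF.
  rewrite [y + h *: e_ k]addrC [y + (- h) *: e_ k]addrC.
  apply: (derive_symmetric_bound (F := fun t => w h (y + t *: e_ j)) d0).
    apply: (is_derive_line (w h) y (e_ j) 0 _).1; rewrite scale0r addr0.
    apply: isdB.
      by apply: (isd_trans _ hf); rewrite addrC; exact: yA.
    by apply: (isd_trans _ hf); rewrite addrC; exact: yA.
  by move=> t td; rewrite scaleNr; exact: bound.
apply: (derive_symmetric_bound (F := fun t => dd j f (y + t *: e_ k)) d0).
  apply: (is_derive_line (dd j f) y (e_ k) 0 _).1; rewrite scale0r addr0.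
  apply: (smooth_isd _ (smooth_dd j hf)); rewrite -[y]addr0 -(scale0r (e_ k)).
  by apply: yA; rewrite normr0 ltW.
move=> t /andP[]; rewrite le_eqVlt => /predU1P[<- _|t0 td].
  by rewrite oppr0 subrr normr0 mulr0.
apply: le_trans (step1 _ t0 td) _.
by rewrite le_eqVlt; apply/orP; left; apply/eqP; field; rewrite gt_eqF.
Qed.

End harmonic_difference_estimate.

(** * Integrals depending on a parameter *)

Definition uniform_at {R : realType} {Y : Type} (B : set Y) (g : 'rV[R]_3 -> Y -> R)
    (x : 'rV[R]_3) := forall e : R, 0 < e -> exists2 r : R, 0 < r &
  forall x', enorm (x' - x) < r -> forall y, B y -> `|g x' y - g x y| <= e.

Section parametric_integrals.
Context {R : realType} {d : measure_display} {Y : measurableType d}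
  (mu : {measure set Y -> \bar R}) (B : set Y) (mB : measurable B)
  (fB : (mu B < +oo)%E).
Local Notation V := 'rV[R]_3.
Implicit Types (g : V -> Y -> R) (x v : V) (A : set V).

Definition good A g := forall x, A x ->
  mu.-integrable B (EFin \o g x) /\ uniform_at B g x.

Lemma integrable_cst (e : R) : mu.-integrable B (EFin \o (fun=> e)).
Proof.
apply/integrableP; split; first exact: measurable_cst.
rewrite (_ : (\int[mu]_(x in B) _ = \int[mu]_(x in B) cst `|e|%:E x)%E)// integral_cst//.
by rewrite lte_mul_pinfty// lee_fin.
Qed.

Lemma Rint_bound (f : Y -> R) (e : R) : mu.-integrable B (EFin \o f) ->
  (forall y, B y -> `|f y| <= e) -> `|\int[mu]_(y in B) f y| <= e * fine (mu B).
Proof.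
move=> fi fe; apply: le_trans (le_normr_Rintegral _ _) _ => //.
rewrite -Rintegral_cst//; apply: le_Rintegral => //.
  exact: integrable_norm.
exact: integrable_cst.
Qed.

Lemma good_cont A g x : open A -> good A g -> A x ->
  {for x, continuous (fun x => \int[mu]_(y in B) g x y)}.
Proof.
move=> oA hg Ax; apply/cont_enormP => e e0.
have [gi gu] := hg x Ax.
have m0 : 0 <= fine (mu B) by rewrite fine_ge0.
have e'0 : 0 < e / (fine (mu B) + 1) by rewrite divr_gt0// ltr_wpDl.
have [r r0 hr] := gu _ e'0.
have /nbhs_enormP[r' r'0 hr'] : nbhs x A by exact: open_nbhs_nbhs.
exists (Num.min r r'); first by rewrite lt_min r0.
move=> x'; rewrite lt_min => /andP[/hr xr /hr' Ax'].
have [gi' _] := hg x' Ax'.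
rewrite -RintegralB//.
apply: le_lt_trans (Rint_bound (e := e / (fine (mu B) + 1)) _ _) _ => //.
  exact: (integrableB mB gi' gi).
by rewrite mulrAC ltr_pdivrMr ?ltr_wpDl// ltr_pM2l// ltrDl.
Qed.

(** Near [x] the derivative stays within [1] of [g1 x y], uniformly in [y], so [|g1 x y| + 1]
    dominates and is integrable as [B] has finite measure. Restriction to the line [x + s *: v]
    leaves one real parameter. *)
Lemma good_isd A g g1 x v : open A -> good A g -> good A g1 ->
  (forall (x : V) y, A x -> B y -> is_derive x v (g^~ y) (g1 x y)) -> A x ->
  is_derive x v (fun x => \int[mu]_(y in B) g x y) (\int[mu]_(y in B) g1 x y).
Proof.
move=> oA hg hg1 dg Ax.
have /nbhs_enormP[r' r'0 hr'] : nbhs x A by exact: open_nbhs_nbhs.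
have [r r0 hr] := (hg1 x Ax).2 1 ltr01.
have v0 : 0 < enorm v + 1 by rewrite ltr_wpDl ?enorm_ge0.
pose t : R := Num.min r r' / (enorm v + 1).
have t0 : 0 < t by rewrite divr_gt0// lt_min r0.
have small (s : R) : `|s| < t -> enorm (x + s *: v - x) < r /\ enorm (x + s *: v - x) < r'.
  move=> st; apply/andP; rewrite -lt_min addrAC subrr add0r enormZ.
  apply: le_lt_trans (_ : `|s| * (enorm v + 1) < _).
    by rewrite ler_wpM2l// lerDl.
  by rewrite -ltr_pdivlMr.
pose f (s : R) y := g (x + s *: v) y.
have smallI (s : R) : `]- t, t[%classic s -> `|s| < t.
  by rewrite /= in_itv/= ltr_norml.
have df (s : R) y : `|s| < t -> B y -> is_derive s (1 : R) (f^~ y) (g1 (x + s *: v) y).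
  move=> st By; apply: (is_derive_line (g^~ y) x v s _).1.
  by apply: dg => //; apply: hr'; case: (small s st).
have I0 : `]- t, t[%classic (0 : R) by rewrite /= in_itv/= oppr_lt0 t0.
have H1 (s : R) : `]- t, t[%classic s -> mu.-integrable B (EFin \o f s).
  by move=> /smallI st; have [] := hg (x + s *: v) (hr' _ (small s st).2).
have H2 (s : R) y : `]- t, t[%classic s -> B y -> derivable (f^~ y) s 1.
  by move=> /smallI st By; have [] := df s y st By.
pose G y := `|g1 x y| + 1.
have G0 y : 0 <= G y by rewrite addr_ge0.
have [g1i _] := hg1 x Ax.
have iG : mu.-integrable B (EFin \o G).
  apply: (integrableD mB (f := fun y => `|g1 x y|%:E) (g := cst 1%E)).
    exact: integrable_norm.
  exact: integrable_cst.
have H3 (s : R) y : `]- t, t[%classic s -> B y -> `|partial1of2 f s y| <= G y.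
  move=> /smallI st By; rewrite partial1of2E (@derive_val _ _ _ _ _ _ _ (df s y st By)).
  have := hr _ (small s st).1 y By.
  rewrite /G; move: (g1 (x + s *: v) y) (g1 x y) => a b.
  by have := ler_normD (a - b) b; rewrite subrK; lra.
have C := cvg_differentiation_under_integral mB I0 H1 H2 G0 iG H3.
have E : \int[mu]_(y in B) partial1of2 f 0 y = \int[mu]_(y in B) g1 x y.
  apply: eq_Rintegral => y; rewrite inE => By.
  rewrite partial1of2E (@derive_val _ _ _ _ _ _ _ (df 0 y _ By)) ?normr0//.
  by rewrite scale0r addr0.
rewrite E in C.
have : is_derive (0 : R) (1 : R) (fun s => \int[mu]_(y in B) f s y) (\int[mu]_(y in B) g1 x y).
  have C' : h^-1 *: (((fun s => \int[mu]_(y in B) f s y) \o shift 0) (h *: 1)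
     - \int[mu]_(y in B) f 0 y) @[h --> (0 : R)^'] --> \int[mu]_(y in B) g1 x y.
    by under eq_fun do rewrite /= [_ *: 1]mulr1.
  by apply: DeriveDef; [apply/cvg_ex; eexists; exact: C'|exact: cvg_lim C'].
move/(is_derive_line (fun x => \int[mu]_(y in B) g x y) x v 0 _).2.
by rewrite scale0r addr0.
Qed.

End parametric_integrals.

Section compact_parameter.
Context {R : realType} {T : topologicalType} (B : set T).
Local Notation V := 'rV[R]_3.

(** By compactness the neighbourhoods of [x] attached to the points of [B] can be replaced by a
    single one. Values at [(y', x')] and [(y', x)] are compared through [g x y], hence the halved
    [e]. *)
Lemma compact_uniform_at (g : V -> T -> R) (x : V) : compact B ->
  (forall y, B y -> {for (y, x), continuous (fun z : T * V => g z.2 z.1)}) ->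
  uniform_at B g x.
Proof.
move=> /compact_near_coveringP/near_covering_withinP cB cg e e0.
have e20 : 0 < e / 2 by rewrite divr_gt0.
have /nbhs_enormP[r r0 hr] : nbhs x [set x' | B `<=` (fun y => `|g x' y - g x y| <= e)].
  apply: (cB _ (nbhs x) (fun x' y => `|g x' y - g x y| <= e)) => y By.
  have [[U W] /= [Uy Wx] UW] : nbhs (y, x) [set z | ball (g x y) (e / 2) (g z.2 z.1)].
    by apply: (cg y By); exact: nbhsx_ballx.
  exists (U, W) => //= -[y' x'] /= [Uy' Wx'] _.
  have := UW (y', x') (conj Uy' Wx').
  have := UW (y', x) (conj Uy' (nbhs_singleton Wx)).
  rewrite /ball/=; move: (g x y) (g x y') (g x' y') => a b c.
  by rewrite !ltr_norml ler_norml; lra.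
by exists r => // x' /hr.
Qed.

End compact_parameter.

(** * Averages of a function along a family of affine maps *)

Section averages.
Context {R : realType}.
Local Notation V := 'rV[R]_3.
Local Notation e_ := (ebase R).
Local Notation mu := (@lebesgue_measure R).
Implicit Types (w al be : R -> R) (b x : V) (f g : V -> R) (A C : set V).

(** One operator for two purposes: [al = 1] and [be s = ep * s] give means over segments,
    [al s = s^2] and [be = 0] give the radial integral [lame_q]. A partial derivative passes under
    the integral and multiplies the weight by [al]. *)
Definition avg w al be b f x : R :=
  \int[mu]_(s in `[0, 1]) (w s * f (al s *: x + be s *: b)).

Definition maps_into al be b A C :=
  forall (s : R) x, 0 <= s <= 1 -> A x -> C (al s *: x + be s *: b).

Let m01 : measurable (`[0%R, 1%R] : set (measurableTypeR R)).
Proof. exact: measurable_itv. Qed.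

Let fin01 : (mu `[0%R, 1%R] < +oo)%E.
Proof. by rewrite lebesgue_measure_itv/= lte_fin ltr01 -EFinB ltry. Qed.

Lemma avg_good w al be b f A C : open A ->
  continuous w -> continuous al -> continuous be ->
  maps_into al be b A C -> (forall x, C x -> {for x, continuous f}) ->
  good mu `[0, 1] A (fun x s => w s * f (al s *: x + be s *: b)).
Proof.
move=> oA cw ca cb AC cf x Ax.
have H (s : R) : 0 <= s <= 1 ->
    {for (s, x), continuous (fun z : R * V => w z.1 * f (al z.1 *: z.2 + be z.1 *: b))}.
  have c1 (h : R -> R) : continuous h -> {for (s, x), continuous (fun z : R * V => h z.1)}.
    by move=> ch; apply: (@continuous_comp _ _ _ fst h (s, x)); [exact: cvg_fst|exact: ch].
  move=> s01; apply: continuousM; first exact: c1.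
  apply: (@continuous_comp _ _ _ (fun z : R * V => al z.1 *: z.2 + be z.1 *: b) f (s, x)).
    apply: continuousD; last by apply: continuousZr_tmp; exact: c1.
    by apply: continuousZ; [exact: c1|exact: cvg_snd].
  exact/cf/AC.
split.
  apply: continuous_compact_integrable; first exact: segment_compact.
  apply: continuous_in_subspaceT => s; rewrite inE/= in_itv/= => s01.
  have := H s s01; move=> K.
  apply: (@continuous_comp _ _ _ (fun s : R => (s, x))
    (fun z : R * V => w z.1 * f (al z.1 *: z.2 + be z.1 *: b)) s) => //.
  move=> P [[U W] /= [Us Wx] UW]; apply: filterS Us => s' Us'.
  by apply: (UW (s', x)); split=> //; exact: nbhs_singleton.
by apply: compact_uniform_at; [exact: segment_compact|
  move=> s; rewrite /= in_itv/= => s01; exact: H].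
Qed.

Lemma avg_cont w al be b f A C x : open A ->
  continuous w -> continuous al -> continuous be ->
  maps_into al be b A C -> (forall x, C x -> {for x, continuous f}) -> A x ->
  {for x, continuous (avg w al be b f)}.
Proof.
move=> oA cw ca cb AC cf Ax.
exact: (good_cont m01 fin01 oA (avg_good oA cw ca cb AC cf)).
Qed.

Lemma continuousM1 w al : continuous w -> continuous al ->
  continuous (fun s : R => w s * al s).
Proof. by move=> cw ca s; apply: continuousM; [exact: cw|exact: ca]. Qed.

Lemma avg_isd w al be b f A C i x : open A -> open C ->
  continuous w -> continuous al -> continuous be ->
  maps_into al be b A C -> smooth C 1 f -> A x ->
  is_derive x (e_ i) (avg w al be b f)
    (avg (fun s => w s * al s) al be b (dd i f) x).
Proof.
move=> oA oC cw ca cb AC hf Ax.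
apply: (good_isd m01 fin01 oA (avg_good oA cw ca cb AC _) (avg_good oA (continuousM1 cw ca) ca cb AC _)) => //.
- by move=> z; exact: smooth_cont hf.
- by move=> z; exact: smooth_cont (smooth_dd i hf).
move=> {}x s {}Ax; rewrite /= in_itv/= => s01; rewrite -mulrA; apply: isdZ.
rewrite addrC; under eq_fun do rewrite addrC.
apply: (isd_affine (L := fun z => al s *: z)).
  by move=> h y z; rewrite scalerDr !scalerA [al s * h]mulrC.
apply: is_derive_eq.
  by apply: (smooth_dir _ oC hf); rewrite addrC; exact: AC.
rewrite (bigD1 i)//= big1 => [|k ki]; rewrite mxE ebase_coord.
  by rewrite eqxx mulr1 addr0.
by rewrite (negPf ki) mulr0 mul0r.
Qed.

Lemma avg_smooth w al be b f A C n : open A -> open C ->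
  continuous w -> continuous al -> continuous be ->
  maps_into al be b A C -> smooth C n f -> smooth A n (avg w al be b f).
Proof.
move=> oA oC cw ca cb AC; elim: n w cw f => [|n IH] w cw f hf.
  split=> // x Ax; apply: (avg_cont oA cw ca cb AC _ Ax).
  by move=> z; exact: smooth_cont hf.
split=> [x Ax|i].
  by apply: (avg_cont oA cw ca cb AC _ Ax) => z; exact: smooth_cont hf.
have hf1 : smooth C 1 f by apply: smooth_le hf.
have D (x : V) (Ax : A x) := avg_isd i oA oC cw ca cb AC hf1 Ax.
split=> [x Ax|]; first by have [] := D x Ax.
apply: smooth_ext (IH _ (continuousM1 cw ca) _ (smooth_dd i hf)) => // x Ax.
by rewrite (isd_dd (D x Ax)).
Qed.

Lemma avg_dd w al be b f A C i x : open A -> open C ->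
  continuous w -> continuous al -> continuous be ->
  maps_into al be b A C -> smooth C 1 f -> A x ->
  dd i (avg w al be b f) x = avg (fun s => w s * al s) al be b (dd i f) x.
Proof. by move=> oA oC cw ca cb AC hf Ax; exact/isd_dd/(avg_isd i oA oC). Qed.

Lemma avg_ext w al be b f g A C x : maps_into al be b A C ->
  (forall y, C y -> f y = g y) -> A x -> avg w al be b f x = avg w al be b g x.
Proof.
move=> AC fg Ax; apply: eq_Rintegral => s; rewrite inE/= in_itv/= => s01.
by rewrite fg//; exact: AC.
Qed.

Lemma avgD w al be b f g A C x : open A ->
  continuous w -> continuous al -> continuous be -> maps_into al be b A C ->
  (forall x, C x -> {for x, continuous f}) ->
  (forall x, C x -> {for x, continuous g}) -> A x ->
  avg w al be b (fun z => f z + g z) x = avg w al be b f x + avg w al be b g x.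
Proof.
move=> oA cw ca cb AC cf cg Ax; rewrite /avg -RintegralD//.
- by apply: eq_Rintegral => s _; rewrite mulrDr.
- exact: (avg_good oA cw ca cb AC cf Ax).1.
- exact: (avg_good oA cw ca cb AC cg Ax).1.
Qed.

Lemma avgZ w al be b (c : R) f A C x : open A ->
  continuous w -> continuous al -> continuous be -> maps_into al be b A C ->
  (forall x, C x -> {for x, continuous f}) -> A x ->
  avg w al be b (fun z => c * f z) x = c * avg w al be b f x.
Proof.
move=> oA cw ca cb AC cf Ax; rewrite /avg -RintegralZl//.
- by apply: eq_Rintegral => s _; rewrite mulrCA.
- exact: (avg_good oA cw ca cb AC cf Ax).1.
Qed.

Lemma avg0 w al be b x : avg w al be b (fun=> 0) x = 0.
Proof.
by rewrite /avg; under eq_Rintegral do rewrite mulr0; rewrite Rintegral_cst// mul0r.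
Qed.

Lemma FTC01 (F f : R -> R) : (forall s : R, 0 <= s <= 1 -> is_derive s (1 : R) F (f s)) ->
  (forall s : R, 0 <= s <= 1 -> {for s, continuous f}) ->
  \int[mu]_(s in `[0, 1]) f s = F 1 - F 0.
Proof.
move=> dF cf.
have cF (s : R) : 0 <= s <= 1 -> {for s, continuous F}.
  move=> s01; have [dFs _] := dF s s01.
  exact/differentiable_continuous/derivable1_diffP.
rewrite /Rintegral (@continuous_FTC2 _ f F 0 1)//.
- apply: continuous_in_subspaceT => s; rewrite inE/= in_itv/=; exact: cf.
- split.
  + by move=> s; rewrite in_itv/= => /andP[s0 s1]; have [] := dF s _; rewrite // !ltW.
  + by apply: cvg_at_right_filter; apply: cF; rewrite lexx ler01.
  + by apply: cvg_at_left_filter; apply: cF; rewrite lexx ler01.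
- move=> s; rewrite in_itv/= => /andP[s0 s1]; rewrite derive1E.
  by apply: (@derive_val _ _ _ _ _ _ _ (dF s _)); rewrite !ltW.
Qed.

End averages.

(** * Steklov averages: means over axis-parallel segments of length [ep] *)

Section steklov_averages.
Context {R : realType}.
Local Notation V := 'rV[R]_3.
Local Notation e_ := (ebase R).
Local Notation mu := (@lebesgue_measure R).
Implicit Types (x y v : V) (f g : V -> R) (i j : 'I_3) (ep r : R).

Definition steklov ep i f : V -> R :=
  avg (fun=> 1) (fun=> 1) (fun s : R => ep * s) (e_ i) f.

(** One average per direction, since averaging along [e_ i] creates a derivative along [e_ i]
    only. *)
Definition steklov3 ep f : V -> R := steklov ep o0 (steklov ep o1 (steklov ep o2 f)).

Lemma steklov_maps ep i r : 0 <= ep ->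
  maps_into (fun=> 1) (fun s : R => ep * s) (e_ i) (eball (r - ep)) (eball r).
Proof.
move=> ep0 s x /andP[s0 s1]; rewrite /eball/= scale1r => xr.
apply: le_lt_trans (enormDe _ _ _) _; rewrite -ltrBrDr; apply: lt_le_trans xr _.
rewrite lerD2l lerN2 ger0_norm ?mulr_ge0//.
by rewrite ler_piMr.
Qed.

Let c1 : continuous (fun _ : R => 1 : R). Proof. exact: cst_continuous. Qed.

Let cl ep : continuous (fun s : R => ep * s).
Proof. by move=> s; apply: continuousM; [exact: cst_continuous|exact: id]. Qed.

Let m01 : measurable (`[0%R, 1%R] : set (measurableTypeR R)).
Proof. exact: measurable_itv. Qed.

Let fin01 : (mu `[0%R, 1%R] < +oo)%E.
Proof. by rewrite lebesgue_measure_itv/= lte_fin ltr01 -EFinB ltry. Qed.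

Let oB r : open (eball r : set V). Proof. exact: open_eball. Qed.

Lemma steklov_cont ep i f r : 0 <= ep -> (forall x, eball r x -> {for x, continuous f}) ->
  forall x, eball (r - ep) x -> {for x, continuous (steklov ep i f)}.
Proof.
move=> ep0 cf x xr.
exact: (avg_cont (@oB _) (@c1) (@c1) (@cl ep) (@steklov_maps ep i r ep0) cf xr).
Qed.

Lemma steklov_isd ep i f f1 r v x : 0 <= ep ->
  (forall x, eball r x -> {for x, continuous f}) ->
  (forall x, eball r x -> {for x, continuous f1}) ->
  (forall x, eball r x -> is_derive x v f (f1 x)) -> eball (r - ep) x ->
  is_derive x v (steklov ep i f) (steklov ep i f1 x).
Proof.
move=> ep0 cf cf1 df xr.
have M := @steklov_maps ep i r ep0.
rewrite /steklov /avg; apply: (good_isd _ _ (@oB _) (avg_good (@oB _) (@c1) (@c1) (@cl ep) M cf)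
  (avg_good (@oB _) (@c1) (@c1) (@cl ep) M cf1)) xr.
- exact: m01.
- exact: fin01.
move=> {}x s xr; rewrite /= in_itv/= => s01; apply: isdZ.
rewrite addrC; under eq_fun do rewrite addrC.
apply: (isd_affine (L := fun z => 1 *: z)).
  by move=> h y z; rewrite !scale1r.
by rewrite [1 *: v]scale1r; apply: df; rewrite addrC; exact: M.
Qed.

(** Along the segment the average is [ep^-1] times an increment of a primitive [Phi] of [f], so its
    derivative is a difference quotient of [f] and continuity of [f] suffices. *)
Lemma steklov_isd_same ep i f r x : 0 < ep ->
  (forall x, eball r x -> {for x, continuous f}) -> eball (r - ep) x ->
  is_derive x (e_ i) (steklov ep i f) (ep^-1 * (f (x + ep *: e_ i) - f x)).
Proof.
move=> ep0 cf xr; pose eta := r - ep - enorm x.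
have eta0 : 0 < eta by rewrite subr_gt0.
pose phi (t : R) := f (x + t *: e_ i).
have cphi (t : R) : `|t| < ep + eta -> {for t, continuous phi}.
  move=> tl; apply: (@continuous_comp _ _ _ (fun t : R => x + t *: e_ i) f t).
    apply: continuousD; first exact: cst_continuous.
    exact: scalel_continuous.
  apply: cf; rewrite /eball/=; apply: le_lt_trans (enormDe _ _ _) _.
  by move: tl; rewrite /eta; lra.
(* The primitive lives on an interval exceeding [[0, ep]] on both sides, so that it can be
   differentiated at [0] and at [ep]. *)
pose a := - (eta / 2); pose u := ep + eta / 2.
have au (t : R) : a <= t <= u -> `|t| < ep + eta.
  by rewrite /a /u ltr_norml; lra.
have iphi : mu.-integrable `[a, u] (EFin \o phi).
  apply: continuous_compact_integrable; first exact: segment_compact.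
  apply: continuous_in_subspaceT => t; rewrite inE/= in_itv/= => tau.
  exact/cphi/au.
pose Phi (t : R) := \int[mu]_(s in `[a, t]) phi s.
have dPhi (t : R) : a < t -> t < u -> is_derive t (1 : R) Phi (phi t).
  move=> at_ tu; have [] := continuous_FTC1_closed tu iphi at_.
    by apply/cphi/au; rewrite !ltW.
  by move=> D E; apply: DeriveDef; [exact: D|exact: etrans (esym (derive1E _ _)) E].
have aff (h : R) (s : R) : is_derive s (1 : R) (fun s : R => h + ep * s) ep.
  apply: is_derive_eq (is_deriveD (is_derive_cst h s 1) (is_deriveZ ep (is_derive_id s 1))) _.
  by rewrite add0r; exact: mulr1.
have stekE (h : R) : `|h| < eta / 2 ->
    steklov ep i f (x + h *: e_ i) = ep^-1 * (Phi (ep + h) - Phi h).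
  move=> hl.
  have hs (s : R) : 0 <= s <= 1 -> a < h + ep * s /\ h + ep * s < u.
    move: hl; rewrite /a /u ltr_norml => /andP[h1 h2] /andP[s0 s1]; split; nra.
  transitivity (\int[mu]_(s in `[0, 1]) (phi (h + ep * s))).
    apply: eq_Rintegral => s _; rewrite mul1r scale1r /phi scalerDl addrA.
    by [].
  apply: etrans (@FTC01 _ (fun s => ep^-1 * Phi (h + ep * s)) (fun s => phi (h + ep * s)) _ _) _.
  - move=> s /hs[h1 h2].
    have D : is_derive s (1 : R) (Phi \o (fun s : R => h + ep * s)) (phi (h + ep * s) * ep).
      exact: (@is_derive1_comp _ Phi (fun s0 : R => h + ep * s0) s _ _ (dPhi _ h1 h2) (aff h s)).
    apply: is_derive_eq (is_deriveZ ep^-1 D) _.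
    by rewrite /GRing.scale/= mulrCA mulVf ?mulr1// gt_eqF.
  - move=> s /hs[h1 h2].
    apply: (@continuous_comp _ _ _ (fun s : R => h + ep * s) phi s).
      by apply: continuousD; [exact: cst_continuous|exact: cl].
    by apply/cphi/au; rewrite !ltW.
  - by rewrite mulr1 mulr0 addr0 -mulrBr [ep + h]addrC.
have key : is_derive (0 : R) (1 : R) (fun h : R => steklov ep i f (x + h *: e_ i))
    (ep^-1 * (phi ep - phi 0)).
  apply: (@near_eq_is_derive _ _ _ (fun h : R => ep^-1 * (Phi (ep + h) - Phi h))).
    apply/nbhs_ballP; exists (eta / 2) => /=; first by rewrite divr_gt0.
    by move=> h; rewrite /ball/= sub0r normrN => hl; rewrite stekE.
  have D1 : is_derive (0 : R) (1 : R) (Phi \o (fun h : R => ep + h)) (phi (ep + 0) * 1).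
    have D0 : is_derive (0 : R) (1 : R) (fun h : R => ep + h) 1.
      by apply: is_derive_eq (is_deriveD (is_derive_cst ep (0 : R) (1 : R))
        (is_derive_id (0 : R) (1 : R))) _; rewrite add0r.
    have D3 : is_derive (ep + 0) (1 : R) Phi (phi (ep + 0)).
      by apply: dPhi; rewrite addr0 /a /u; lra.
    exact: (@is_derive1_comp _ Phi (fun h : R => ep + h) 0 _ _ D3 D0).
  have D2 : is_derive (0 : R) (1 : R) Phi (phi 0).
    by apply: dPhi; rewrite /a /u; lra.
  apply: is_derive_eq (is_deriveZ ep^-1 (is_deriveB D1 D2)) _.
  by rewrite addr0 mulr1.
have := (is_derive_line (steklov ep i f) x (e_ i) 0 _).2 key.
by rewrite scale0r addr0 /phi scale0r addr0.
Qed.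

Lemma steklov_dd ep i j f r x : 0 <= ep -> smooth (eball r) 1 f -> eball (r - ep) x ->
  dd j (steklov ep i f) x = steklov ep i (dd j f) x.
Proof.
move=> ep0 hf xr; apply: isd_dd; apply: (@steklov_isd ep i f (dd j f) r) => //.
- by move=> y; exact: smooth_cont hf.
- by move=> y; exact: smooth_cont (smooth_dd j hf).
- by move=> y; exact: smooth_isd hf.
Qed.

Lemma steklov_smooth ep i f r n : 0 <= ep -> smooth (eball r) n f ->
  smooth (eball (r - ep)) n (steklov ep i f).
Proof.
move=> ep0 hf.
exact: (avg_smooth (@oB _) (@oB r) (@c1) (@c1) (@cl ep) (@steklov_maps ep i r ep0) hf).
Qed.

Lemma steklov_ext ep i f g r x : 0 <= ep -> (forall y, eball r y -> f y = g y) ->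
  eball (r - ep) x -> steklov ep i f x = steklov ep i g x.
Proof.
by move=> ep0 fg xr; apply: (avg_ext _ (@steklov_maps ep i r ep0)).
Qed.

Lemma eball_le r r' x : r <= r' -> eball r x -> eball r' x.
Proof. by move=> rr' xr; exact: lt_le_trans xr rr'. Qed.

Let quot ep i f := fun x => ep^-1 * (f (x + ep *: e_ i) - f x).

Let quot_cont ep i f r : 0 <= ep -> (forall x, eball r x -> {for x, continuous f}) ->
  forall x, eball (r - ep) x -> {for x, continuous (quot ep i f)}.
Proof.
move=> ep0 cf x xr; apply: contM; first exact: cst_continuous.
apply: contD; last first.
  by apply/contN/cf; apply: eball_le xr; rewrite gerBl.
apply: (cont_lip (G := fun z => z + ep *: e_ i) (K := 1)).
  by move=> a b; rewrite mul1r opprD addrACA subrr addr0.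
apply: cf; rewrite /eball/=; apply: le_lt_trans (enormDe _ _ _) _.
by move: xr; rewrite /eball/= ger0_norm//; lra.
Qed.

Lemma steklov3_dd ep j f r x : 0 <= ep -> smooth (eball r) 1 f ->
  eball (r - ep - ep - ep) x -> dd j (steklov3 ep f) x = steklov3 ep (dd j f) x.
Proof.
move=> ep0 hf xr.
rewrite (steklov_dd _ _ ep0 (steklov_smooth _ ep0 (steklov_smooth _ ep0 hf)) xr).
apply: (@steklov_ext _ _ _ _ (r - ep - ep)) => // y yr.
rewrite (steklov_dd _ _ ep0 (steklov_smooth _ ep0 hf) yr).
by apply: (@steklov_ext _ _ _ _ (r - ep)) => // z zr; exact: steklov_dd hf zr.
Qed.

(** Derivatives already present pass under the averages. In the base case the average in the
    direction of differentiation becomes a difference quotient while the two others remain. Each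
    average costs [ep] of radius. *)
Lemma steklov3_smooth ep f r n : 0 < ep -> smooth (eball r) n f ->
  smooth (eball (r - ep - ep - ep)) n.+1 (steklov3 ep f).
Proof.
move=> ep0; have ep0' := ltW ep0; elim: n f => [|n IH] f hf; last first.
  split=> [x|i].
    exact: smooth_cont (@steklov_smooth ep o0 _ _ _ ep0' (@steklov_smooth ep o1 _ _ _ ep0' (@steklov_smooth ep o2 _ _ _ ep0' hf))).
  have hf1 : smooth (eball r) 1 f by apply: smooth_le hf.
  split=> [x xr|].
    have h3 := @steklov_smooth ep o0 _ _ _ ep0' (@steklov_smooth ep o1 _ _ _ ep0' (@steklov_smooth ep o2 _ _ _ ep0' hf1)).
    by have [] := smooth_isd i h3 xr.
  apply: smooth_ext (IH _ (smooth_dd i hf)) => // x xr.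
  by rewrite (steklov3_dd _ ep0' hf1).
have cf : forall x, eball r x -> {for x, continuous f} by move=> x; exact: smooth_cont hf.
have c2 := @steklov_cont ep o2 _ _ ep0' cf.
have c12 := @steklov_cont ep o1 _ _ ep0' c2.
have c012 := @steklov_cont ep o0 _ _ ep0' c12.
split=> // i.
have [D cD qD] : exists2 D : V -> R, (forall x, eball (r - ep - ep - ep) x ->
    is_derive x (e_ i) (steklov3 ep f) (D x)) &
    (forall x, eball (r - ep - ep - ep) x -> {for x, continuous D}).
  move: i; apply: ord3P.
  - exists (quot ep o0 (steklov ep o1 (steklov ep o2 f))); last exact: quot_cont.
    by move=> x; exact: steklov_isd_same.
  - exists (steklov ep o0 (quot ep o1 (steklov ep o2 f))); last by apply: steklov_cont => //; exact: quot_cont.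
    move=> x; apply: steklov_isd => //; first exact: quot_cont.
    by move=> y; exact: steklov_isd_same.
  - exists (steklov ep o0 (steklov ep o1 (quot ep o2 f))).
      move=> x; apply: steklov_isd => //; first by apply: steklov_cont => //; exact: quot_cont.
      move=> y; apply: steklov_isd => //; first exact: quot_cont.
      by move=> z; exact: steklov_isd_same.
    by apply: steklov_cont => //; apply: steklov_cont => //; exact: quot_cont.
split=> [x xr|]; first by have [] := cD x xr.
split=> // x xr; apply: (@cont_ext _ _ D _ _ (@oB _) _ xr).
  by move=> y yr; rewrite (isd_dd (cD y yr)).
exact: qD.
Qed.

Lemma steklov_bound ep i f r x (c m : R) : 0 <= ep ->
  (forall x, eball r x -> {for x, continuous f}) -> eball (r - ep) x ->
  (forall y, enorm (y - x) <= ep -> `|f y - c| <= m) -> `|steklov ep i f x - c| <= m.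
Proof.
move=> ep0 cf xr hf.
have mu1 : fine (mu `[0%R, 1%R]) = 1.
  by rewrite lebesgue_measure_itv/= lte_fin ltr01 oppr0 adde0.
have gi := (avg_good (@oB _) (@c1) (@c1) (@cl ep) (@steklov_maps ep i r ep0) cf xr).1.
have ci := integrable_cst m01 fin01 c.
have cE : c = \int[mu]_(s in `[0, 1]) c by rewrite Rintegral_cst// mu1 mulr1.
rewrite {1}cE -RintegralB//.
apply: le_trans (Rint_bound m01 fin01 (e := m) _ _) _; last by rewrite mu1 mulr1.
  exact: (integrableB m01 gi ci).
move=> s; rewrite /= in_itv/= => /andP[s0 s1]; rewrite mul1r scale1r; apply: hf.
rewrite addrAC subrr add0r enormZ enorm_ebase mulr1 ger0_norm ?mulr_ge0//.
by rewrite ler_piMr.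
Qed.

Lemma steklov3_bound ep f r x (c m : R) : 0 <= ep ->
  (forall x, eball r x -> {for x, continuous f}) -> eball (r - ep - ep - ep) x ->
  (forall y, enorm (y - x) <= ep *+ 3 -> `|f y - c| <= m) -> `|steklov3 ep f x - c| <= m.
Proof.
move=> ep0 cf xr hf.
have c2 := @steklov_cont ep o2 _ _ ep0 cf.
have c12 := @steklov_cont ep o1 _ _ ep0 c2.
apply: (@steklov_bound ep o0 _ _ x c m ep0 c12 xr) => y yx.
have yr : eball (r - ep - ep) y.
  have := enorm_dist y x; move: xr yx; rewrite /eball/=; lra.
apply: (@steklov_bound ep o1 _ _ y c m ep0 c2 yr) => z zy.
have zr : eball (r - ep) z.
  have := enorm_dist z y; move: yr zy; rewrite /eball/=; lra.
apply: (@steklov_bound ep o2 _ _ z c m ep0 cf zr) => t tz; apply: hf.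
apply: le_trans (enorm_tri t z x) _; have := enorm_tri z y x.
by rewrite !mulrS mulr0n; lra.
Qed.

Lemma steklovD ep i f g r x : 0 <= ep -> (forall x, eball r x -> {for x, continuous f}) ->
  (forall x, eball r x -> {for x, continuous g}) -> eball (r - ep) x ->
  steklov ep i (fun z => f z + g z) x = steklov ep i f x + steklov ep i g x.
Proof.
move=> ep0 cf cg xr.
exact: (avgD (@oB _) (@c1) (@c1) (@cl ep) (@steklov_maps ep i r ep0) cf cg xr).
Qed.

Lemma steklovZ ep i (c : R) f r x : 0 <= ep -> (forall x, eball r x -> {for x, continuous f}) ->
  eball (r - ep) x -> steklov ep i (fun z => c * f z) x = c * steklov ep i f x.
Proof.
move=> ep0 cf xr.
exact: (avgZ c (@oB _) (@c1) (@c1) (@cl ep) (@steklov_maps ep i r ep0) cf xr).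
Qed.

Lemma steklov3D ep f g r x : 0 <= ep -> (forall x, eball r x -> {for x, continuous f}) ->
  (forall x, eball r x -> {for x, continuous g}) -> eball (r - ep - ep - ep) x ->
  steklov3 ep (fun z => f z + g z) x = steklov3 ep f x + steklov3 ep g x.
Proof.
move=> ep0 cf cg xr.
have f2 := @steklov_cont ep o2 _ _ ep0 cf; have g2 := @steklov_cont ep o2 _ _ ep0 cg.
have f12 := @steklov_cont ep o1 _ _ ep0 f2; have g12 := @steklov_cont ep o1 _ _ ep0 g2.
rewrite /steklov3 -(steklovD o0 ep0 f12 g12 xr); apply: (@steklov_ext _ _ _ _ (r - ep - ep)) => // y yr.
rewrite -(steklovD o1 ep0 f2 g2 yr); apply: (@steklov_ext _ _ _ _ (r - ep)) => // z zr.
exact: steklovD cf cg zr.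
Qed.

Lemma steklov3Z ep (c : R) f r x : 0 <= ep -> (forall x, eball r x -> {for x, continuous f}) ->
  eball (r - ep - ep - ep) x -> steklov3 ep (fun z => c * f z) x = c * steklov3 ep f x.
Proof.
move=> ep0 cf xr.
have f2 := @steklov_cont ep o2 _ _ ep0 cf; have f12 := @steklov_cont ep o1 _ _ ep0 f2.
rewrite /steklov3 -(steklovZ o0 c ep0 f12 xr); apply: (@steklov_ext _ _ _ _ (r - ep - ep)) => // y yr.
rewrite -(steklovZ o1 c ep0 f2 yr); apply: (@steklov_ext _ _ _ _ (r - ep)) => // z zr.
exact: steklovZ cf zr.
Qed.

Lemma steklov3_ext ep f g r x : 0 <= ep -> (forall y, eball r y -> f y = g y) ->
  eball (r - ep - ep - ep) x -> steklov3 ep f x = steklov3 ep g x.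
Proof.
move=> ep0 fg xr; apply: (steklov_ext o0 ep0 _ xr) => y yr.
by apply: (steklov_ext o1 ep0 _ yr) => z zr; exact: (steklov_ext o2 ep0 fg zr).
Qed.

Lemma steklov3_0 ep x : steklov3 ep (fun=> 0) x = 0.
Proof.
have E i : steklov ep i (fun=> 0) = (fun=> 0 : R) by apply/funext => y; exact: avg0.
by rewrite /steklov3 !E.
Qed.

End steklov_averages.

(** * Decomposition of a Lame solution as [v + (1 - |x|^2) q] *)

Section lame_decomposition.
Context {R : realType}.
Local Notation V := 'rV[R]_3.
Local Notation e_ := (ebase R).
Local Notation mu_L := (@lebesgue_measure R).
Implicit Types (x y : V) (i j k : 'I_3).

Variables (mu lam r : R) (U : 'I_3 -> V -> R).
Hypotheses (mu0 : 0 < mu) (ml0 : 0 < mu *+ 2 + lam).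
Hypothesis sU : forall k, smooth (eball r) 4 (U k).
Hypothesis lameU : forall k x, eball r x ->
  mu * lap (U k) x + (lam + mu) * \sum_j dd k (dd j (U j)) x = 0.

Local Notation A := (eball r : set V).
Let oA : open A. Proof. exact: open_eball. Qed.

(** The system reads [lap U + kappa * grad (div U) = 0], and the condition on the Lame constants
    becomes [1 + kappa > 0]. *)
Definition kappa : R := (lam + mu) / mu.
Let d x := \sum_j dd j (U j) x.
Let dk k := dd k d.

Lemma kappa_gt : 0 < 1 + kappa.
Proof.
rewrite /kappa -{1}(divff (lt0r_neq0 mu0)) -mulrDl divr_gt0//.
by move: ml0; rewrite mulr2n; lra.
Qed.

Let sd : smooth A 3 d.
Proof. by apply: (smooth_sum (@oA)) => j; exact: smooth_dd. Qed.

Let sdk k : smooth A 2 (dk k). Proof. exact: smooth_dd sd. Qed.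

Let dkE k x : A x -> dk k x = \sum_j dd k (dd j (U j)) x.
Proof.
move=> Ax; apply: isd_dd; apply: isd_sum => j.
exact: smooth_isd (smooth_dd j (sU j)) Ax.
Qed.

Let lapU k x : A x -> lap (U k) x = - kappa * dk k x.
Proof.
move=> Ax; have := lameU k Ax; rewrite -dkE// => H.
apply: (@mulfI _ mu); first by rewrite gt_eqF.
have -> : mu * (- kappa * dk k x) = - ((lam + mu) * dk k x).
  by rewrite /kappa; field; rewrite gt_eqF.
by apply/eqP; rewrite -subr_eq0 opprK; apply/eqP.
Qed.

Let dd_sum i (F : 'I_3 -> V -> R) x : (forall j, smooth A 1 (F j)) -> A x ->
  dd i (fun z => \sum_j F j z) x = \sum_j dd i (F j) x.
Proof.
by move=> sF Ax; apply/isd_dd/isd_sum => j; exact: smooth_isd (sF j) Ax.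
Qed.

(** The divergence of the system is [(1 + kappa) * lap d = 0]. *)
Let lapd x : A x -> lap d x = 0.
Proof.
move=> Ax.
have H k : dd k (lap (U k)) x = - kappa * dd k (dk k) x.
  rewrite (dd_ext k oA (g := fun z => - kappa * dk k z) (lapU k) Ax).
  by apply/isd_dd/isdZ; exact: smooth_isd (sdk k) Ax.
have S : \sum_k dd k (lap (U k)) x = lap d x.
  rewrite /lap.
  transitivity (\sum_k \sum_j dd j (dd j (dd k (U k))) x).
    apply: eq_bigr => k _.
    rewrite dd_sum//; last by move=> j; apply: smooth_le (smooth_dd j (smooth_dd j (sU k))).
    apply: eq_bigr => j _.
    rewrite (smooth_schwarz k j oA (smooth_dd j (sU k)) Ax).
    apply: (dd_ext _ oA) => // y Ay.
    exact: (smooth_schwarz k j oA (sU k) Ay).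
  rewrite exchange_big/=; apply: eq_bigr => j _.
  rewrite -dd_sum//; last by move=> k; apply: smooth_le (smooth_dd j (smooth_dd k (sU k))).
  apply: (dd_ext _ oA) => // y Ay; rewrite dd_sum//.
  by move=> k; apply: smooth_le (smooth_dd k (sU k)).
have : (1 + kappa) * lap d x = 0.
  rewrite mulrDl mul1r -{1}S (eq_bigr _ (fun k _ => H k)) -mulr_sumr.
  by rewrite /lap /dk mulNr addNr.
by move/eqP; rewrite mulf_eq0 (gt_eqF kappa_gt)/= => /eqP.
Qed.

Let lapdk k x : A x -> lap (dk k) x = 0.
Proof.
move=> Ax; rewrite /lap.
transitivity (\sum_j dd k (dd j (dd j d)) x).
  apply: eq_bigr => j _; rewrite (smooth_schwarz k j oA (smooth_dd j sd) Ax).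
  by apply: (dd_ext _ oA) => // y Ay; exact: (smooth_schwarz j k oA sd Ay).
rewrite -dd_sum//; last by move=> j; exact: smooth_dd (smooth_dd j sd).
rewrite (dd_ext k oA (g := fun=> 0) lapd Ax).
exact: isd_dd (isd_cst 0 x (e_ k)).
Qed.

(** Dilation by [s^2] instead of [s] keeps the weights polynomial: in the variable [s^2] the
    solution of the radial equation for [q] carries a half-integer power. *)
Let sq (s : R) := s ^+ 2.
Let csq : continuous sq.
Proof. by move=> s; exact: exprn_continuous. Qed.

Let cz : continuous (fun _ : R => 0 : R). Proof. exact: cst_continuous. Qed.

Let mapsA : maps_into sq (fun=> 0) 0 A A.
Proof.
move=> s x /andP[s0 s1] Ax; rewrite scaler0 addr0 /eball/= enormZ.
rewrite ger0_norm ?sqr_ge0//; apply: le_lt_trans Ax.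
by rewrite ler_piMl ?enorm_ge0// exprn_ile1.
Qed.

Let AV (w : R -> R) f := avg w sq (fun=> 0) 0 f.
Let w0 (s : R) := kappa / 2 * sq s.
Let cw0 : continuous w0.
Proof. by apply: continuousM1; [exact: cst_continuous|exact: csq]. Qed.
Let w1 (s : R) := w0 s * sq s.
Let cw1 : continuous w1. Proof. by apply: continuousM1; [exact: cw0|exact: csq]. Qed.
Let w2 (s : R) := w1 s * sq s.
Let cw2 : continuous w2. Proof. by apply: continuousM1; [exact: cw1|exact: csq]. Qed.

(* [q] solves [3 q + 2 (x . grad) q = kappa / 2 * grad (div U)], which is what makes
   [U - (1 - |x|^2) q] harmonic. *)
Definition lame_q k : V -> R :=
  avg (fun s => kappa / 2 * s ^+ 2) (fun s => s ^+ 2) (fun=> 0) 0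
    (dd k (fun x => \sum_j dd j (U j) x)).
Local Notation q := lame_q.

Let sq_ k : smooth A 2 (q k).
Proof. exact: (avg_smooth (@oA) (@oA) (@cw0) (@csq) (@cz) (@mapsA) (sdk k)). Qed.

Let ddq j k x : A x -> dd j (q k) x = AV w1 (dd j (dk k)) x.
Proof.
move=> Ax; have s1 := smooth_le (isT : (1 <= 2)%N) (sdk k).
exact: (avg_dd j (@oA) (@oA) (@cw0) (@csq) (@cz) (@mapsA) s1 Ax).
Qed.

Let AV_sum w (F : 'I_3 -> V -> R) x : continuous w -> (forall j, smooth A 0 (F j)) ->
  A x -> AV w (fun z => \sum_j F j z) x = \sum_j AV w (F j) x.
Proof.
move=> cw sF Ax; have c j y : A y -> {for y, continuous (F j)} by exact: smooth_cont (sF j).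
rewrite sum3 -(avgD (@oA) cw (@csq) (@cz) (@mapsA) (c o0) (c o1) Ax).
rewrite -(avgD (@oA) cw (@csq) (@cz) (@mapsA) (fun y Ay => contD (c o0 y Ay) (c o1 y Ay)) (c o2) Ax).
by apply: (avg_ext _ (@mapsA)) Ax => y _; rewrite sum3.
Qed.

Let AV_0 w f x : (forall y, A y -> f y = 0) -> A x -> AV w f x = 0.
Proof. by move=> f0 Ax; rewrite /AV (avg_ext w (@mapsA) f0 Ax) avg0. Qed.

Let lapq k x : A x -> lap (q k) x = 0.
Proof.
move=> Ax; rewrite /lap.
transitivity (\sum_j AV w2 (dd j (dd j (dk k))) x).
  apply: eq_bigr => j _.
  rewrite (dd_ext j oA (g := AV w1 (dd j (dk k))) (ddq j k) Ax).
  exact: (avg_dd j (@oA) (@oA) (@cw1) (@csq) (@cz) (@mapsA) (smooth_dd j (sdk k)) Ax).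
rewrite -AV_sum//; last by move=> j; exact: smooth_dd (smooth_dd j (sdk k)).
exact: AV_0 (lapdk k) Ax.
Qed.

(** [q] averages dilates of the gradient of the harmonic function [d], hence is curl free and,
    below, divergence free; [lame_div_v] uses both. *)
Let curlq j k x : A x -> dd j (q k) x = dd k (q j) x.
Proof.
move=> Ax; rewrite !ddq//; apply: (avg_ext _ (@mapsA)) Ax => y Ay.
exact: (smooth_schwarz j k oA sd Ay).
Qed.

Let divq x : A x -> \sum_j dd j (q j) x = 0.
Proof.
move=> Ax; rewrite (eq_bigr _ (fun j _ => ddq j j Ax)) -AV_sum//.
  exact: AV_0 lapd Ax.
by move=> j; apply: smooth_le (smooth_dd j (sdk j)).
Qed.

(** The left side is the integral over [[0, 1]] of the derivative of
    [kappa / 2 * s^3 * dk k (s^2 *: x)], which vanishes at [s = 0]. *)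
Let odeq k x : A x -> 3 * q k x + 2 * \sum_j x 0 j * dd j (q k) x = kappa / 2 * dk k x.
Proof.
move=> Ax.
have Asx (s : R) : 0 <= s <= 1 -> A (s ^+ 2 *: x).
  by move=> s01; have := mapsA s01 Ax; rewrite scaler0 addr0.
pose L (s : R) := \sum_j x 0 j * dd j (dk k) (s ^+ 2 *: x).
pose F (s : R) := kappa / 2 * (s ^+ 3 * dk k (s ^+ 2 *: x)).
pose f (s : R) := 3 * (w0 s * dk k (s ^+ 2 *: x)) + 2 * (w1 s * L s).
have cn (g : V -> R) (s : R) : {for s ^+ 2 *: x, continuous g} ->
    {for s, continuous (fun s : R => g (s ^+ 2 *: x))}.
  move=> cg; apply: (@continuous_comp _ _ _ (fun s : R => s ^+ 2 *: x) g s); last exact: cg.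
  by apply: continuousZr_tmp; exact: exprn_continuous.
have I : \int[mu_L]_(s in `[0, 1]) f s = F 1 - F 0.
  apply: FTC01 => s s01.
    have D1 : is_derive (s ^+ 2) (1 : R) (fun t : R => dk k (t *: x)) (L s).
      have := smooth_dir x oA (sdk k) (Asx s s01).
      rewrite -[s ^+ 2 *: x in X in X -> _]add0r => /(is_derive_line (dk k) 0 x (s ^+ 2) _).1.
      by under eq_fun do rewrite add0r; rewrite add0r.
    have D2 : is_derive s (1 : R) (fun s : R => s ^+ 2) (2 * s).
      by apply: is_derive_eq; rewrite /GRing.scale/= ?expr1 ?mulr1 mulr_natl.
    have D3 : is_derive s (1 : R) (fun s : R => s ^+ 3) (3 * s ^+ 2).
      by apply: is_derive_eq; rewrite /GRing.scale/=; ring.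
    have D12 := @is_derive1_comp _ (fun t : R => dk k (t *: x)) (fun s : R => s ^+ 2) s _ _ D1 D2.
    apply: is_derive_eq (is_deriveZ (kappa / 2) (is_deriveM D3 D12)) _.
    rewrite /f /w1 /w0 /sq /GRing.scale/=.
    move: (L s) (dk k (s ^+ 2 *: x)) => a b; ring.
  have cdk := cn (dk k) s (smooth_cont (sdk k) (Asx s s01)).
  have cLj j := cn (dd j (dk k)) s (smooth_cont (smooth_dd j (sdk k)) (Asx s s01)).
  have cL : {for s, continuous L}.
    rewrite (_ : L = fun s => x 0 o0 * dd o0 (dk k) (s ^+ 2 *: x) +
       x 0 o1 * dd o1 (dk k) (s ^+ 2 *: x) + x 0 o2 * dd o2 (dk k) (s ^+ 2 *: x)).
      apply: continuousD; first apply: continuousD;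
        by apply: continuousM; [exact: cst_continuous|exact: cLj].
    by apply/funext => t; rewrite /L sum3.
  apply: continuousD; apply: continuousM; try exact: cst_continuous.
    by apply: continuousM; [exact: cw0|exact: cdk].
  by apply: continuousM; [exact: cw1|exact: cL].
have -> : kappa / 2 * dk k x = F 1 - F 0.
  by rewrite /F !expr1n mul1r scale1r expr0n/= mul0r mulr0 subr0.
rewrite -I (eq_bigr _ (fun j _ => congr1 (fun t => x 0 j * t) (ddq j k Ax))).
pose h (y : V) := \sum_j x 0 j * dd j (dk k) y.
have sh : smooth A 0 h.
  apply: smooth_sum => // j; apply: smoothZ => //.
  by apply: smooth_le (smooth_dd j (sdk k)).
have -> : \sum_j x 0 j * AV w1 (dd j (dk k)) x = AV w1 h x.
  rewrite AV_sum//; last first.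
    move=> j; apply: smoothZ => //.
    by apply: smooth_le (smooth_dd j (sdk k)).
  apply: eq_bigr => j _; apply/esym.
  apply: (avgZ _ (@oA) (@cw1) (@csq) (@cz) (@mapsA) _ Ax) => y.
  exact: smooth_cont (smooth_dd j (sdk k)).
have g0 := (avg_good (@oA) (@cw0) (@csq) (@cz) (@mapsA) (fun y => smooth_cont (sdk k)) Ax).1.
have g1 := (avg_good (@oA) (@cw1) (@csq) (@cz) (@mapsA) (fun y => smooth_cont sh) Ax).1.
have m01 : measurable (`[0%R, 1%R] : set (measurableTypeR R)) by exact: measurable_itv.
rewrite -[3 * _](RintegralZl _ m01 g0) -[2 * _](RintegralZl _ m01 g1).
rewrite -(RintegralD m01 (integrableZl m01 3 g0) (integrableZl m01 2 g1)).
by apply: eq_Rintegral => s _; rewrite scaler0 addr0.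
Qed.

Definition lame_v k x : R := U k x - (1 - enorm x ^+ 2) * q k x.
Local Notation v := lame_v.

Let sb : smooth A 2 (fun x => 1 - enorm x ^+ 2).
Proof.
apply: smoothB => //; first exact: smooth_cst.
apply: smooth_ext (smooth_sum (@oA) (F := fun k z => z 0 k * z 0 k) _) => // [y _|k].
  by rewrite enorm_sqr; apply: eq_bigr => k _; rewrite expr2.
by apply: smoothM => //; exact: smooth_coord.
Qed.

Lemma lame_v_smooth k : smooth A 2 (v k).
Proof.
apply: smoothB => //; first by apply: smooth_le (sU k).
by apply: smoothM => //; exact: sq_.
Qed.

Let isd_b j x : is_derive x (e_ j) (fun z : V => 1 - enorm z ^+ 2) (- (2 * x 0 j)).
Proof.
apply: is_derive_eq (isdB (isd_cst 1 x (e_ j)) (isd_enorm_sqr x (e_ j))) _.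
rewrite sub0r (bigD1 j)//= big1 => [|k kj]; rewrite ebase_coord.
  by rewrite eqxx mulr1 addr0.
by rewrite (negPf kj) mulr0.
Qed.

Let v1 k j x := dd j (U k) x - (- (2 * x 0 j) * q k x + (1 - enorm x ^+ 2) * dd j (q k) x).

Let isd_v k j x : A x -> is_derive x (e_ j) (v k) (v1 k j x).
Proof.
move=> Ax; apply: isdB (smooth_isd j (sU k) Ax) _.
exact: isdM (isd_b j x) (smooth_isd j (sq_ k) Ax).
Qed.

(** As [q] is harmonic, the Laplacian of [(1 - |x|^2) q] is [-2 (3 q + 2 (x . grad) q)]; by [odeq]
    this is [- kappa * dk k], the Laplacian of [U k]. *)
Lemma lame_v_harmonic k x : A x -> lap (v k) x = 0.
Proof.
move=> Ax; rewrite /lap.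
have H j : dd j (dd j (v k)) x = dd j (dd j (U k)) x + 2 * q k x
    + 4 * (x 0 j * dd j (q k) x) - (1 - enorm x ^+ 2) * dd j (dd j (q k)) x.
  apply: (isd2 oA Ax (f1 := v1 k j)); first by move=> y; exact: isd_v.
  apply: is_derive_eq.
    apply: isdB (smooth_isd j (smooth_dd j (sU k)) Ax) _.
    apply: isdD; last exact: isdM (isd_b j x) (smooth_isd j (smooth_dd j (sq_ k)) Ax).
    apply: isdM (smooth_isd j (sq_ k) Ax).
    exact: isdN (isdZ 2 (isd_coord x (e_ j) j)).
  rewrite ebase_coord eqxx/=.
  move: (dd j (dd j (U k)) x) (dd j (dd j (q k)) x) (dd j (q k) x) (q k x) => a b c e.
  by move: (enorm x) (x 0 j) => ? ?; ring.
rewrite (eq_bigr _ (fun j _ => H j)) sumrB !big_split/=.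
have L1 := lapU k Ax; have L2 := lapq k Ax; have O := odeq k Ax.
rewrite /lap in L1 L2; rewrite L1 -!mulr_sumr L2 mulr0 subr0.
rewrite [\sum_(i < 3) q k x]sum3.
by move: O; move: (\sum_j _) (dk k x) (q k x) => S a b; lra.
Qed.

Lemma lame_vE k x : U k x = v k x + (1 - enorm x ^+ 2) * q k x.
Proof. by rewrite /v subrK. Qed.

(** Since [q] is divergence free, [div v = div U + 2 (x . q)]. Differentiating, [curlq] turns
    [x . d_k q] into the radial derivative of [q k], and [odeq] eliminates [div U]. *)
Lemma lame_div_v k x : A x -> kappa * \sum_j dd k (dd j (v j)) x =
  (6 + 2 * kappa) * q k x + (4 + 2 * kappa) * \sum_j x 0 j * dd j (q k) x.
Proof.
move=> Ax.
rewrite -(dd_sum k (F := fun j => dd j (v j))) => [||//]; last first.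
  by move=> j; exact: smooth_dd (lame_v_smooth j).
have E y : A y -> \sum_j dd j (v j) y = d y + 2 * \sum_j y 0 j * q j y.
  move=> Ay; rewrite (eq_bigr _ (fun j _ => isd_dd (isd_v j j Ay))) sumrB big_split/=.
  rewrite -mulr_sumr (divq Ay) mulr0 addr0 -/(d y) mulr_sumr -sumrN; congr (_ + _).
  by apply: eq_bigr => j _; rewrite mulNr opprK mulrA.
rewrite (dd_ext k oA E Ax).
have D : is_derive x (e_ k) (fun y => d y + 2 * \sum_j y 0 j * q j y)
   (dk k x + 2 * \sum_j (e_ k 0 j * q j x + x 0 j * dd k (q j) x)).
  apply: isdD (smooth_isd k sd Ax) _; apply: isdZ; apply: isd_sum => j.
  exact: isdM (isd_coord x (e_ k) j) (smooth_isd k (sq_ j) Ax).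
rewrite (isd_dd D) big_split/=.
rewrite [X in X + \sum_j x 0 j * _](_ : _ = q k x); last first.
  rewrite (bigD1 k)//= big1 => [|j jk]; rewrite ebase_coord.
    by rewrite eqxx mul1r addr0.
  by rewrite (negPf jk) mul0r.
rewrite (eq_bigr _ (fun j _ => congr1 (fun t => x 0 j * t) (curlq k j Ax))).
have := odeq k Ax; move: (\sum_j _) (dk k x) (q k x) => S a b H.
have -> : kappa * (a + 2 * (b + S)) = 2 * (kappa / 2 * a) + 2 * kappa * b + 2 * kappa * S.
  by field.
by rewrite -H; ring.
Qed.

(* At a maximum over [0 <= s <= 1] of [q (s x) (1 - s |x|)] the radial derivative
   is nonnegative, and [lame_div_v] turns this into a bound for the maximum. *)
Let ray_bound k x (c B : R) : enorm x < 1 -> 1 < r -> `|c| = 1 ->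
  (forall s : R, 0 <= s <= 1 ->
    `|\sum_j dd k (dd j (v j)) (s *: x)| <= B / (1 - s * enorm x) ^+ 2) ->
  c * q k x * (1 - enorm x) <= `|kappa| * B / (4 + 2 * kappa).
Proof.
move=> x1 r1 c1 hB.
have Asx (s : R) : 0 <= s <= 1 -> A (s *: x).
  move=> /andP[s0 s1]; rewrite /eball/= enormZ ger0_norm//.
  by apply: lt_trans r1; apply: le_lt_trans x1; rewrite ler_piMl ?enorm_ge0.
pose m (s : R) := c * q k (s *: x) * (1 - s * enorm x).
pose y' (s : R) := \sum_j x 0 j * dd j (q k) (s *: x).
have dq (s : R) : 0 <= s <= 1 -> is_derive s (1 : R) (fun s : R => q k (s *: x)) (y' s).
  move=> s01; have := smooth_dir x oA (sq_ k) (Asx s s01).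
  rewrite -[s *: x in X in X -> _]add0r => /(is_derive_line (q k) 0 x s _).1.
  by under eq_fun do rewrite add0r; rewrite add0r.
have dm (s : R) : 0 <= s <= 1 -> is_derive s (1 : R) m
    (c * y' s * (1 - s * enorm x) - c * q k (s *: x) * enorm x).
  move=> s01.
  have D1 := is_deriveZ c (dq s s01).
  have D2 : is_derive s (1 : R) (fun s : R => 1 - s * enorm x) (- enorm x).
    by apply: is_derive_eq; rewrite /GRing.scale/=; ring.
  apply: is_derive_eq (is_deriveM D1 D2) _.
  transitivity (c * q k (s *: x) * - enorm x + (1 - s * enorm x) * (c * y' s)) => //.
  by move: (q k (s *: x)) (y' s) => ? ?; ring.
have cm : {within `[0, 1], continuous m}.
  apply: derivable_within_continuous => s; rewrite in_itv/= => s01.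
  by have [] := dm s s01.
have [s] := EVT_max ler01 cm; rewrite in_itv/= => s01 maxm.
have -> : c * q k x * (1 - enorm x) = m 1 by rewrite /m scale1r mul1r.
apply: le_trans (maxm 1 _) _; first by rewrite in_itv/= ler01 lexx.
(* The factor [s] settles the endpoint [s = 0]; elsewhere a negative derivative would make [m]
   larger slightly to the left, still inside [[0, 1]]. *)
have sder : 0 <= s * (c * y' s * (1 - s * enorm x) - c * q k (s *: x) * enorm x).
  have [s0 s1] := andP s01.
  have [->|sn0] := eqVneq s 0; first by rewrite mul0r.
  have {sn0 s0} s0 : 0 < s by rewrite lt_neqAle eq_sym sn0.
  rewrite pmulr_rge0// leNgt; apply/negP => dneg.
  have dneg' : 0 < - (c * y' s * (1 - s * enorm x) - c * q k (s *: x) * enorm x) / 2.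
    by rewrite divr_gt0// oppr_gt0.
  have [t t0 ht] := is_derive_eps1 (dm s s01) dneg'.
  have [h [h0 hs ht']] := exists_pos_lt2 s0 t0.
  have := ht (- h); rewrite normrN gtr0_norm// => /(_ ht').
  have := maxm (s - h); rewrite in_itv/= => H; have {H} := H ltac:(lra).
  move: dneg; set D := c * y' s * _ - _; move: (m (s - h)) (m s) D => a b D.
  by rewrite ler_norml => D0 ab /andP[+ _]; nra.
have := lame_div_v k (Asx s s01).
have -> : \sum_j (s *: x) 0 j * dd j (q k) (s *: x) = s * y' s.
  by rewrite mulr_sumr; apply: eq_bigr => j _; rewrite mxE mulrA.
have := hB s s01; rewrite /m; move: sder.
have kg := kappa_gt.
have k4 : 0 < 4 + 2 * kappa by lra.
have sx1 : s * enorm x < 1.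
  have [s0 s1] := andP s01.
  by apply: le_lt_trans x1; rewrite ler_piMl ?enorm_ge0.
have sx0 : 0 <= s * enorm x by rewrite mulr_ge0 ?enorm_ge0//; case/andP: s01.
move: (\sum_j dd k _ _) (y' s) (q k (s *: x)) => G Y Q.
have -> : s * (c * Y * (1 - s * enorm x) - c * Q * enorm x) =
  c * (s * Y) * (1 - s * enorm x) - c * Q * (s * enorm x) by ring.
move: sx1 sx0; move: (s * Y) (s * enorm x) => Z p p1 p0 H1 H2 H3.
have p10 : 0 < 1 - p by lra.
rewrite ler_pdivlMr//.
have [cQ|cQ] := leP 0 (c * Q); last first.
  have B0 : 0 <= B.
    by have := le_trans (normr_ge0 _) H2; rewrite pmulr_lge0// invr_gt0 exprn_gt0.
  apply: le_trans (_ : 0 <= _); last by rewrite mulr_ge0.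
  rewrite -[c * Q * (1 - p) * _]mulrA; apply: mulr_le0_ge0; first exact: ltW.
  by apply: mulr_ge0; exact: ltW.
have kG : c * (kappa * G) * (1 - p) ^+ 2 <= `|kappa| * B.
  apply: le_trans (ler_norm _) _.
  rewrite normrM [`|c * _|]normrM [`|kappa * _|]normrM c1 mul1r.
  rewrite -mulrA ler_wpM2l//.
  by rewrite [`|(1 - p) ^+ 2|]ger0_norm ?sqr_ge0// -ler_pdivlMr ?exprn_gt0.
apply: le_trans kG; rewrite H3 -subr_ge0.
(* The first summand is nonnegative by the radial derivative at the maximum, the second by the case
   [0 <= c * Q]. *)
rewrite (_ : _ - _ = (4 + 2 * kappa) * (1 - p) * (c * Z * (1 - p) - c * Q * p)
  + 2 * (c * Q) * (1 - p) ^+ 2); last by ring.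
apply: addr_ge0; first by apply: mulr_ge0 => //; apply: mulr_ge0; exact: ltW.
by apply: mulr_ge0; [exact: mulr_ge0|exact: sqr_ge0].
Qed.

Lemma lame_q_bound k x (B : R) : enorm x < 1 -> 1 < r ->
  (forall s : R, 0 <= s <= 1 ->
    `|\sum_j dd k (dd j (v j)) (s *: x)| <= B / (1 - s * enorm x) ^+ 2) ->
  `|q k x| * (1 - enorm x) <= `|kappa| * B / (4 + 2 * kappa).
Proof.
move=> x1 r1 hB; have [q0|q0] := leP 0 (q k x).
  by rewrite (ger0_norm q0); have := ray_bound x1 r1 (normr1 R) hB; rewrite mul1r.
by rewrite (ltr0_norm q0); have := ray_bound x1 r1 (normrN1 R) hB; rewrite mulN1r.
Qed.

End lame_decomposition.

(** * Measurability of open sets and continuous functions in the plane *)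

Section plane_measurability.
Context {R : realType}.
Local Notation T := (measurableTypeR R).

(** The product sigma-algebra is generated by rectangles, so the open set is exhausted by the
    countably many rational rectangles inside it. *)
Lemma open_measurable2 (A : set (R * R)) : open A -> measurable (A : set (T * T)).
Proof.
move=> oA.
pose rect (p : (rat * rat) * (rat * rat)) : set (T * T) :=
  `](ratr p.1.1 : R), (ratr p.1.2 : R)[%classic `*` `](ratr p.2.1 : R), (ratr p.2.2 : R)[%classic.
have -> : (A : set (T * T)) = \bigcup_p (if pselect (rect p `<=` A) then rect p else set0).
  apply/seteqP; split=> [z Az|z [p _]]; last by case: pselect => // h; exact: h.
  have /nbhs_ballP[e /= e0 he] : nbhs z A by exact: open_nbhs_nbhs.
  have ex (a : R) : exists p : rat * rat,
      [/\ ratr p.1 < a, a < ratr p.2, a - e < ratr p.1 & ratr p.2 < a + e].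
    have [p1] := @rat_in_itvoo R (a - e) a ltac:(by rewrite ltrBlDr ltrDl).
    rewrite in_itv/= => /andP[a1 a2].
    have [p2] := @rat_in_itvoo R a (a + e) ltac:(by rewrite ltrDl).
    rewrite in_itv/= => /andP[a3 a4].
    by exists (p1, p2).
  have [p [p1 p2 p3 p4]] := ex z.1.
  have [q [q1 q2 q3 q4]] := ex z.2.
  exists (p, q) => //; case: pselect => h.
    by split; rewrite /= in_itv/= ?p1 ?p2 ?q1 ?q2.
  exfalso; apply: h => y [/=]; rewrite !in_itv/= => /andP[h1 h2] /andP[h3 h4].
  apply: he; split; rewrite /ball/= ltr_norml; lra.
apply: countable_bigcupT_measurable => // p.
by case: (pselect _) => h //=; exact: measurableX.
Qed.

Lemma continuous_measurable2 (f : R * R -> R) : continuous f ->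
  measurable_fun (setT : set (T * T)) f.
Proof.
move=> /continuousP cf; apply: (measurability _ (RGenOpens.measurableE R)).
move=> _ [_ [a [b ->] <-]]; rewrite setTI; apply: open_measurable2.
exact/cf/interval_open.
Qed.

End plane_measurability.

(** * Spherical coordinates and chord lengths *)

Section spherical_coordinates.
Context {R : realType}.
Local Notation V := 'rV[R]_3.
Implicit Types (z : R * R) (xi : V) (x rho : R).

Lemma mvt_dist (f df : R -> R) (a b K : R) :
  (forall x, is_derive x (1 : R) f (df x)) -> (forall x, `|df x| <= K) ->
  `|f b - f a| <= K * `|b - a|.
Proof.
move=> dF hK.
wlog ab : a b / a <= b.
  move=> H; have [|/ltW] := leP a b; first exact: H.
  by move=> /H; rewrite distrC [`|a - b|]distrC.
have [|c _ ->] := @MVT_segment _ f df a b ab (fun x _ => dF x).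
  by apply: derivable_within_continuous => x _; have [] := dF x.
by rewrite normrM ler_wpM2r.
Qed.

Lemma sin_lip (a b : R) : `|sin b - sin a| <= `|b - a|.
Proof.
by rewrite -[leRHS]mul1r; apply: (mvt_dist (df := cos)) => x; exact: cos_max.
Qed.

Lemma abs_sin_le x : `|sin x| <= `|x|.
Proof. by have := sin_lip 0 x; rewrite sin0 !subr0. Qed.

(** With [y = x / 2], [sin x = 2 sin y cos y >= 2 y cos^2 y], and [cos x >= 0] forces
    [2 cos^2 y >= 1]. The inequality [y cos y <= sin y] holds because the difference has derivative
    [y sin y]. *)
Lemma sin_ge_half x : 0 <= x <= pi / 2 -> x / 2 <= sin x.
Proof.
move=> /andP[x0 xp].
have key (y : R) : 0 <= y <= pi / 2 -> y * cos y <= sin y.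
  move=> /andP[y0 yp].
  pose f (t : R) := sin t - t * cos t.
  have df (t : R) : is_derive t (1 : R) f (t * sin t).
    apply: is_derive_eq (is_deriveB (is_derive_sin t) (is_deriveM (is_derive_id t (1 : R)) (is_derive_cos t))) _.
    by rewrite /GRing.scale/=; ring.
  have [|c] := @MVT_segment _ f (fun t => t * sin t) 0 y y0 (fun t _ => df t).
    by apply: derivable_within_continuous => t _; have [] := df t.
  rewrite in_itv/= => /andP[c0 cy]; rewrite /f sin0 mul0r !subr0 => E.
  rewrite -subr_ge0 E mulr_ge0// mulr_ge0// sin_ge0_pi// c0/=.
  by apply: le_trans cy _; apply: le_trans yp _; rewrite ler_pdivrMr// ler_peMr ?pi_ge0// ler1n.
have xh : 0 <= x / 2 <= pi / 2 by lra.
have := key _ xh; have := sin_mulr2n (x / 2).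
rewrite (_ : (x / 2) *+ 2 = x); last by rewrite mulr2n -splitr.
have c0 : 0 <= cos (x / 2) by apply: cos_ge0_pihalf; lra.
have := cos_mulr2n (x / 2); rewrite (_ : (x / 2) *+ 2 = x); last by rewrite mulr2n -splitr.
have cx : 0 <= cos x by apply: cos_ge0_pihalf; lra.
move: (cos (x / 2)) (sin (x / 2)) (cos x) (sin x) cx c0 => c s C S cx c0.
rewrite !mulr2n => h1 h2 h3.
have e1 : 0 <= c * (s - x / 2 * c) by rewrite mulr_ge0// subr_ge0.
have e2 : 0 <= x * (c ^+ 2 + c ^+ 2 - 1) by rewrite mulr_ge0// -h1.
by rewrite h2; nra.
Qed.

Lemma sin_sqr_half x : cos x = 1 - 2 * sin (x / 2) ^+ 2.
Proof.
rewrite -{1}(_ : (x / 2) *+ 2 = x); last by rewrite mulr2n -splitr.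
by rewrite cos_mulr2n cos2sin2 mulr2n; ring.
Qed.

(** The haversine formula: it separates polar from azimuthal displacement, the latter damped by the
    two sines. *)
Lemma enorm_sphB z w : enorm (sph z - sph w) ^+ 2 =
  4 * sin ((z.1 - w.1) / 2) ^+ 2 + 4 * (sin z.1 * sin w.1) * sin ((z.2 - w.2) / 2) ^+ 2.
Proof.
rewrite enorm_sqr3 !mxE/=.
have := sin_sqr_half (z.1 - w.1); have := sin_sqr_half (z.2 - w.2).
rewrite !cosB; have := cos2Dsin2 z.1; have := cos2Dsin2 z.2.
have := cos2Dsin2 w.1; have := cos2Dsin2 w.2.
move: (sin ((z.1 - w.1) / 2)) (sin ((z.2 - w.2) / 2)) => A B.
move: (cos z.1) (sin z.1) (cos z.2) (sin z.2) (cos w.1) (sin w.1) (cos w.2) (sin w.2).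
move=> c s cp sp c' s' cp' sp' h1 h2 h3 h4 h5 h6.
have -> : (s * cp - s' * cp') ^+ 2 + (s * sp - s' * sp') ^+ 2 + (c - c') ^+ 2 =
  s ^+ 2 * (cp ^+ 2 + sp ^+ 2) + s' ^+ 2 * (cp' ^+ 2 + sp' ^+ 2) + c ^+ 2 + c' ^+ 2
  - 2 * (s * s') * (cp * cp' + sp * sp') - 2 * (c * c' + s * s') + 2 * (s * s') by ring.
by rewrite h1 h3 h5 h6; lra.
Qed.

Lemma enorm_sph z : enorm (sph z) = 1.
Proof.
apply/eqP; rewrite -(@eqrXn2 _ 2)// ?enorm_ge0// enorm_sqr3 !mxE/= expr1n.
have := cos2Dsin2 z.1; have := cos2Dsin2 z.2.
move: (cos z.1) (sin z.1) (cos z.2) (sin z.2) => c s cp sp h1 h2.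
apply/eqP; rewrite -h2.
by rewrite -[s ^+ 2]mulr1 -h1; ring.
Qed.

Lemma sin_half_sqr_le x : 4 * sin (x / 2) ^+ 2 <= x ^+ 2.
Proof.
have := abs_sin_le (x / 2); rewrite -ler_sqr ?nnegrE ?normr_ge0//.
by rewrite !real_normK ?num_real// => h; rewrite -[leRHS](_ : 4 * (x / 2) ^+ 2 = _); [lra|field].
Qed.

Lemma sphB_le z w : 0 <= sin z.1 * sin w.1 ->
  enorm (sph z - sph w) ^+ 2 <= (z.1 - w.1) ^+ 2 + sin z.1 * sin w.1 * (z.2 - w.2) ^+ 2.
Proof.
move=> s0; rewrite enorm_sphB lerD ?sin_half_sqr_le//.
rewrite (_ : 4 * (sin z.1 * sin w.1) * sin ((z.2 - w.2) / 2) ^+ 2 =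
  sin z.1 * sin w.1 * (4 * sin ((z.2 - w.2) / 2) ^+ 2)); last by ring.
by rewrite ler_wpM2l// sin_half_sqr_le.
Qed.

Lemma sph_lip z w : enorm (sph z - sph w) <= `|z.1 - w.1| + `|z.2 - w.2|.
Proof.
rewrite enorm_le ?addr_ge0//; apply: le_trans (_ : (z.1 - w.1) ^+ 2 + (z.2 - w.2) ^+ 2 <= _).
  rewrite enorm_sphB lerD ?sin_half_sqr_le//.
  apply: le_trans (sin_half_sqr_le (z.2 - w.2)); rewrite -!mulrA ler_pM2l// mulrA.
  by rewrite ler_piMl ?sqr_ge0.
rewrite -(real_normK (num_real (z.1 - w.1))) -(real_normK (num_real (z.2 - w.2))).
by rewrite sqrrD addrAC lerDl mulrn_wge0// mulr_ge0.
Qed.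

Lemma continuous_sph_comp (g : V -> R) z : {for sph z, continuous g} ->
  {for z, continuous (fun z => g (sph z))}.
Proof.
move=> /cont_enormP cg; apply/cvgrPdist_lt => e e0.
have [d d0 hd] := cg e e0.
exists (ball z.1 (d / 2), ball z.2 (d / 2)) => /=.
  by split; apply: nbhsx_ballx; rewrite divr_gt0.
move=> w [/= h1 h2]; rewrite distrC; apply: hd.
apply: le_lt_trans (sph_lip _ _) _.
by move: h1 h2; rewrite /ball/= distrC [`|z.2 - _|]distrC; lra.
Qed.

Lemma sph_surj xi : enorm xi = 1 -> exists2 z, @sph_dom R z & sph z = xi.
Proof.
move=> xi1.
have h : xi 0 o0 ^+ 2 + xi 0 o1 ^+ 2 + xi 0 o2 ^+ 2 = 1 by rewrite -enorm_sqr3 xi1 expr1n.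
have c1 : -1 <= xi 0 o2 <= 1.
  by have := coord_le_enorm xi o2; rewrite xi1 ler_norml.
pose th := acos (xi 0 o2).
have th0 : 0 <= th <= pi by rewrite acos_ge0//= acos_lepi.
have cth : cos th = xi 0 o2 by rewrite acosK// in_itv.
have sth0 : 0 <= sin th by exact: sin_ge0_pi.
have sth : sin th ^+ 2 = xi 0 o0 ^+ 2 + xi 0 o1 ^+ 2 by rewrite sin2cos2 cth -h; ring.
suff [ph ph0 [E1 E2]] : exists2 ph : R, 0 <= ph <= pi *+ 2 &
    sin th * cos ph = xi 0 o0 /\ sin th * sin ph = xi 0 o1.
  exists (th, ph); first by split; rewrite /= in_itv/=.
  apply/rowP; apply: ord3P; rewrite mxE//=.
have [s0|sn0] := eqVneq (sin th) 0.
  exists 0; first by rewrite lexx/= mulrn_wge0// pi_ge0.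
  have a0 : 0 <= xi 0 o0 ^+ 2 by exact: sqr_ge0.
  have b0 : 0 <= xi 0 o1 ^+ 2 by exact: sqr_ge0.
  move: sth; rewrite s0 expr0n/= => /esym/eqP; rewrite paddr_eq0// !sqrf_eq0.
  by move=> /andP[/eqP-> /eqP->]; rewrite !mul0r.
have sp : 0 < sin th by rewrite lt_neqAle eq_sym sn0.
pose a := xi 0 o0 / sin th; pose b := xi 0 o1 / sin th.
have ab : a ^+ 2 + b ^+ 2 = 1.
  by rewrite /a /b !expr_div_n -mulrDl -sth divff// expf_neq0.
have a1 : -1 <= a <= 1.
  rewrite -ler_norml -(@ler_sqr _ `|a| 1) ?nnegrE// expr1n real_normK ?num_real// -ab lerDl.
  exact: sqr_ge0.
have Ea : sin th * a = xi 0 o0 by rewrite /a mulrC divfK.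
have Eb : sin th * b = xi 0 o1 by rewrite /b mulrC divfK.
have ac0 : 0 <= acos a <= pi by rewrite acos_ge0//= acos_lepi.
have ca : cos (acos a) = a by rewrite acosK// in_itv.
have sa : sin (acos a) = `|b|.
  rewrite sin_acos// -sqrtr_sqr; congr Num.sqrt.
  by rewrite -ab; ring.
have p2 : pi <= pi *+ 2 :> R by rewrite mulr2n lerDl pi_ge0.
have [b0|b0] := leP 0 b.
  exists (acos a); last by rewrite ca sa (ger0_norm b0).
  by move: ac0 p2; lra.
exists (pi *+ 2 - acos a); first by move: ac0; rewrite mulr2n; have := pi_ge0 R; lra.
by rewrite cosB sinB cos2pi sin2pi ca sa (ltr0_norm b0) -Ea -Eb; split; congr (_ * _); ring.
Qed.

End spherical_coordinates.

(** * Integration over the sphere in angular coordinates *)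

Section sphere_functional.
Context {R : realType}.
Local Notation V := 'rV[R]_3.
Local Notation T := (measurableTypeR R).
Local Notation mu1 := (@lebesgue_measure R).
Local Notation mu2 := (mu1 \x mu1)%E.
Local Notation dom := (@sph_dom R).
Implicit Types (g h : R * R -> R) (A : set (R * R)) (xi : V) (z : R * R).

(** Functions on the sphere are functions of the angles on the whole plane; the global bound makes
    every integral over [dom] finite. *)
Definition bounded_measurable g := measurable_fun (setT : set (T * T)) g /\
  exists M : R, forall z, `|g z| <= M.

(* Integration over the sphere against surface measure, in spherical coordinates. *)
Definition sphere_int g : R := \int[mu2]_(z in dom) (g z * sin z.1).

Lemma measurable_dom : measurable (dom : set (T * T)).
Proof. by apply: measurableX; exact: measurable_itv. Qed.

Lemma mu2X (I K : set T) : measurable I -> measurable K ->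
  mu2 (I `*` K : set (T * T)) = (mu1 I * mu1 K)%E.
Proof. by move=> mI mK; exact: product_measure1E. Qed.

Lemma mu2_dom : (mu2 (dom : set (T * T)) = (pi * (pi *+ 2))%:E)%E.
Proof.
rewrite mu2X; [|exact: measurable_itv..].
rewrite !lebesgue_measure_itv/= !lte_fin pi_gt0 mulrn_wgt0 ?pi_gt0//.
by rewrite !oppr0 !adde0 EFinM.
Qed.

Lemma fin_dom : (mu2 (dom : set (T * T)) < +oo)%E.
Proof. by rewrite mu2_dom ltry. Qed.

Lemma sin_dom z : dom z -> 0 <= sin z.1.
Proof. by move=> [/=]; rewrite in_itv/= => h _; exact: sin_ge0_pi. Qed.

Lemma measurable_sin1 : measurable_fun (setT : set (T * T)) (fun z => sin z.1).
Proof.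
apply: continuous_measurable2 => z.
by apply: (@continuous_comp _ _ _ fst sin z); [exact: cvg_fst|exact: continuous_sin].
Qed.

Lemma bmM g h : bounded_measurable g -> bounded_measurable h -> bounded_measurable (fun z => g z * h z).
Proof.
move=> [mg [M hM]] [mh [N hN]]; split; first exact: measurable_funM.
by exists (M * N) => z; rewrite normrM ler_pM.
Qed.

Lemma bmD g h : bounded_measurable g -> bounded_measurable h -> bounded_measurable (fun z => g z + h z).
Proof.
move=> [mg [M hM]] [mh [N hN]]; split; first exact: measurable_funD.
by exists (M + N) => z; apply: le_trans (ler_normD _ _) _; rewrite lerD.
Qed.

Lemma bm_cst (c : R) : bounded_measurable (fun=> c).
Proof. by split; [exact: measurable_cst|exists `|c|]. Qed.

Lemma bmZ (c : R) g : bounded_measurable g -> bounded_measurable (fun z => c * g z).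
Proof. by move=> bg; apply: bmM => //; exact: bm_cst. Qed.

Lemma bm_sin : bounded_measurable (fun z => sin z.1).
Proof. by split; [exact: measurable_sin1|exists 1 => z; exact: sin_max]. Qed.

Lemma bm_indic A : measurable (A : set (T * T)) -> bounded_measurable (\1_A : R * R -> R).
Proof.
move=> mA; split; first exact: measurable_indic.
by exists 1 => z; rewrite indicE; case: (z \in A); rewrite ?normr0 ?normr1.
Qed.

Lemma bm_sum (I : Type) (s : seq I) (F : I -> R * R -> R) :
  (forall i, bounded_measurable (F i)) -> bounded_measurable (fun z => \sum_(i <- s) F i z).
Proof.
move=> bF; elim: s => [|i s IH].
  rewrite (_ : (fun z => _) = fun=> 0); first exact: bm_cst.
  by apply/funext => z; rewrite big_nil.
rewrite (_ : (fun z => _) = fun z => F i z + \sum_(i <- s) F i z); first exact: bmD.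
by apply/funext => z; rewrite big_cons.
Qed.

Lemma bm_integrable g : bounded_measurable g ->
  mu2.-integrable (dom : set (T * T)) (EFin \o (fun z => g z * sin z.1)).
Proof.
move=> bg; have [mg [M hM]] := bmM bg bm_sin.
apply: measurable_bounded_integrable.
- exact: measurable_dom.
- exact: fin_dom.
- exact: measurable_funTS.
- exists M; split; first exact: num_real.
  by move=> y My z _; apply: le_trans (hM z) (ltW My).
Qed.

Lemma JE g : bounded_measurable g -> (sphere_int g)%:E = (\int[mu2]_(z in dom) (g z * sin z.1)%:E)%E.
Proof.
move=> bg; rewrite /sphere_int /Rintegral fineK//.
by apply: integrable_fin_num; [exact: measurable_dom|exact: bm_integrable].
Qed.

Lemma J_le g h : bounded_measurable g -> bounded_measurable h -> (forall z, dom z -> g z <= h z) -> sphere_int g <= sphere_int h.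
Proof.
move=> bg bh gh; apply: le_Rintegral; [exact: measurable_dom|exact: bm_integrable..|].
by move=> z dz; rewrite ler_wpM2r ?sin_dom ?gh.
Qed.

Lemma JD g h : bounded_measurable g -> bounded_measurable h -> sphere_int (fun z => g z + h z) = sphere_int g + sphere_int h.
Proof.
move=> bg bh; rewrite /sphere_int -RintegralD; [|exact: measurable_dom|exact: bm_integrable..].
by apply: eq_Rintegral => z _; rewrite mulrDl.
Qed.

Lemma JZ (c : R) g : bounded_measurable g -> sphere_int (fun z => c * g z) = c * sphere_int g.
Proof.
move=> bg; rewrite /sphere_int -RintegralZl; [|exact: measurable_dom|exact: bm_integrable].
by apply: eq_Rintegral => z _; rewrite mulrA.
Qed.

Lemma J_ext g h : (forall z, dom z -> g z = h z) -> sphere_int g = sphere_int h.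
Proof. by move=> gh; apply: eq_Rintegral => z; rewrite inE => dz; rewrite gh. Qed.

Lemma J0 : sphere_int (fun=> 0) = 0.
Proof.
by have := JZ 0 (bm_cst 0); rewrite !mul0r.
Qed.

Lemma J_ge0 g : bounded_measurable g -> (forall z, dom z -> 0 <= g z) -> 0 <= sphere_int g.
Proof. by move=> bg g0; rewrite -J0; apply: J_le => //; exact: bm_cst. Qed.

Lemma J_sum (I : Type) (s : seq I) (F : I -> R * R -> R) :
  (forall i, bounded_measurable (F i)) -> sphere_int (fun z => \sum_(i <- s) F i z) = \sum_(i <- s) sphere_int (F i).
Proof.
move=> bF; elim: s => [|i s IH].
  by rewrite big_nil -[RHS]J0; apply: J_ext => z _; rewrite big_nil.
rewrite big_cons -IH -JD//; last exact: bm_sum.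
by apply: J_ext => z _; rewrite big_cons.
Qed.

Lemma J_rect_upper A (I K : set T) (m a b : R) : measurable (A : set (T * T)) ->
  measurable I -> measurable K -> (mu1 I <= a%:E)%E -> (mu1 K <= b%:E)%E ->
  0 <= m -> (forall z, A z -> dom z -> I z.1 /\ K z.2 /\ sin z.1 <= m) ->
  sphere_int \1_A <= m * (a * b).
Proof.
move=> mA mI mK Ia Kb m0 h; rewrite -lee_fin JE; last exact: bm_indic.
have mIK : measurable (I `*` K : set (T * T)) by exact: measurableX.
apply: (@le_trans _ _ (\int[mu2]_(z in dom) (m * \1_(I `*` K) z)%:E)%E).
  apply: ge0_le_integral.
  - exact: measurable_dom.
  - by move=> z dz; rewrite lee_fin mulr_ge0 ?sin_dom.
  - by apply/measurable_EFinP/measurable_funTS; exact: (bmM (bm_indic mA) bm_sin).1.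
  - by apply/measurable_EFinP/measurable_funTS; exact: (bmZ m (bm_indic mIK)).1.
  - move=> z dz; rewrite lee_fin !indicE.
    have [Az|nAz] := boolP (z \in A); last by rewrite mul0r mulr_ge0.
    rewrite inE in Az; have [Iz [Kz sm]] := h z Az dz.
    by rewrite mem_set// mul1r mulr1.
under eq_integral do rewrite EFinM.
rewrite ge0_integralZl; [|exact: measurable_dom| | |by rewrite lee_fin]; last 2 first.
- by apply/measurable_EFinP/measurable_funTS; exact: measurable_indic.
- by move=> z _; rewrite lee_fin.
rewrite integral_indic//; last exact: measurable_dom.
rewrite EFinM lee_wpmul2l ?lee_fin//.
apply: (@le_trans _ _ (mu2 (I `*` K : set (T * T)))).
  apply: le_measure; [|by rewrite inE|exact: subIsetl].
  by rewrite inE; apply: measurableI => //; exact: measurable_dom.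
by rewrite mu2X// EFinM lee_pmul.
Qed.

Lemma J_rect_lower A (I K : set T) (m a b : R) : measurable (A : set (T * T)) ->
  measurable I -> measurable K -> mu1 I = a%:E -> mu1 K = b%:E -> 0 <= m ->
  (forall z, I z.1 -> K z.2 -> [/\ A z, dom z & m <= sin z.1]) ->
  m * (a * b) <= sphere_int \1_A.
Proof.
move=> mA mI mK Ia Kb m0 h; rewrite -lee_fin JE; last exact: bm_indic.
have mIK : measurable (I `*` K : set (T * T)) by exact: measurableX.
apply: (@le_trans _ _ (\int[mu2]_(z in dom) (m * \1_(I `*` K) z)%:E)%E); last first.
  apply: ge0_le_integral.
  - exact: measurable_dom.
  - by move=> z dz; rewrite lee_fin mulr_ge0.
  - by apply/measurable_EFinP/measurable_funTS; exact: (bmZ m (bm_indic mIK)).1.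
  - by apply/measurable_EFinP/measurable_funTS; exact: (bmM (bm_indic mA) bm_sin).1.
  - move=> z dz; rewrite lee_fin !indicE.
    have [IKz|nIKz] := boolP (z \in I `*` K); last by rewrite mulr0 mulr_ge0 ?sin_dom.
    rewrite inE in IKz; have [Az _ sm] := h z IKz.1 IKz.2.
    by rewrite mem_set// mul1r mulr1.
under eq_integral do rewrite EFinM.
rewrite ge0_integralZl; [|exact: measurable_dom| | |by rewrite lee_fin]; last 2 first.
- by apply/measurable_EFinP/measurable_funTS; exact: measurable_indic.
- by move=> z _; rewrite lee_fin.
rewrite integral_indic//; last exact: measurable_dom.
rewrite (_ : (I `*` K) `&` dom = I `*` K); last first.
  apply/seteqP; split=> z; first by case.
  by move=> IKz; split=> //; have [] := h z IKz.1 IKz.2.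
have E : mu2 (I `*` K : set (T * T)) = (a * b)%:E by rewrite mu2X// Ia Kb.
by rewrite EFinM; apply: lee_wpmul2l; rewrite ?lee_fin// -E.
Qed.

(** Monotone convergence for sets; in the covering argument it passes from finite families of caps
    to a countable one. *)
Lemma J_limit (F : nat -> set (R * R)) A (c : R) :
  (forall n, measurable (F n : set (T * T))) -> measurable (A : set (T * T)) ->
  (forall n m, (n <= m)%N -> F n `<=` F m) ->
  (forall z, A z -> dom z -> exists n, F n z) ->
  (forall n, sphere_int \1_(F n) <= c) -> sphere_int \1_A <= c.
Proof.
move=> mF mA ndF AF Jc; rewrite -lee_fin JE; last exact: bm_indic.
pose g' n (z : T * T) := (\1_(F n) z * sin z.1)%:E.
have mg' n : measurable_fun (dom : set (T * T)) (g' n).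
  by apply/measurable_EFinP/measurable_funTS; exact: (bmM (bm_indic (mF n)) bm_sin).1.
have g'0 n z : dom z -> (0 <= g' n z)%E.
  by move=> dz; rewrite lee_fin mulr_ge0 ?sin_dom.
have ndg' z : dom z -> {homo g'^~ z : n m / (n <= m)%N >-> (n <= m)%E}.
  move=> dz n m nm; rewrite lee_fin ler_wpM2r ?sin_dom// !indicE.
  have [Fz|//] := boolP (z \in F n); rewrite inE in Fz.
  by rewrite (mem_set (ndF _ _ nm _ Fz)).
have C := cvg_monotone_convergence measurable_dom mg' g'0 ndg'.
apply: (@le_trans _ _ (\int[mu2]_(z in dom) limn (g'^~ z))%E).
  apply: ge0_le_integral.
  - exact: measurable_dom.
  - by move=> z dz; rewrite lee_fin mulr_ge0 ?sin_dom.
  - by apply/measurable_EFinP/measurable_funTS; exact: (bmM (bm_indic mA) bm_sin).1.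
  - apply: (emeasurable_fun_cvg g') => // z dz.
    exact: (ereal_nondecreasing_is_cvgn (ndg' z dz)).
  - move=> z dz; have /cvg_lim -> // := ereal_nondecreasing_cvgn (ndg' z dz).
    rewrite indicE; have [Az|nAz] := boolP (z \in A); last first.
      by rewrite mul0r; apply: le_trans (g'0 0%N z dz) _; apply: ereal_sup_ubound; exists 0%N.
    rewrite inE in Az; have [n Fn] := AF z Az dz.
    apply: ereal_sup_ubound; exists n => //.
    by rewrite /g' indicE mem_set.
rewrite -(cvg_lim _ (C mu2))//; apply: lime_le; first by apply/cvg_ex; eexists; exact: C.
by apply: nearW => n; rewrite -JE ?lee_fin//; exact: bm_indic.
Qed.

(** Chordal rather than geodesic distance, so that covering arguments can use Euclidean balls. *)
Definition cap xi (rho : R) : set (R * R) := [set z | enorm (sph z - xi) < rho].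

Lemma open_cap xi rho : open (cap xi rho).
Proof.
apply: (open_comp (f := fun z => enorm (sph z - xi)) (D := [set t | t < rho])) => //.
move=> z _; apply: (continuous_sph_comp (g := fun w => enorm (w - xi))).
apply: (cont_lip (G := fun w => w - xi) (K := 1)); last exact: continuous_enorm.
by move=> a b; rewrite mul1r opprB addrA subrK.
Qed.

Lemma measurable_cap xi rho : measurable (cap xi rho : set (T * T)).
Proof. by apply: open_measurable2; exact: open_cap. Qed.

Lemma bm_cap xi rho : bounded_measurable \1_(cap xi rho).
Proof. by apply: bm_indic; exact: measurable_cap. Qed.

End sphere_functional.

(** * The surface measure of a cap is comparable to [rho^2] *)

Section cap_measure.
Context {R : realType}.
Local Notation V := 'rV[R]_3.
Local Notation T := (measurableTypeR R).
Local Notation mu1 := (@lebesgue_measure R).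
Local Notation dom := (@sph_dom R).
Implicit Types (xi : V) (z : R * R) (x rho : R).

Lemma pi_lt4 : (pi : R) < 4.
Proof. by have := @pihalf_lt2 R; lra. Qed.

Lemma lebesgue_measure_seg (a b : R) : a <= b -> mu1 `[a, b]%classic = (b - a)%:E.
Proof.
rewrite lebesgue_measure_itv/= lte_fin le_eqVlt => /orP[/eqP->|->]; last by rewrite EFinB.
by rewrite ltxx subrr.
Qed.

Lemma sin_half_small x rho : 0 <= rho -> `|x| <= pi -> 4 * sin (x / 2) ^+ 2 <= rho ^+ 2 ->
  `|x| <= 2 * rho.
Proof.
move=> r0 xp h.
have s1 : `|x| / 2 / 2 <= sin (`|x| / 2).
  by apply: sin_ge_half; rewrite divr_ge0//=; lra.
have s2 : 4 * sin (`|x| / 2) ^+ 2 <= rho ^+ 2.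
  move: h; have [x0|x0] := leP 0 x; first by rewrite ger0_norm.
  by rewrite ltr0_norm// mulNr sinN sqrrN.
have {}s2 : (2 * sin (`|x| / 2)) ^+ 2 <= rho ^+ 2 by rewrite exprMn -natrX.
have sp : 0 <= sin (`|x| / 2) by apply: le_trans s1; rewrite !divr_ge0.
by move: s2; rewrite ler_sqr ?nnegrE ?mulr_ge0//; lra.
Qed.

Lemma cap_polar z w rho : dom z -> dom w -> 0 < rho ->
  enorm (sph z - sph w) < rho -> `|z.1 - w.1| <= 2 * rho.
Proof.
move=> dz dw r0 h; apply: sin_half_small; first exact: ltW.
  move: dz dw => -[/=+ _] [/=+ _]; rewrite !in_itv/= => /andP[? ?] /andP[? ?].
  by rewrite ler_norml; apply/andP; split; lra.
apply: (@le_trans _ _ (enorm (sph z - sph w) ^+ 2)); last first.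
  by rewrite ler_sqr ?nnegrE ?enorm_ge0 ?ltW.
rewrite enorm_sphB lerDl mulr_ge0 ?sqr_ge0// mulr_ge0// mulr_ge0//; exact: sin_dom.
Qed.

(** Away from the poles the chord controls the azimuth, but only modulo [2 pi]: the seam of the
    coordinates produces the two shifted windows. *)
Lemma cap_azimuth z w rho : dom z -> dom w -> 0 < rho -> 4 * rho < sin w.1 ->
  enorm (sph z - sph w) < rho ->
  [\/ `|z.2 - w.2| <= 4 * rho / sin w.1, `|z.2 - (w.2 + pi *+ 2)| <= 4 * rho / sin w.1 |
      `|z.2 - (w.2 - pi *+ 2)| <= 4 * rho / sin w.1].
Proof.
move=> dz dw r0 sw h; have th := cap_polar dz dw r0 h.
have sz : sin w.1 / 2 <= sin z.1.
  by have := le_trans (sin_lip w.1 z.1) th; rewrite ler_norml => /andP[+ _]; lra.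
have s0 : 0 < sin w.1 by apply: lt_trans sw; lra.
have [p2 p4] := (pi_ge2 R, pi_lt4).
have e : 4 * sin ((z.2 - w.2) / 2) ^+ 2 <= (2 * rho / sin w.1) ^+ 2.
  have : enorm (sph z - sph w) ^+ 2 <= rho ^+ 2.
    by rewrite ler_sqr ?nnegrE ?enorm_ge0 ?ltW.
  rewrite enorm_sphB expr_div_n ler_pdivlMr ?exprn_gt0//.
  move: (sin ((z.1 - w.1) / 2)) (sin ((z.2 - w.2) / 2)) (sin z.1) (sin w.1) sz s0 {sw th}.
  move=> a b c s sz s0 hh.
  have a2 := sqr_ge0 a; have b2 := sqr_ge0 b.
  have : s / 2 * s * b ^+ 2 <= c * s * b ^+ 2.
    by rewrite ler_wpM2r// ler_wpM2r// ltW.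
  by move: hh; rewrite !exprMn; nra.
move: dz dw => -[/=_ +] [/=_ +]; rewrite !in_itv/= => /andP[z0 z1] /andP[w0 w1].
have q0 : 0 <= 2 * rho / sin w.1 by rewrite divr_ge0 ?mulr_ge0// ltW.
have -> : 4 * rho / sin w.1 = 2 * (2 * rho / sin w.1) by field; rewrite gt_eqF.
move: q0 e; set q := 2 * rho / sin w.1 => q0 e.
have E (t : R) : sin ((t + pi *+ 2) / 2) ^+ 2 = sin (t / 2) ^+ 2.
  by rewrite (_ : (t + pi *+ 2) / 2 = t / 2 + pi) ?sinDpi ?sqrrN// mulr2n; field.
have [c1|c1] := leP `|z.2 - w.2| pi.
  by constructor 1; exact: sin_half_small.
have [c2|c2] := leP w.2 z.2.
  constructor 2; apply: sin_half_small => //.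
    rewrite ger0_norm ?subr_ge0// in c1.
    by rewrite ler_norml mulr2n; apply/andP; split; lra.
  by rewrite -E (_ : z.2 - (w.2 + pi *+ 2) + pi *+ 2 = z.2 - w.2)//; ring.
constructor 3; apply: sin_half_small => //.
  rewrite ltr0_norm ?subr_lt0// in c1.
  by rewrite ler_norml mulr2n; apply/andP; split; lra.
by rewrite (_ : z.2 - (w.2 - pi *+ 2) = z.2 - w.2 + pi *+ 2) ?E//; ring.
Qed.

Lemma cap_upper xi rho : enorm xi = 1 -> 0 < rho -> sphere_int \1_(cap xi rho) <= 192 * rho ^+ 2.
Proof.
move=> /sph_surj[w dw <-] r0; have [p2 p4] := (pi_ge2 R, pi_lt4).
have Im : (mu1 `[(w.1 - 2 * rho)%R, (w.1 + 2 * rho)%R]%classic <= (4 * rho)%:E)%E.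
  by rewrite lebesgue_measure_seg ?lee_fin; lra.
have [sw|sw] := leP (sin w.1) (4 * rho).
  apply: (@le_trans _ _ (6 * rho * (4 * rho * 8))); last by rewrite expr2; lra.
  apply: (@J_rect_upper _ _ _ `[0, pi *+ 2]%classic _ _ _ (measurable_cap _ _)) Im _ _ _ => //.
  - by rewrite lebesgue_measure_seg ?lee_fin ?mulr2n; lra.
  - lra.
  - move=> z cz dz; have th := cap_polar dz dw r0 cz.
    have := le_trans (sin_lip w.1 z.1) th; move: th.
    rewrite /= !in_itv/= !ler_norml => /andP[? ?] /andP[? ?].
    by split; [apply/andP; split; lra|split; [case: dz|lra]].
have s0 : 0 < sin w.1 by apply: lt_trans sw; lra.
pose a := 4 * rho / sin w.1.
have a0 : 0 <= a by rewrite divr_ge0 ?mulr_ge0 // ltW.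
pose K : set T := `[w.2 - a, w.2 + a]%classic `|`
  (`[w.2 + pi *+ 2 - a, w.2 + pi *+ 2 + a]%classic `|`
   `[w.2 - pi *+ 2 - a, w.2 - pi *+ 2 + a]%classic).
have mK : measurable K by apply: measurableU => //; exact: measurableU.
have seg (c : R) : (mu1 `[(c - a)%R, (c + a)%R]%classic <= (2 * a)%:E)%E.
  by rewrite lebesgue_measure_seg ?lee_fin; lra.
have Km : (mu1 K <= (6 * a)%:E)%E.
  apply: (@le_trans _ _ ((2 * a)%:E + ((2 * a)%:E + (2 * a)%:E))%E); last first.
    by rewrite -!EFinD lee_fin; lra.
  apply: le_trans (measureU2 _ _ _) _ => //; first exact: measurableU.
  apply: leeD; first exact: seg.
  apply: le_trans (measureU2 _ _ _) _ => //.
  by apply: leeD; exact: seg.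
apply: (@le_trans _ _ (3 / 2 * sin w.1 * (4 * rho * (6 * a)))); last first.
  rewrite [leLHS](_ : _ = 144 * rho ^+ 2); first by rewrite ler_wpM2r ?sqr_ge0//; lra.
  by rewrite /a; field; rewrite gt_eqF.
apply: (@J_rect_upper _ _ _ K _ _ _ (measurable_cap _ _)) Im _ _ _ => //; first by lra.
move=> z cz dz; have th := cap_polar dz dw r0 cz.
have := le_trans (sin_lip w.1 z.1) th; move: (th).
rewrite /= !in_itv/= !ler_norml => /andP[? ?] /andP[? ?].
split; [by apply/andP; split; lra|split; last by lra].
have [||] := cap_azimuth dz dw r0 sw cz; rewrite -/a ler_norml => /andP[? ?].
- by left; rewrite /= in_itv/=; apply/andP; split; lra.
- by right; left; rewrite /= in_itv/=; apply/andP; split; lra.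
- by right; right; rewrite /= in_itv/=; apply/andP; split; lra.
Qed.

(** The interval starts at [th] towards the equator when [th] is near the pole, which bounds the
    sine below by a multiple of [rho], and lies on the polar side otherwise. Reflection in the
    equator reduces to [th <= pi / 2]. *)
Lemma polar_interval (th rho : R) : 0 <= th <= pi -> 0 < rho <= 2 ->
  exists a : R, forall t, a <= t <= a + rho / 8 ->
    [/\ 0 <= t <= pi, `|t - th| <= rho / 4 & (sin th + rho) / 24 <= sin t].
Proof.
move=> /andP[th0 thp] /andP[r0 r2]; have [p2 p4] := (pi_ge2 R, pi_lt4).
wlog thh : th th0 thp / th <= pi / 2.
  move=> H; have [|th2] := leP th (pi / 2); first exact: H.
  have [|||a ha] := H (pi - th); try lra.
  exists (pi - (a + rho / 8)) => t ht.
  have [|h1 h2 h3] := ha (pi - t); first by move: ht => /andP[? ?]; apply/andP; split; lra.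
  split; first by move: h1 => /andP[? ?]; apply/andP; split; lra.
  - by rewrite distrC (_ : th - t = pi - t - (pi - th))//; ring.
  - by move: h3; rewrite !sinB sinpi cospi !mul0r !mulN1r !sub0r !opprK.
have sth : sin th <= th.
  by apply: le_trans (ler_norm _) (le_trans (abs_sin_le th) _); rewrite ger0_norm.
have sth1 := sin_le1 th.
have [c|c] := leP th (pi / 4).
  exists (th + rho / 8) => t /andP[t0 t1]; split; first by apply/andP; split; lra.
    by rewrite ger0_norm; lra.
  have : t / 2 <= sin t by apply: sin_ge_half; apply/andP; split; lra.
  by lra.
exists (th - rho / 8) => t /andP[t0 t1]; split; first by apply/andP; split; lra.
  by rewrite ler0_norm; lra.
have : t / 2 <= sin t by apply: sin_ge_half; apply/andP; split; lra.
by lra.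
Qed.

(** A coordinate rectangle fits into the cap. Its azimuthal length [l] satisfies
    [(s + rho) * l = rho / 4], so that both displacements contribute at most [rho^2 / 16] to the
    squared chord; [768 = 24 * 8 * 4] collects the sine bound, the polar length and [l]. *)
Lemma cap_lower xi rho : enorm xi = 1 -> 0 < rho <= 2 -> rho ^+ 2 / 768 <= sphere_int \1_(cap xi rho).
Proof.
move=> /sph_surj[w dw <-] r02; have [p2 p4] := (pi_ge2 R, pi_lt4).
have s0 := sin_dom dw.
have [r0 r2] := andP r02.
move: (dw) => -[/=]; rewrite !in_itv/= => w1p /andP[w0 w2].
have [a ha] := polar_interval w1p r02.
pose s := sin w.1; pose l := rho / (4 * (s + rho)).
have sr : 0 < s + rho by rewrite ltr_wpDl.
have l0 : 0 < l by rewrite divr_gt0 ?mulr_gt0.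
have l1 : l <= 1 / 4.
  by rewrite ler_pdivrMr ?mulr_gt0// (_ : 1 / 4 * (4 * (s + rho)) = s + rho) ?lerDr//; field.
have [b hb] : exists b : R, forall t, b <= t <= b + l -> 0 <= t <= pi *+ 2 /\ `|t - w.2| <= l.
  have [c|c] := leP w.2 pi.
    exists w.2 => t /andP[? ?]; rewrite ler_norml mulr2n.
    by split; apply/andP; split; lra.
  exists (w.2 - l) => t /andP[? ?]; rewrite ler_norml mulr2n.
  by split; apply/andP; split; lra.
rewrite [leLHS](_ : _ = (s + rho) / 24 * (rho / 8 * l)); last first.
  by rewrite /l; field; rewrite gt_eqF.
apply: (@J_rect_lower _ _ `[a, a + rho / 8]%classic `[b, b + l]%classic) => //.
- exact: measurable_cap.
- by rewrite lebesgue_measure_seg; [congr EFin; ring|lra].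
- by rewrite lebesgue_measure_seg; [congr EFin; ring|lra].
- by rewrite divr_ge0// ltW.
move=> z /=; rewrite !in_itv/= => /ha[tp td ts] /hb[fp fd].
split=> //.
rewrite /cap/= -(@ltr_sqr _ _ rho) ?nnegrE ?enorm_ge0 ?ltW//.
have sz : 0 <= sin z.1 by apply: sin_ge0_pi.
have szr : sin z.1 <= s + rho.
  have := le_trans (sin_lip w.1 z.1) td; rewrite ler_norml => /andP[_].
  by rewrite -/s; lra.
apply: le_lt_trans (sphB_le _) _; first exact: mulr_ge0.
have h1 : (z.1 - w.1) ^+ 2 <= (rho / 4) ^+ 2.
  by rewrite -(real_normK (num_real _)) ler_sqr ?nnegrE ?normr_ge0//; lra.
have h2 : sin z.1 * sin w.1 * (z.2 - w.2) ^+ 2 <= (s + rho) * (s + rho) * l ^+ 2.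
  apply: ler_pM; rewrite ?sqr_ge0 ?mulr_ge0//.
    by apply: ler_pM => //; rewrite -/s lerDl ltW.
  by rewrite -(real_normK (num_real _)) ler_sqr ?nnegrE ?normr_ge0//; lra.
apply: le_lt_trans (lerD h1 h2) _.
rewrite [ltLHS](_ : _ = rho ^+ 2 / 8); last by rewrite /l; field; rewrite gt_eqF.
by rewrite ltr_pdivrMr// ltr_pMr ?exprn_gt0//; lra.
Qed.

End cap_measure.

(** * The finite Vitali covering lemma *)

Section vitali.
Context {R : realType}.
Local Notation V := 'rV[R]_3.

Lemma seq_max (I : eqType) (r : I -> R) (s : seq I) : s != [::] ->
  exists2 j, j \in s & {in s, forall i, r i <= r j}.
Proof.
elim: s => // i [|k s] IH _.
  by exists i; rewrite ?mem_head// => j; rewrite inE => /eqP->.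
have [//|j js hj] := IH.
have [ij|/ltW ji] := leP (r i) (r j).
  by exists j => [|l]; [rewrite inE js orbT|rewrite inE => /orP[/eqP->//|/hj]].
exists i => [|l]; first exact: mem_head.
by rewrite inE => /orP[/eqP->//|/hj/le_trans]; apply.
Qed.

(** Greedy selection: a ball of largest radius is kept, its triple swallows every ball meeting it,
    and induction treats the rest. Disjointness is stated as a bound on a sum of indicators, the
    form in which it is integrated against [g]. *)
Lemma vitali_finite (I : eqType) (c : I -> V) (r : I -> R) (s : seq I) :
  {in s, forall i, 0 < r i} ->
  exists t : seq I, [/\ {subset t <= s},
    (forall y, \sum_(j <- t) (enorm (y - c j) < r j)%R%:R <= 1 :> R) &
    {in s, forall i, exists2 j, j \in t &
      forall y, enorm (y - c i) < r i -> enorm (y - c j) < 3 * r j}].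
Proof.
have [n] := ubnP (size s); elim: n s => // n IH s sn r0.
have [->|s0] := eqVneq s [::].
  by exists [::]; split=> // y; rewrite big_nil.
have [j js hj] := seq_max r s0.
pose meet i := `[< exists y, enorm (y - c i) < r i /\ enorm (y - c j) < r j >].
have mj : meet j by apply/asboolP; exists (c j); rewrite subrr enorm0 r0.
have [||t [ts t1 tc]] := IH [seq i <- s | ~~ meet i].
- rewrite -ltnS; apply: leq_ltn_trans sn; rewrite size_filter -(count_predC meet s).
  by rewrite -addn1 addnC leq_add2r -has_count; apply/hasP; exists j.
- by move=> i; rewrite mem_filter => /andP[_ /r0].
exists (j :: t); split.
- by move=> i; rewrite inE => /orP[/eqP->//|/ts]; rewrite mem_filter => /andP[].
- move=> y; rewrite big_cons; have [yj|_] := ltP; last by rewrite add0r.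
  rewrite big1_seq ?addr0// => i /= it; have := ts _ it; rewrite mem_filter => /andP[ni _].
  by case: ltP => // yi; case/negP: ni; apply/asboolP; exists y.
- move=> i is_; have [/asboolP[y [yi yj]]|ni] := boolP (meet i); last first.
    have [|k kt hk] := tc i; first by rewrite mem_filter ni.
    by exists k => //; rewrite inE kt orbT.
  exists j; first exact: mem_head.
  move=> x xi; have rij := hj i is_.
  have := enorm_tri x (c i) (c j); have := enorm_tri (c i) y (c j).
  by rewrite (enormB (c i) y); lra.
Qed.

End vitali.

(** * Weak and strong type inequalities for the maximal function over caps *)

Section weak_type.
Context {R : realType}.
Local Notation V := 'rV[R]_3.
Local Notation T := (measurableTypeR R).
Local Notation dom := (@sph_dom R).
Implicit Types (f g h : R * R -> R) (E : set (R * R)) (z : R * R).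

Lemma measurable_gt g (c : R) : bounded_measurable g -> measurable ([set z | c < g z] : set (T * T)).
Proof.
move=> [mg _]; rewrite (_ : [set z | c < g z] = setT `&` g @^-1` `]c, +oo[%classic); first exact: mg.
by apply/seteqP; split=> z /=; rewrite in_itv/= andbT => //= -[].
Qed.

(** The selected disjoint caps have total measure at most a multiple of [1 / t] times the integral
    of [g], and their triples cover. Finite families can only exhaust a countable one, so the caps
    are first replaced by caps with rational angles and radius. [E] is an arbitrary measurable set
    of points that own a heavy cap. *)
Lemma weak_type : exists2 K : R, 0 <= K & forall g (t : R) E,
  bounded_measurable g -> (forall z, 0 <= g z) -> 0 < t -> measurable (E : set (T * T)) ->
  (forall z, E z -> dom z ->
     exists2 rho : R, 0 < rho & t * rho ^+ 2 < sphere_int (fun w => g w * \1_(cap (sph z) rho) w)) ->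
  sphere_int \1_E <= K / t * sphere_int g.
Proof.
(* [192] bounds the measure of caps, [3^2] pays for tripled radii, [4] for the rational
   approximation. *)
have [K K0 KE] : exists2 K : R, 0 <= K & 192 * 3 ^+ 2 * 4 <= K by exists (192 * 3 ^+ 2 * 4).
exists K => // g t E bg g0 t0 mE hE.
pose I : Type := ((rat * rat) * rat)%type.
pose c (i : I) : V := sph (ratr i.1.1, ratr i.1.2).
pose r (i : I) : R := ratr i.2.
pose G (i : I) := `[< 0 < r i /\ t / 4 * r i ^+ 2 < sphere_int (fun w => g w * \1_(cap (c i) (r i)) w) >].
(* Finite stages of the countable family, in the order of its enumeration; [G] retains the heavy
   caps. *)
pose s n : seq I := [seq i <- pmap unpickle (iota 0 n) | G i].
pose F n : set (R * R) := [set z | has (fun i => `[< cap (c i) (r i) z >]) (s n)].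
have bgc i : bounded_measurable (fun w => g w * \1_(cap (c i) (r i)) w) by apply: bmM => //; exact: bm_cap.
have mF n : measurable (F n : set (T * T)).
  rewrite (_ : F n = \big[setU/set0]_(i <- s n) cap (c i) (r i)).
    by apply: bigsetU_measurable => i _; exact: measurable_cap.
  rewrite -bigcup_seq; apply/seteqP; split=> [z /hasP[i is_ /asboolP iz]|z [i /= is_ iz]].
    by exists i.
  by apply/hasP; exists i => //; apply/asboolP.
apply: (@J_limit _ F) => //.
- move=> n m nm z /hasP[i]; rewrite mem_filter mem_pmap => /andP[Gi /mapP[k kn ik]] iz.
  apply/hasP; exists i => //; rewrite mem_filter Gi mem_pmap; apply/mapP; exists k => //.
  by move: kn; rewrite !mem_iota !add0n !leq0n => /leq_trans; apply.
- move=> z Ez dz; have [rho r0 hr] := hE z Ez dz.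
  have [q1 /andP[q1a q1b]] : exists q, z.1 < ratr q < z.1 + rho / 8 by apply: rat_in_itvoo; lra.
  have [q2 /andP[q2a q2b]] : exists q, z.2 < ratr q < z.2 + rho / 8 by apply: rat_in_itvoo; lra.
  (* The new centre is within [rho / 4] of [sph z]: a radius above [5 / 4 * rho] recaptures the old
     cap, and one below [2 * rho] loses at most the factor [4] allowed by [t / 4] in [G]. *)
  have [q3] : exists q, 5 / 4 * rho < ratr q < 2 * rho by apply: rat_in_itvoo; lra.
  pose i : I := ((q1, q2), q3); rewrite -[ratr q3]/(r i) => /andP[q3a q3b].
  have zi : enorm (sph z - c i) < rho / 4.
    apply: le_lt_trans (sph_lip _ _) _; rewrite /= !ltr0_norm; lra.
  have ri : 0 < r i by lra.
  exists (pickle i).+1; apply/hasP; exists i; last by apply/asboolP; rewrite /cap/=; lra.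
  rewrite mem_filter; apply/andP; split; last first.
    by rewrite mem_pmap; apply/mapP; exists (pickle i); rewrite ?mem_iota ?add0n ?ltnS ?leqnn ?pickleK.
  apply/asboolP; split=> //; apply: (@le_lt_trans _ _ (t * rho ^+ 2)); last first.
    apply: lt_le_trans hr _; apply: J_le => [|//|w _]; first by apply: bmM => //; exact: bm_cap.
    rewrite ler_wpM2l// !indicE.
    have [|//] := boolP (w \in cap (sph z) rho); rewrite inE /cap/= => wz.
    rewrite mem_set//=; apply: le_lt_trans (enorm_tri _ (sph z) _) _.
    by lra.
  rewrite mulrAC -mulrA ler_pM2l// ler_pdivrMr// (_ : _ * 4 = (2 * rho) ^+ 2); last by ring.
  by rewrite ler_sqr ?nnegrE; lra.
- move=> n.
  have sG i : i \in s n -> 0 < r i /\ t / 4 * r i ^+ 2 < sphere_int (fun w => g w * \1_(cap (c i) (r i)) w).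
    by rewrite mem_filter => /andP[/asboolP].
  have [|v [vs v1 vc]] := @vitali_finite R I c r (s n); first by move=> i /sG[].
  apply: (@le_trans _ _ (sphere_int (fun z => \sum_(i <- v) \1_(cap (c i) (3 * r i)) z))).
    apply: J_le; [exact: bm_indic|by apply: bm_sum => i; exact: bm_cap|].
    move=> z _; rewrite indicE; have [|_] := boolP (z \in F n); last first.
      by apply: sumr_ge0 => i _.
    rewrite inE => /hasP[i /vc[j jv hj] /asboolP iz].
    rewrite (big_rem j)//= indicE mem_set; last exact: hj.
    by rewrite lerDl; apply: sumr_ge0 => k _.
  rewrite J_sum; last by move=> i; exact: bm_cap.
  apply: (@le_trans _ _ (\sum_(i <- v) K / t * sphere_int (fun w => g w * \1_(cap (c i) (r i)) w))).
    rewrite big_seq [leRHS]big_seq; apply: ler_sum => i /vs/sG[ri hi].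
    apply: le_trans (cap_upper (enorm_sph _) _) _; first by rewrite mulr_gt0.
    rewrite mulrAC ler_pdivlMr//.
    rewrite exprMn mulrA; apply: (@le_trans _ _ (192 * 3 ^+ 2 * 4 * (t / 4 * r i ^+ 2))).
      by rewrite le_eqVlt; apply/orP; left; apply/eqP; field.
    apply: ler_pM => //; last exact: ltW.
    by apply: mulr_ge0; [rewrite divr_ge0// ltW|exact: sqr_ge0].
  rewrite -mulr_sumr; apply: ler_wpM2l; first by rewrite divr_ge0// ltW.
  rewrite -J_sum; last exact: bgc.
  apply: J_le => //; first exact: bm_sum.
  move=> z _; rewrite -mulr_sumr ler_piMr//.
  apply: le_trans (v1 (sph z)); rewrite le_eqVlt; apply/orP; left; apply/eqP.
  apply: eq_bigr => i _; rewrite indicE; congr (_%:R); congr nat_of_bool.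
  by apply/idP/idP; rewrite inE.
Qed.

(** The part of [f] below [t / m] contributes at most [t * rho^2 / 2] to a cap, because
    [192 / m = 1 / 2]. The part above must supply the rest, so [weak_type] applies to it at level
    [t / 2]. *)
Lemma weak_type_truncated : exists K m : R, [/\ 0 <= K, 0 < m & forall f (t : R) E,
  bounded_measurable f -> (forall z, 0 <= f z) -> 0 < t -> measurable (E : set (T * T)) ->
  (forall z, E z -> dom z ->
     exists2 rho : R, 0 < rho & t * rho ^+ 2 < sphere_int (fun w => f w * \1_(cap (sph z) rho) w)) ->
  sphere_int \1_E <= K / t * sphere_int (fun z => f z * \1_[set z | t < m * f z] z)].
Proof.
have [K K0 HK] := weak_type.
have [m m0 hm] : exists2 m : R, 0 < m & 192 / m = 2^-1.
  by exists (192 * 2); [rewrite mulr_gt0|rewrite invfM mulrA mulfV// mul1r].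
exists (K * 2), m; split; [exact: mulr_ge0|exact: m0|].
move=> f t E bf f0 t0 mE hE.
have bt : bounded_measurable (\1_[set z | t < m * f z] : _ -> R).
  by apply: bm_indic; apply: measurable_gt; exact: bmZ.
pose g z := f z * \1_[set z | t < m * f z] z.
have bg : bounded_measurable g by exact: bmM.
rewrite (_ : K * 2 / t = K / (t / 2)); last by field; rewrite gt_eqF.
apply: (HK g) => //.
- by move=> z; rewrite mulr_ge0.
- by rewrite divr_gt0.
move=> z Ez dz; have [rho r0 hr] := hE z Ez dz; exists rho => //.
have bc := bm_cap (sph z) rho.
have bgc := bmM bg bc.
suff : sphere_int (fun w => f w * \1_(cap (sph z) rho) w) <=
    sphere_int (fun w => g w * \1_(cap (sph z) rho) w) + t / m * (192 * rho ^+ 2).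
  rewrite (_ : t / m * (192 * rho ^+ 2) = t * (192 / m) * rho ^+ 2); last by ring.
  by rewrite hm; lra.
apply: (@le_trans _ _ (sphere_int (fun w => g w * \1_(cap (sph z) rho) w) +
    t / m * sphere_int \1_(cap (sph z) rho))); last first.
  rewrite lerD2l; apply: ler_wpM2l; first by rewrite divr_ge0// ltW.
  by apply: cap_upper => //; exact: enorm_sph.
rewrite -JZ// -JD//; last exact: bmZ.
apply: J_le; [exact: bmM|by apply: bmD => //; exact: bmZ|].
move=> w _; rewrite -mulrDl ler_wpM2r// /g indicE.
have [wt|] := boolP (w \in _); first by rewrite mulr1 lerDl divr_ge0// ltW.
by rewrite notin_setE/= => /negP; rewrite -leNgt mulr0 add0r ler_pdivlMr// mulrC.
Qed.

Lemma bm_powR g (p : R) : 0 <= p -> bounded_measurable g -> (forall z, 0 <= g z) -> bounded_measurable (fun z => g z `^ p).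
Proof.
move=> p0 [mg [M hM]] g0; split.
  exact: (measurableT_comp (measurable_powR p) mg).
exists (M `^ p) => z; rewrite ger0_norm ?powR_ge0//.
have gM : g z <= M := le_trans (ler_norm _) (hM z).
by rewrite ge0_ler_powR ?nnegrE// (le_trans (g0 z)).
Qed.

Lemma powR2_gt1 (q : R) : 0 < q -> 1 < 2 `^ q.
Proof.
move=> q0; have := @gt0_ltr_powR R q q0 1 2; rewrite !nnegrE powR1; apply => //.
by rewrite ltr1n.
Qed.

Lemma powR_exp2 (q : R) k : (2 ^+ k) `^ q = (2 `^ q) ^+ k.
Proof.
elim: k => [|k IH]; first by rewrite !expr0 powR1.
by rewrite !exprS powRM// ?exprn_ge0// IH.
Qed.

(** Only the largest [k] with [2^k < y] matters; the summand [1] covers [y <= 1]. *)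
Lemma dyadic_upper (p y : R) n : 0 <= p -> 0 <= y <= 2 ^+ n ->
  y `^ p <= 1 + \sum_(0 <= k < n) (2 ^+ k.+1) `^ p * (2 ^+ k < y)%R%:R.
Proof.
move=> p0; elim: n => [|n IH] /andP[y0 yn].
  by rewrite big_geq// addr0; have := @ge0_ler_powR R p p0 y 1; rewrite !nnegrE powR1; apply.
rewrite big_nat_recr//=; have [ny|yn'] := ltP (2 ^+ n) y.
  rewrite mulr1 addrA; apply: le_trans (_ : (2 ^+ n.+1) `^ p <= _).
    by rewrite ge0_ler_powR ?nnegrE// exprn_ge0.
  by rewrite lerDr addr_ge0// sumr_ge0// => k _; rewrite mulr_ge0// powR_ge0.
by rewrite mulr0 addr0; apply: IH; rewrite y0.
Qed.

(** A geometric sum of ratio [2^q > 1] is dominated by its last term. *)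
Lemma dyadic_lower (q y : R) n : 0 < q -> 0 <= y ->
  \sum_(0 <= k < n) (2 `^ q) ^+ k * (2 ^+ k < y)%R%:R <= 2 `^ q / (2 `^ q - 1) * y `^ q.
Proof.
move=> q0 y0; set a := 2 `^ q.
have a1 : 1 < a by exact: powR2_gt1.
elim: n => [|n IH]; first by rewrite big_geq// mulr_ge0 ?powR_ge0// divr_ge0; lra.
rewrite big_nat_recr//=; have [ny|yn'] := ltP (2 ^+ n) y; last by rewrite mulr0 addr0.
rewrite mulr1.
apply: (@le_trans _ _ (a / (a - 1) * a ^+ n)); last first.
  rewrite ler_wpM2l ?divr_ge0 ?subr_ge0 ?(ltW a1)//; first by lra.
  by rewrite -powR_exp2 ge0_ler_powR ?nnegrE ?exprn_ge0// ltW.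
apply: (@le_trans _ _ (\sum_(0 <= k < n) a ^+ k + a ^+ n)).
  rewrite lerD2r; apply: ler_sum => k _; rewrite ler_piMr ?exprn_ge0//; first by lra.
  by case: (_ < _).
have a10 : a - 1 != 0 by rewrite subr_eq0 gt_eqF.
have E m : \sum_(0 <= k < m) a ^+ k = (a ^+ m - 1) / (a - 1).
  elim: m => [|m IHm]; first by rewrite big_geq// expr0 subrr mul0r.
  by rewrite big_nat_recr//= IHm exprS; field.
rewrite E [leLHS](_ : _ = (a ^+ n * a - 1) / (a - 1)); last by field.
rewrite mulrAC ler_pM2r ?invr_gt0 ?subr_gt0// mulrC; lra.
Qed.

(** The hypothesis bounds [g] by [C] times the maximal function of [f] without naming it. At level
    [2^k] the weight of order [2^(k p)] and the factor [2^-k] of the weak bound leave [a^k]; summed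
    over [2^k < m * f] this is of order [(m * f)^(p - 1)], and the remaining factor [f] restores the
    power [p]. *)
Lemma strong_type (p C : R) : 1 < p -> 0 < C -> exists2 K : R, 0 <= K &
  forall f g, bounded_measurable f -> bounded_measurable g -> (forall z, 0 <= f z) -> (forall z, 0 <= g z) ->
    (forall z (t : R), dom z -> 0 < t ->
       (forall rho : R, 0 < rho -> sphere_int (fun w => f w * \1_(cap (sph z) rho) w) <= t * rho ^+ 2) ->
       g z <= C * t) ->
  sphere_int (fun z => g z `^ p) <= K * (1 + sphere_int (fun z => f z `^ p)).
Proof.
move=> p1 C0; have [W [m [W0 m0 HW]]] := weak_type_truncated; have p0 : 0 <= p by lra.
have q0 : 0 < p - 1 by lra.
pose a : R := 2 `^ (p - 1).
have a1 : 1 < a by exact: powR2_gt1.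
pose L : R := sphere_int (fun=> 1).
have L0 : 0 <= L by apply: J_ge0 => //; exact: bm_cst.
pose D : R := W * 2 `^ p * (a / (a - 1) * m `^ (p - 1)).
have D0 : 0 <= D.
  have aa : 0 <= a / (a - 1) by apply: divr_ge0; lra.
  by apply: mulr_ge0; apply: mulr_ge0; rewrite ?powR_ge0.
exists (C `^ p * (L + D)); first by rewrite mulr_ge0 ?powR_ge0 ?addr_ge0.
move=> f g bf bg f0 g0 H.
have bfp := bm_powR p0 bf f0.
have bgp := bm_powR p0 bg g0.
have Jfp : 0 <= sphere_int (fun z => f z `^ p) by apply: J_ge0 => // z _; exact: powR_ge0.
(* Finitely many levels suffice because [g] is bounded; [n] does not enter the final constant. *)
have [n hn] : exists n, forall z, g z / C <= 2 ^+ n.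
  have [_ [M hM]] := bg.
  exists (Num.bound (M / C)) => z; apply: le_trans (_ : M / C <= _).
    by rewrite ler_pM2r ?invr_gt0// (le_trans (ler_norm _)).
  apply: le_trans (ltW (archi_boundP _)) _.
    by rewrite divr_ge0 ?(ltW C0)// (le_trans (normr_ge0 _) (hM z)).
  by rewrite -natrX ler_nat ltnW// ltn_expl.
pose A k : set (R * R) := [set z | 2 ^+ k < g z / C].
have bgC : bounded_measurable (fun z => g z / C).
  by rewrite (_ : (fun z => _) = fun z => C^-1 * g z); [exact: bmZ|apply/funext => z; rewrite mulrC].
have mA k : measurable (A k : set (T * T)) by exact: measurable_gt.
have bA k : bounded_measurable (\1_(A k) : _ -> R) by exact: bm_indic.
pose B k : R * R -> R := fun z => f z * \1_[set z | 2 ^+ k < m * f z] z.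
have bB k : bounded_measurable (B k).
  by apply: bmM => //; apply: bm_indic; apply: measurable_gt; exact: bmZ.
have JA k : sphere_int \1_(A k) <= W / 2 ^+ k * sphere_int (B k).
  apply: HW => //.
  move=> z Az dz; apply: contrapT => nz.
  have : g z <= C * 2 ^+ k.
    apply: H => // rho r0.
    by rewrite leNgt; apply/negP => h; apply: nz; exists rho.
  by apply/negP; rewrite -ltNge mulrC -ltr_pdivlMr.
have step1 : sphere_int (fun z => g z `^ p) <=
    C `^ p * (L + \sum_(0 <= k < n) (2 ^+ k.+1) `^ p * sphere_int \1_(A k)).
  under eq_bigr do rewrite -JZ//.
  rewrite -J_sum; last by move=> k; exact: bmZ.
  rewrite -JD; [|exact: bm_cst|by apply: bm_sum => k; exact: bmZ].
  rewrite -JZ; last by apply: bmD; [exact: bm_cst|by apply: bm_sum => k; exact: bmZ].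
  apply: J_le => //.
    by apply: bmZ; apply: bmD; [exact: bm_cst|by apply: bm_sum => k; exact: bmZ].
  move=> z _; rewrite -[X in X `^ p](_ : C * (g z / C) = _); last by field; rewrite gt_eqF.
  rewrite powRM ?(ltW C0)// ?divr_ge0 ?(ltW C0)// ler_wpM2l ?powR_ge0//.
  apply: le_trans (@dyadic_upper p _ n p0 _) _; first by rewrite hn divr_ge0// ltW.
  rewrite lerD2l le_eqVlt; apply/orP; left; apply/eqP; apply: eq_bigr => k _.
  rewrite indicE; congr (_ * _%:R); congr nat_of_bool.
  by apply/idP/idP; rewrite inE.
apply: le_trans step1 _; rewrite -mulrA ler_wpM2l ?powR_ge0//.
suff S : \sum_(0 <= k < n) (2 ^+ k.+1) `^ p * sphere_int \1_(A k) <= D * sphere_int (fun z => f z `^ p).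
  apply: (@le_trans _ _ (L + D * sphere_int (fun z => f z `^ p))); first by rewrite lerD2l.
  by move: Jfp L0 D0; move: (sphere_int _) => x; nra.
have E (k : nat) : (2 ^+ k.+1) `^ p * (W / 2 ^+ k) = W * 2 `^ p * a ^+ k.
  have -> : (2 ^+ k.+1) `^ p = 2 `^ p * (2 ^+ k * a ^+ k).
    rewrite powR_exp2 exprS; congr (_ * _).
    by rewrite -exprMn; congr (_ ^+ _); rewrite /a mulr_powRB1//; lra.
  by field; rewrite expf_neq0.
apply: (@le_trans _ _ (\sum_(0 <= k < n) (W * 2 `^ p * a ^+ k) * sphere_int (B k))).
  by apply: ler_sum => k _; rewrite -E -mulrA ler_wpM2l ?powR_ge0.
under eq_bigr do rewrite -JZ//.
rewrite -J_sum; last by move=> k; exact: bmZ.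
rewrite -JZ//; apply: J_le; [by apply: bm_sum => k; exact: bmZ|exact: bmZ|].
move=> z _; rewrite /D.
under eq_bigr do rewrite -mulrA.
rewrite -mulr_sumr -[leRHS]mulrA ler_wpM2l ?mulr_ge0 ?powR_ge0//.
apply: (@le_trans _ _ (f z * (a / (a - 1) * (m * f z) `^ (p - 1)))); last first.
  rewrite powRM ?(ltW m0)// le_eqVlt; apply/orP; left; apply/eqP.
  have -> : f z `^ p = f z * f z `^ (p - 1) by rewrite mulr_powRB1//; lra.
  by ring.
apply: (@le_trans _ _ (f z * \sum_(0 <= k < n) a ^+ k * (2 ^+ k < m * f z)%R%:R)).
  rewrite mulr_sumr le_eqVlt; apply/orP; left; apply/eqP; apply: eq_bigr => k _.
  rewrite /B mulrCA indicE; congr (_ * (_ * _%:R)); congr nat_of_bool.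
  by apply/idP/idP; rewrite inE.
by apply: ler_wpM2l => //; apply: dyadic_lower => //; rewrite mulr_ge0// ltW.
Qed.

End weak_type.

(** * The Poisson kernel as a harmonic majorant *)

Section poisson.
Context {R : realType}.
Local Notation V := 'rV[R]_3.
Local Notation T := (measurableTypeR R).
Local Notation e_ := (ebase R).
Local Notation mu2 := ((@lebesgue_measure R) \x (@lebesgue_measure R))%E.
Local Notation dom := (@sph_dom R).
Local Notation S := (@unit_sphere R).
Implicit Types (f : R * R -> R) (K : V -> V -> R) (x y w v : V) (z : R * R).

Lemma enormB_gt0 x w : x != w -> 0 < enorm (x - w).
Proof.
move=> xw; rewrite lt0r enorm_ge0 andbT; apply: contra xw => /eqP e0.
rewrite -subr_eq0; apply/eqP/rowP => k; rewrite [RHS]mxE.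
by apply/eqP; rewrite -normr_le0 -e0; exact: coord_le_enorm.
Qed.

Lemma isd_inv_enorm w x v : x != w ->
  is_derive x v (fun y => (enorm (y - w))^-1)
    (- (\sum_k (x - w) 0 k * v 0 k) * (enorm (x - w))^-1 ^+ 3).
Proof.
move=> xw; have n0 := enormB_gt0 xw.
have E (y : V) : enorm (y - w) = Num.sqrt (enorm (y - w) ^+ 2).
  by rewrite sqrtr_sqr ger0_norm// enorm_ge0.
pose Q (s : R) := enorm (x + s *: v - w) ^+ 2.
have dQ : is_derive (0 : R) (1 : R) Q (2 * \sum_k (x - w) 0 k * v 0 k).
  rewrite (_ : Q = fun s : R => enorm (x - w + s *: v) ^+ 2); last first.
    by apply/funext => s; rewrite /Q addrAC.
  apply: (is_derive_line (fun y : V => enorm y ^+ 2) (x - w) v 0 _).1.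
  by rewrite scale0r addr0; exact: isd_enorm_sqr.
have Q0 : Q 0 = enorm (x - w) ^+ 2 by rewrite /Q scale0r addr0.
have Qp : 0 < Q 0 by rewrite Q0 exprn_gt0.
have ds := is_derive1_comp (is_derive1_sqrt Qp) dQ.
have sq : Num.sqrt (Q 0) = enorm (x - w) by rewrite Q0 -E.
have sn : (Num.sqrt \o Q) 0 != 0 by rewrite /= sq gt_eqF.
have dv := is_deriveV sn ds.
suff : is_derive (0 : R) (1 : R) (fun s : R => (enorm (x + s *: v - w))^-1)
    (- (\sum_k (x - w) 0 k * v 0 k) * (enorm (x - w))^-1 ^+ 3).
  move/(is_derive_line (fun y : V => (enorm (y - w))^-1) x v 0 _).2.
  by rewrite scale0r addr0.
rewrite (_ : (fun s : R => _) = fun s : R => ((Num.sqrt \o Q) s)^-1); last first.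
  by apply/funext => s; rewrite /= /Q -E.
apply: (is_derive_eq dv); rewrite /= sq /GRing.scale/=.
by field; rewrite gt_eqF.
Qed.

Definition inv_dist x w := (enorm (x - w))^-1.
(** The Poisson kernel of the ball up to the factor [1 / (4 pi)]. *)
Definition poisson x w := (1 - enorm x ^+ 2) * inv_dist x w ^+ 3.
(* [poisson1 i] and [poisson2 i] are the first two derivatives of [poisson] in the
   direction [ebase R i], computed from [d_i (1/|x - w|) = - (x - w)_i / |x - w|^3]. *)
Definition poisson1 i x w :=
  - 2 * x 0 i * inv_dist x w ^+ 3 - 3 * (1 - enorm x ^+ 2) * (x - w) 0 i * inv_dist x w ^+ 5.
Definition poisson2 i x w :=
  - 2 * inv_dist x w ^+ 3 + 12 * x 0 i * (x - w) 0 i * inv_dist x w ^+ 5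
  - 3 * (1 - enorm x ^+ 2) * inv_dist x w ^+ 5
  + 15 * (1 - enorm x ^+ 2) * (x - w) 0 i ^+ 2 * inv_dist x w ^+ 7.

Lemma neq_sphere x w : enorm x < 1 -> enorm w = 1 -> x != w.
Proof. by move=> x1 w1; apply/eqP => xw; rewrite xw w1 ltxx in x1. Qed.

Lemma sum_ebase (a : V) i : \sum_k a 0 k * e_ i 0 k = a 0 i.
Proof.
rewrite (bigD1 i)//= ebase_coord eqxx mulr1 big1 ?addr0// => k ki.
by rewrite ebase_coord (negbTE ki) mulr0.
Qed.

Lemma isd_exp (h : V -> R) x v (a : R) n : is_derive x v h a ->
  is_derive x v (fun y => h y ^+ n.+1) (n.+1%:R * h x ^+ n * a).
Proof.
move=> dh; elim: n => [|n IH].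
  by apply: is_derive_eq dh _; rewrite expr0 mulr1 mul1r.
rewrite (_ : (fun y => _) = fun y => h y * h y ^+ n.+1); last by apply/funext => y; rewrite exprS.
apply: (is_derive_eq (isdM dh IH)).
by rewrite -[n.+2%:R]natr1 exprS; ring.
Qed.

Lemma poisson_isd i x w : enorm x < 1 -> enorm w = 1 ->
  is_derive x (e_ i) (poisson^~ w) (poisson1 i x w).
Proof.
move=> x1 w1; have := isd_inv_enorm (e_ i) (neq_sphere x1 w1); rewrite sum_ebase => dq.
have dn := isd_enorm_sqr x (e_ i); rewrite sum_ebase in dn.
apply: (is_derive_eq (isdM (isdB (isd_cst 1 x (e_ i)) dn) (isd_exp 2 dq))).
rewrite /poisson1 -/(inv_dist x w); move: (inv_dist x w) (x 0 i) ((x - w) 0 i) (enorm x) => a b c d; ring.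
Qed.

Lemma isd_coordB x w v i : is_derive x v (fun y => (y - w) 0 i) (v 0 i).
Proof.
rewrite (_ : (fun y => _) = fun y => y 0 i - w 0 i); last by apply/funext => y; rewrite !mxE.
by apply: (is_derive_eq (isdB (isd_coord x v i) (isd_cst (w 0 i) x v))); rewrite subr0.
Qed.

Lemma poisson1_isd i x w : enorm x < 1 -> enorm w = 1 ->
  is_derive x (e_ i) (poisson1 i ^~ w) (poisson2 i x w).
Proof.
move=> x1 w1; have := isd_inv_enorm (e_ i) (neq_sphere x1 w1); rewrite sum_ebase => dq.
have dn := isd_enorm_sqr x (e_ i); rewrite sum_ebase in dn.
have dx := isd_coord x (e_ i) i; have dy := isd_coordB x w (e_ i) i.
rewrite ebase_coord eqxx mulr1n in dx; rewrite ebase_coord eqxx mulr1n in dy.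
have d1 := isdM (isdZ (-2) dx) (isd_exp 2 dq).
have d2 := isdM (isdM (isdZ 3 (isdB (isd_cst 1 x (e_ i)) dn)) dy) (isd_exp 4 dq).
apply: (is_derive_eq (isdB d1 d2)).
rewrite /poisson2 -/(inv_dist x w) ?mulr1n; move: (inv_dist x w) (x 0 i) ((x - w) 0 i) (enorm x) => a b c d; ring.
Qed.

Lemma poisson_harmonic x w : enorm x < 1 -> enorm w = 1 -> \sum_i poisson2 i x w = 0.
Proof.
move=> x1 w1; have n0 := enormB_gt0 (neq_sphere x1 w1).
have E : inv_dist x w ^+ 2 * enorm (x - w) ^+ 2 = 1 by rewrite -exprMn mulVf ?expr1n// gt_eqF.
have W : enorm w ^+ 2 = 1 by rewrite w1 expr1n.
rewrite sum3 /poisson2; move: E W; rewrite !enorm_sqr3 !mxE.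
move: (inv_dist x w) (x 0 o0) (x 0 o1) (x 0 o2) (w 0 o0) (w 0 o1) (w 0 o2) => q a b c d e g E W.
(* The Laplacian is sorted into three groups: the first two vanish because [q] is the inverse of
   [|x - w|], the third because [|w| = 1]. *)
transitivity (- 6 * q ^+ 3 *
    (1 - q ^+ 2 * ((a - d) ^+ 2 + (b - e) ^+ 2 + (c - g) ^+ 2)) +
  15 * (1 - (a ^+ 2 + b ^+ 2 + c ^+ 2)) * q ^+ 5 *
    (q ^+ 2 * ((a - d) ^+ 2 + (b - e) ^+ 2 + (c - g) ^+ 2) - 1) +
  6 * q ^+ 5 * (1 - (d ^+ 2 + e ^+ 2 + g ^+ 2))); first by ring.
by rewrite E W; ring.
Qed.

(** In the pair the sphere point comes first, the order that [compact_uniform_at] expects. *)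
Variant jointly_continuous K : Prop := Jc of (forall x w, enorm x < 1 -> enorm w = 1 ->
  {for (w, x), continuous (fun z : V * V => K z.2 z.1)}).

Lemma jcD K L : jointly_continuous K -> jointly_continuous L -> jointly_continuous (fun x w => K x w + L x w).
Proof. by move=> [jK] [jL]; split=> x w x1 w1; apply: continuousD; [exact: jK|exact: jL]. Qed.

Lemma jcM K L : jointly_continuous K -> jointly_continuous L -> jointly_continuous (fun x w => K x w * L x w).
Proof. by move=> [jK] [jL]; split=> x w x1 w1; apply: continuousM; [exact: jK|exact: jL]. Qed.

Lemma jc_cst (c : R) : jointly_continuous (fun _ _ => c).
Proof. by split=> x w _ _; exact: cst_continuous. Qed.

Lemma jcX K n : jointly_continuous K -> jointly_continuous (fun x w => K x w ^+ n).
Proof.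
move=> jK; elim: n => [|n IH].
  by rewrite (_ : (fun x w => _) = fun _ _ => 1); [exact: jc_cst|do 2 apply/funext => ?; rewrite expr0].
rewrite (_ : (fun x w => _) = fun x w => K x w * K x w ^+ n); first exact: jcM.
by do 2 apply/funext => ?; rewrite exprS.
Qed.

Lemma jcN K : jointly_continuous K -> jointly_continuous (fun x w => - K x w).
Proof. by move=> [jK]; split=> x w x1 w1; apply: continuousN; exact: jK. Qed.

Lemma jc_coord i : jointly_continuous (fun x _ => x 0 i).
Proof.
split=> x w _ _; apply: (@continuous_comp _ _ _ snd (fun x : V => x 0 i) (w, x)).
  exact: cvg_snd.
exact: coord_continuous.
Qed.

Lemma jc_enorm : jointly_continuous (fun x _ => enorm x).
Proof.
split=> x w _ _; apply: (@continuous_comp _ _ _ snd (@enorm R) (w, x)).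
  exact: cvg_snd.
exact: continuous_enorm.
Qed.

Lemma jc_coordB i : jointly_continuous (fun x w => (x - w) 0 i).
Proof.
split=> x w _ _.
apply: (@continuous_comp _ _ _ (fun z : V * V => z.2 - z.1) (fun x : V => x 0 i) (w, x)).
  by apply: cvgB; [exact: cvg_snd|exact: cvg_fst].
exact: coord_continuous.
Qed.

Lemma jc_inv_dist : jointly_continuous inv_dist.
Proof.
split=> x w x1 w1; apply: (@continuousV _ _ (fun z : V * V => enorm (z.2 - z.1)) (w, x)).
  by rewrite gt_eqF// enormB_gt0// neq_sphere.
apply: (@continuous_comp _ _ _ (fun z : V * V => z.2 - z.1) (@enorm R) (w, x)).
  by apply: cvgB; [exact: cvg_snd|exact: cvg_fst].
exact: continuous_enorm.
Qed.

Lemma jc_poisson : jointly_continuous poisson.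
Proof. exact: (jcM (jcD (jc_cst 1) (jcN (jcX 2 jc_enorm))) (jcX 3 jc_inv_dist)). Qed.

Let jc_1n : jointly_continuous (fun x _ => 1 - enorm x ^+ 2) := jcD (jc_cst 1) (jcN (jcX 2 jc_enorm)).

Lemma jc_poisson1 i : jointly_continuous (poisson1 i).
Proof.
exact: (jcD (jcM (jcM (jc_cst (- 2)) (jc_coord i)) (jcX 3 jc_inv_dist))
  (jcN (jcM (jcM (jcM (jc_cst 3) jc_1n) (jc_coordB i)) (jcX 5 jc_inv_dist)))).
Qed.

Lemma jc_poisson2 i : jointly_continuous (poisson2 i).
Proof.
exact: (jcD (jcD (jcD (jcM (jc_cst (- 2)) (jcX 3 jc_inv_dist))
    (jcM (jcM (jcM (jc_cst 12) (jc_coord i)) (jc_coordB i)) (jcX 5 jc_inv_dist)))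
  (jcN (jcM (jcM (jc_cst 3) jc_1n) (jcX 5 jc_inv_dist))))
  (jcM (jcM (jcM (jc_cst 15) jc_1n) (jcX 2 (jc_coordB i))) (jcX 7 jc_inv_dist))).
Qed.

Lemma compact_sphere : compact S.
Proof.
have : closed S.
  rewrite (_ : S = @enorm R @^-1` [set 1]); last by [].
  by apply: closed_comp; [move=> *; exact: continuous_enorm|exact: closed_eq].
move=> cS; apply: (subclosed_compact cS (compact_eball (r := 1))).
by move=> w /= ->.
Qed.

Lemma jc_section K x w : jointly_continuous K -> enorm x < 1 -> enorm w = 1 -> {for w, continuous (K x)}.
Proof.
move=> [jK] x1 w1.
apply: (@continuous_comp _ _ _ (fun w : V => (w, x)) (fun z : V * V => K z.2 z.1) w).
  move=> A [[U W] /= [Uw Wx] UW]; apply: filterS Uw => w' Uw'.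
  by apply: UW; split=> //; exact: nbhs_singleton.
exact: jK.
Qed.

Lemma kernel_bm K x : jointly_continuous K -> enorm x < 1 -> bounded_measurable (fun z => K x (sph z)).
Proof.
move=> jK x1; split.
  apply: continuous_measurable2 => z; apply: continuous_sph_comp.
  by apply: jc_section => //; exact: enorm_sph.
have cK : compact (K x @` S).
  apply: continuous_compact; last exact: compact_sphere.
  by apply: continuous_in_subspaceT => w; rewrite inE => w1; exact: jc_section.
have [M [_ hM]] := compact_bounded cK.
exists (M + 1) => z; apply: hM; first by rewrite ltrDl.
by exists (sph z) => //; exact: enorm_sph.
Qed.

Lemma kernel_good K f : jointly_continuous K -> bounded_measurable f ->
  good mu2 (dom : set (T * T)) (eball 1) (fun x z => K x (sph z) * f z * sin z.1).
Proof.
move=> jK bf x x1; split.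
  exact: (bm_integrable (bmM (kernel_bm jK x1) bf)).
have [_ [M hM]] := bmM bf bm_sin.
have M0 : 0 <= M := le_trans (normr_ge0 _) (hM (0, 0)).
move=> e e0; have e'0 : 0 < e / (M + 1) by rewrite divr_gt0// ltr_wpDl.
have [|r r0 hr] := compact_uniform_at (g := K) (x := x) compact_sphere _ e'0.
  by case: jK => jK w w1; exact: jK.
exists r => // x' x'r z _.
rewrite -!mulrA -mulrBl normrM; apply: (@le_trans _ _ (e / (M + 1) * (M + 1))); last first.
  by rewrite divfK// gt_eqF// ltr_wpDl.
apply: ler_pM => //; first by apply: hr => //; exact: enorm_sph.
by apply: le_trans (hM z) _; rewrite lerDl.
Qed.

Definition poisson_integral K f x := sphere_int (fun z => K x (sph z) * f z).

Lemma poisson_integral_cont K f x : jointly_continuous K -> bounded_measurable f -> enorm x < 1 -> {for x, continuous (poisson_integral K f)}.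
Proof.
move=> jK bf x1.
exact: (good_cont (measurable_dom : measurable (dom : set (T * T))) fin_dom (open_eball (r := 1)) (kernel_good jK bf)).
Qed.

Lemma poisson_integral_isd K L f x v : jointly_continuous K -> jointly_continuous L -> bounded_measurable f ->
  (forall x w, enorm x < 1 -> enorm w = 1 -> is_derive x v (K^~ w) (L x w)) ->
  enorm x < 1 -> is_derive x v (poisson_integral K f) (poisson_integral L f x).
Proof.
move=> jK jL bf KL x1.
apply: (good_isd measurable_dom fin_dom (open_eball (r := 1)) (kernel_good jK bf) (kernel_good jL bf)) => //.
move=> y z y1 _.
rewrite (_ : (fun y => _) = fun y => (f z * sin z.1) * K y (sph z)); last first.
  by apply/funext => y'; ring.
apply: (is_derive_eq (isdZ (f z * sin z.1) (KL y (sph z) y1 (enorm_sph z)))).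
by ring.
Qed.

(** Comparison on the ball of radius [1 - d] with [2 * d < eta]. On its boundary the kernel is at
    least [d / (2 * d)^3] over the cap of radius [d] about [x / |x|], where [f] exceeds [|v x|], and
    this cap has measure at least [d^2 / 768]. Hence [C = 8 * 768], whatever [d] and [eta]. *)
Lemma poisson_lower : exists2 C : R, 0 <= C & forall (v : V -> R) f (eta : R), bounded_measurable f -> (forall z, 0 <= f z) ->
  smooth (eball 1) 2 v -> (forall x, enorm x < 1 -> lap v x = 0) -> 0 < eta ->
  (forall x z, enorm x < 1 -> enorm (x - sph z) <= eta -> `|v x| <= f z) ->
  forall x, enorm x < 1 -> `|v x| <= C * poisson_integral poisson f x.
Proof.
have [C C0 CE] : exists2 C : R, 0 <= C & C / (8 * 768) = 1.
  have : (0 : R) < 8 * 768 by lra.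
  by move: (8 * 768 : R) => c c0; exists c; [exact: ltW|rewrite divff// gt_eqF].
exists C => // v f eta bf f0 sv lv eta0 vf x0 x01.
have [d [d0 dx deta]] : exists d : R, [/\ 0 < d, d < 1 - enorm x0 & d < eta / 2].
  by apply: exists_pos_lt2; rewrite ?divr_gt0// subr_gt0.
have nx0 := enorm_ge0 x0.
pose rho := 1 - d.
have r0 : 0 < rho by rewrite /rho; lra.
have r1 : rho < 1 by rewrite /rho; lra.
suff H (s : R) : `|s| = 1 -> forall x, enorm x <= rho -> s * v x - C * poisson_integral poisson f x <= 0.
  have xr : enorm x0 <= rho by rewrite /rho; lra.
  have := H 1 (normr1 _) _ xr; have := H (-1) (normrN1 _) _ xr.
  by rewrite ler_norml; move: (poisson_integral _ _ _) => a h1 h2; apply/andP; split; lra.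
move=> s1.
apply: (max_principle (K := [set x | enorm x <= rho]) (B := [set x | enorm x = rho])).
- exact: compact_eball.
- move=> x /= xr; have x1 : enorm x < 1 by exact: le_lt_trans xr r1.
  apply: contD; first by apply: contM; [exact: cst_continuous|exact: (smooth_cont sv)].
  apply: contN; apply: contM; first exact: cst_continuous.
  by apply: poisson_integral_cont => //; exact: jc_poisson.
- move=> x /= _ xr; rewrite subr_le0.
  have x1 : enorm x < 1 by rewrite xr.
  apply: le_trans (ler_norm _) _; rewrite normrM s1 mul1r.
  pose xi := rho^-1 *: x.
  have xi1 : enorm xi = 1 by rewrite enormZ xr ger0_norm ?invr_ge0 ?ltW// mulVf// gt_eqF.
  have xxi : enorm (x - xi) = d.
    rewrite (_ : x - xi = - d *: xi); last first.
      rewrite /xi scalerA mulNr scaleNr -{1}(scale1r x) -scaleNr -scaleNr -scalerDl; congr (_ *: _).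
      by rewrite (_ : d = 1 - rho) ?/rho; [field; rewrite gt_eqF|ring].
    by rewrite enormZ xi1 mulr1 normrN gtr0_norm.
  have low : d ^+ 2 / 768 <= sphere_int \1_(cap xi d) by apply: cap_lower => //; rewrite d0/=; lra.
  have bc := bm_cap xi d.
  apply: (@le_trans _ _ (C * sphere_int (fun z => `|v x| / (8 * d ^+ 2) * \1_(cap xi d) z))).
    rewrite JZ//; apply: (@le_trans _ _ (C * (`|v x| / (8 * d ^+ 2) * (d ^+ 2 / 768)))).
      rewrite [leRHS](_ : _ = `|v x| * (C / (8 * 768))); first by rewrite CE mulr1.
      by field; rewrite gt_eqF.
    apply: ler_wpM2l => //.
    by apply: ler_wpM2l => //; rewrite divr_ge0// mulr_ge0// sqr_ge0.
  rewrite ler_wpM2l//; apply: J_le; [exact: bmZ|exact: (bmM (kernel_bm jc_poisson x1))|].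
  have n1 : d <= 1 - enorm x ^+ 2 by rewrite xr /rho; nra.
  move=> z _; rewrite indicE; have q0 : 0 <= inv_dist x (sph z) by rewrite invr_ge0 enorm_ge0.
  have [|_] := boolP (z \in cap xi d); last first.
    by rewrite mulr0 mulr_ge0// mulr_ge0 ?exprn_ge0//; lra.
  rewrite inE /cap/= => zd; rewrite mulr1 mulrC.
  have xz : enorm (x - sph z) <= 2 * d.
    by have := enorm_tri x xi (sph z); rewrite xxi (enormB xi); lra.
  apply: ler_pM; [by rewrite invr_ge0 mulr_ge0// sqr_ge0|exact: normr_ge0| |by apply: vf => //; lra].
  apply: (@le_trans _ _ (d * (2 * d)^-1 ^+ 3)).
    by rewrite le_eqVlt; apply/orP; left; apply/eqP; field; rewrite gt_eqF.
  apply: ler_pM; rewrite ?exprn_ge0 ?invr_ge0 ?mulr_ge0 ?(ltW d0)//.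
  rewrite lerXn2r ?nnegrE ?invr_ge0 ?mulr_ge0 ?(ltW d0) ?enorm_ge0//.
  rewrite lef_pV2 ?posrE ?mulr_gt0//.
  by rewrite enormB_gt0// neq_sphere// enorm_sph.
- move=> x /= xr nxr.
  have sub : eball rho `<=` eball 1 by move=> y /= /lt_trans; apply.
  exists (eball rho), (fun i y => s * dd i v y - C * poisson_integral (poisson1 i) f y),
    (fun i => s * dd i (dd i v) x - C * poisson_integral (poisson2 i) f x).
  have xr' : enorm x < rho by rewrite lt_neqAle xr andbT; apply/eqP.
  split.
  + exact: open_eball.
  + by split=> // y /= /ltW.
  + move=> i y /sub y1; apply: isdB; apply: isdZ; first exact: (smooth_isd i sv).
    by apply: poisson_integral_isd => //; [exact: jc_poisson|exact: jc_poisson1|move=> *; exact: poisson_isd].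
  + move=> i; apply: isdB; apply: isdZ; first exact: (smooth_isd i (smooth_dd i sv) (sub _ xr')).
    by apply: poisson_integral_isd => //; [exact: jc_poisson1|exact: jc_poisson2|move=> *; exact: poisson1_isd|exact: sub].
  + have x1 := sub _ xr'.
    rewrite big_split/= -mulr_sumr; have := lv x x1; rewrite /lap => ->.
    rewrite mulr0 add0r sumrN -mulr_sumr.
    have bP i : bounded_measurable (fun z => poisson2 i x (sph z) * f z).
      by apply: bmM => //; apply: kernel_bm => //; exact: jc_poisson2.
    rewrite -J_sum// (_ : sphere_int _ = 0) ?mulr0 ?oppr0//.
    rewrite -[RHS]J0; apply: J_ext => z _.
    by rewrite -mulr_suml poisson_harmonic ?mul0r// enorm_sph.
Qed.

Lemma exp8V n : (8^-1 : R) ^+ n = ((2^-1) ^+ n) ^+ 3.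
Proof. by rewrite -exprM mulnC exprM; congr (_ ^+ _); field. Qed.

(** If [2^n * d <= s], the left side is at most [8^(-n)], which the factor [8] matches with the term
    of index [n + 1]. *)
Lemma dyadic_cube (s d : R) n : 0 < d -> 0 <= s -> s < 2 ^+ n * d ->
  (d / (d + s)) ^+ 3 <= 8 * \sum_(0 <= k < n.+1) (8^-1) ^+ k * (s < 2 ^+ k * d)%R%:R.
Proof.
move=> d0 s0; have ds : 0 < d + s by rewrite ltr_pwDl.
elim: n => [|n IH] sn.
  rewrite big_nat1 expr0 mul1r sn mulr1.
  apply: (@le_trans _ _ 1); last by rewrite ler1n.
  by apply: exprn_ile1; [rewrite divr_ge0// ltW|rewrite ler_pdivrMr// mul1r lerDl].
rewrite big_nat_recr//= mulrDr sn mulr1.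
have [h|h] := ltP s (2 ^+ n * d).
  by apply: le_trans (IH h) _; rewrite lerDl mulr_ge0// exprn_ge0// invr_ge0.
apply: (@le_trans _ _ (8 * (8^-1) ^+ n.+1)); last first.
  rewrite lerDr mulr_ge0//; apply: sumr_ge0 => k _.
  by apply: mulr_ge0 => //; rewrite exprn_ge0// invr_ge0.
rewrite [_ ^+ n.+1]exprS mulrA mulfV// mul1r.
rewrite exp8V.
rewrite lerXn2r ?nnegrE ?exprn_ge0 ?invr_ge0 ?divr_ge0 ?(ltW d0) ?(ltW ds)//.
rewrite ler_pdivrMr// exprVn ler_pdivlMl ?exprn_gt0//.
by apply: le_trans h _; rewrite lerDr ltW.
Qed.

(** With [d = 1 - |x|] the kernel is at most a multiple of [d / (d + |z - xi|)^3] in the cone. Cut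
    along the caps of radius [2^k * d], it has weight of order [8^(-k) / d^2] on a cap where [f] has
    integral at most [t * 4^k * d^2]; the resulting series in [2^(-k)] converges. *)
Lemma poisson_upper : exists2 C : R, 0 <= C & forall f xi (t : R),
  bounded_measurable f -> (forall z, 0 <= f z) -> enorm xi = 1 -> 0 <= t ->
  (forall rho : R, 0 < rho -> sphere_int (fun z => f z * \1_(cap xi rho) z) <= t * rho ^+ 2) ->
  forall x, enorm x < 1 -> enorm (x - xi) <= 7 * (1 - enorm x) -> poisson_integral poisson f x <= C * t.
Proof.
pose C1 : R := 2 * 16 ^+ 3 * 8.
have C10 : 0 <= C1 by rewrite /C1 !mulr_ge0// exprn_ge0.
exists (C1 * 2); first by rewrite mulr_ge0.
move=> f xi t bf f0 xi1 t0 ht x x1 xxi.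
pose d := 1 - enorm x; have d0 : 0 < d by rewrite subr_gt0.
have [n hn] : exists n, 2 < 2 ^+ n * d.
  exists (Num.bound (2 / d)); rewrite -ltr_pdivrMr//.
  apply: lt_trans (archi_boundP _) _; first by rewrite divr_ge0// ltW.
  by rewrite -natrX ltr_nat ltn_expl.
pose c k : R := C1 / d ^+ 2 * (8^-1) ^+ k.
have c0 k : 0 <= c k by rewrite !mulr_ge0 ?invr_ge0 ?exprn_ge0 ?invr_ge0 ?(ltW d0).
pose F k z := c k * (f z * \1_(cap xi (2 ^+ k * d)) z).
have bfc k : bounded_measurable (fun z => f z * \1_(cap xi (2 ^+ k * d)) z) by apply: bmM => //; exact: bm_cap.
have bF k : bounded_measurable (F k) by apply: bmZ.
apply: (@le_trans _ _ (sphere_int (fun z => \sum_(0 <= k < n.+1) F k z))).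
  apply: J_le; [exact: (bmM (kernel_bm jc_poisson x1))|exact: bm_sum|].
  move=> z _; rewrite /F.
  set s := enorm (sph z - xi); have s0 : 0 <= s := enorm_ge0 _.
  have s2 : s <= 2 by apply: le_trans (enormBD _ _) _; rewrite enorm_sph xi1.
  have xz : d <= enorm (x - sph z).
    by have := enormBD x (x - sph z); rewrite subKr enorm_sph /d; lra.
  (* [s <= |x - z| + 7 * d] and [d <= |x - z|] give the factor [9], rounded up to [16]. *)
  have xz2 : d + s <= 16 * enorm (x - sph z).
    by have := enorm_tri (sph z) x xi; rewrite (enormB _ x) -/s /d in xz *; lra.
  apply: (@le_trans _ _ (C1 / d ^+ 2 * (8^-1 * (d / (d + s)) ^+ 3) * f z)).
    rewrite ler_wpM2r// /poisson.
    have ds : 0 < d + s by rewrite ltr_pwDl.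
    rewrite (_ : C1 / d ^+ 2 * (8^-1 * (d / (d + s)) ^+ 3) = 2 * d * (16 / (d + s)) ^+ 3); last first.
      by rewrite /C1; field; rewrite !gt_eqF.
    have q0 : 0 <= inv_dist x (sph z) by rewrite invr_ge0 enorm_ge0.
    apply: ler_pM; rewrite ?exprn_ge0//.
    - by rewrite subr_ge0 exprn_ile1// ?enorm_ge0// ltW.
    - by rewrite /d; have := enorm_ge0 x; nra.
    rewrite lerXn2r ?nnegrE ?divr_ge0 ?(ltW ds)//.
    rewrite /inv_dist -[leLHS]mul1r ler_pdivrMr; last exact: lt_le_trans d0 xz.
    by rewrite mulrAC ler_pdivlMr// mul1r.
  under eq_bigr do rewrite [f z * _]mulrC mulrA.
  rewrite -mulr_suml ler_wpM2r//.
  under eq_bigr do rewrite -mulrA.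
  rewrite -mulr_sumr ler_wpM2l ?divr_ge0 ?exprn_ge0 ?(ltW d0)//.
  rewrite ler_pdivrMl//.
  apply: le_trans (dyadic_cube d0 s0 (le_lt_trans s2 hn)) _.
  rewrite le_eqVlt; apply/orP; left; apply/eqP; congr (_ * _); apply: eq_bigr => k _.
  by rewrite indicE; congr (_ * _%:R); congr nat_of_bool; apply/idP/idP; rewrite inE.
rewrite J_sum//.
apply: (@le_trans _ _ (\sum_(0 <= k < n.+1) C1 * t * (2^-1) ^+ k)).
  apply: ler_sum => k _; rewrite JZ//.
  apply: (@le_trans _ _ (c k * (t * (2 ^+ k * d) ^+ 2))).
    by rewrite ler_wpM2l// ht// mulr_gt0// exprn_gt0.
  rewrite le_eqVlt; apply/orP; left; apply/eqP; rewrite /c.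
  rewrite exp8V !exprVn.
  have : (2 : R) ^+ k != 0 by rewrite expf_neq0.
  move: ((2 : R) ^+ k) => a a0; field.
  by rewrite a0 gt_eqF.
rewrite -mulr_sumr (mulrAC C1 2); apply: ler_wpM2l; first exact: mulr_ge0.
have E m : \sum_(0 <= k < m) (2^-1 : R) ^+ k = 2 - 2 * (2^-1) ^+ m.
  elim: m => [|m IH]; first by rewrite big_geq// expr0; ring.
  by rewrite big_nat_recr//= IH exprS; field.
by rewrite E gerBl mulr_ge0// exprn_ge0// invr_ge0.
Qed.

End poisson.

(** * Pointwise bound for a smooth Lame solution in a cone *)

Section cone_bound.
Context {R : realType}.
Local Notation V := 'rV[R]_3.
Local Notation dom := (@sph_dom R).
Local Notation S := (@unit_sphere R).
Implicit Types (f : R * R -> R) (U : 'I_3 -> V -> R) (x y w xi : V) (z : R * R).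

Lemma compact_uniform (K : set V) (v : V -> R) (e : R) : compact K ->
  (forall x, K x -> {for x, continuous v}) -> 0 < e ->
  exists2 eta : R, 0 < eta & forall x w, K w -> enorm (x - w) < eta ->
    `|v x - v w| <= e.
Proof.
move=> cK cv e0.
have [|eta eta0 h] := compact_uniform_at (g := fun h w => v (w + h)) (x := 0) cK _ e0.
  move=> w w1.
  apply: (@continuous_comp _ _ _ (fun z : V * V => z.1 + z.2) v (w, 0)).
    by apply: cvgD; [exact: cvg_fst|exact: cvg_snd].
  by rewrite /= addr0; exact: cv.
exists eta => // x w w1 xw.
by have := h (x - w); rewrite subr0 => /(_ xw w w1); rewrite subrKC addr0.
Qed.

Lemma cube_enorm y (d : R) x : 0 <= d -> cube y d x -> enorm (x - y) <= 2 * d.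
Proof.
move=> d0 h; apply: le_trans (enorm_le_norm _) _; rewrite ler_wpM2l//.
by apply: norm_leP => // i; have := h i; rewrite !mxE.
Qed.

(** The cone is star shaped about [0], as the estimate of [q] along rays requires. *)
Lemma cone_radial x xi (s : R) : enorm xi = 1 -> 0 <= s <= 1 ->
  enorm (x - xi) <= 3 * (1 - enorm x) ->
  enorm (s *: x - xi) <= 3 * (1 - enorm (s *: x)).
Proof.
move=> xi1 /andP[s0 s1] h.
rewrite (_ : s *: x - xi = s *: (x - xi) - (1 - s) *: xi); last first.
  by rewrite scalerBr scalerBl scale1r opprB addrA subrK.
apply: le_trans (enormBD _ _) _; rewrite !enormZ xi1 !ger0_norm ?subr_ge0//.
by have := ler_wpM2l s0 h; move: (enorm _) (enorm _) => a b; nra.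
Qed.

(** The slack [e] between [|U|] on the sphere and [f] pays for the modulus of continuity of [v],
    over which there is no control; [C] therefore depends on [mu] and [lam] only. *)
Lemma lame_cone_bound (mu lam : R) : 0 < mu -> 0 < mu *+ 2 + lam ->
  exists2 C : R, 0 <= C & forall (r : R) U f (e : R), 1 < r ->
    (forall k, smooth (eball r) 4 (U k)) ->
    (forall k x, eball r x ->
       mu * lap (U k) x + (lam + mu) * \sum_j dd k (dd j (U j)) x = 0) ->
    bounded_measurable f -> (forall z, 0 <= f z) -> 0 < e ->
    (forall k z, `|U k (sph z)| + e <= f z) ->
    forall xi (t : R), enorm xi = 1 -> 0 < t ->
    (forall rho : R, 0 < rho -> sphere_int (fun z => f z * \1_(cap xi rho) z) <= t * rho ^+ 2) ->
    forall x k, enorm x < 1 -> enorm (x - xi) <= 3 * (1 - enorm x) -> `|U k x| <= C * t.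
Proof.
move=> mu0 ml0.
have [Cl Cl0 low] := @poisson_lower R; have [Cu Cu0 upp] := @poisson_upper R.
pose A := Cl * Cu; have A0 : 0 <= A by rewrite mulr_ge0.
pose D := `|kappa mu lam| / (4 + 2 * kappa mu lam).
have kp := kappa_gt mu0 ml0.
have D0 : 0 <= D by rewrite divr_ge0//; lra.
(* [A] bounds [v]. In the other term [9 * 8^2] comes from second derivatives at scale
   [(1 - |y|) / 8], [3] from the three terms of the divergence, [D] from [lame_q_bound], and [2]
   from [1 - |x|^2 <= 2 * (1 - |x|)]. *)
exists (A + 2 * (D * (3 * (9 * 8 ^+ 2 * A)))).
  by apply: addr_ge0 => //; do 4 apply: mulr_ge0 => //.
move=> r U f e r1 sU lU bf f0 e0 Uf xi t xi1 t0 ht x k x1 xxi.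
pose v := lame_v mu lam U.
have sub : eball 1 `<=` (eball r : set V) by move=> y /= /lt_trans; apply.
have sv j : smooth (eball r) 2 (v j) by exact: lame_v_smooth.
have vS j w : enorm w = 1 -> v j w = U j w.
  by move=> w1; rewrite /v /lame_v w1 expr1n subrr mul0r subr0.
have vA j y : enorm y < 1 -> enorm (y - xi) <= 7 * (1 - enorm y) -> `|v j y| <= A * t.
  move=> y1 yxi; have [|eta eta0 heta] := compact_uniform compact_sphere _ e0 (v := v j).
    by move=> w w1; apply: (smooth_cont (sv j)); rewrite /eball/= w1.
  apply: (@le_trans _ _ (Cl * poisson_integral (@poisson R) f y)); last first.
    by rewrite /A -mulrA ler_wpM2l//; apply: (upp f xi) => //; exact: ltW.
  apply: (low (v j) f (eta / 2)) => //.
  - exact: smooth_sub sub (sv j).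
  - by move=> x' x'1; apply: (lame_v_harmonic mu0 ml0 sU lU); exact: sub.
  - by rewrite divr_gt0.
  - move=> x' z x'1 x'z; apply: le_trans (Uf j z).
    have := heta x' (sph z) (enorm_sph z); rewrite -vS ?enorm_sph//.
    move=> /(_ (le_lt_trans x'z _)); rewrite ltr_pdivrMr// ltr_pMr// ltr1n => /(_ isT).
    have := ler_normD (v j x' - v j (sph z)) (v j (sph z)); rewrite subrK.
    by move: (`|v j x'|) (`|v j (sph z)|) (`|_|) => a b c; lra.
pose B := 3 * (9 * 8 ^+ 2 * A) * t.
have vB y : enorm y < 1 -> enorm (y - xi) <= 3 * (1 - enorm y) ->
    `|\sum_j dd k (dd j (v j)) y| <= B / (1 - enorm y) ^+ 2.
  (* The cube of half-side [2 d] at [y] stays in the cone [|x - xi| <= 7 (1 - |x|)]. *)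
  move=> y1 yxi; pose d := (1 - enorm y) / 8.
  have d0 : 0 < d by rewrite divr_gt0// subr_gt0.
  have Ed : 1 - enorm y = 8 * d by rewrite /d; field.
  have hj j : `|dd k (dd j (v j)) y| <= 9 * (A * t) / d ^+ 2.
    have hc x' : cube y (2 * d) x' -> enorm (x' - y) <= 4 * d.
      move=> /(cube_enorm (mulr_ge0 _ (ltW d0))) => /(_ (ler0n _ _)).
      by rewrite mulrA -natrM.
    have hb x' : cube y (2 * d) x' -> enorm x' <= enorm y + 4 * d.
      by move=> /hc; have := enormD (x' - y) y; rewrite subrK; lra.
    apply: (harmonic_second_derivative j k (open_eball (r := r)) (sv j)) => //.
    - by move=> x'; exact: (lame_v_harmonic mu0 ml0 sU lU).
    - by move=> x' /hb hx; apply: sub; rewrite /eball/=; lra.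
    - move=> x' hx; have := hb _ hx; have := hc _ hx; have := enorm_tri x' y xi => h1 h2 h3.
      by apply: vA; lra.
  rewrite sum3; apply: le_trans (ler_normD _ _) _; apply: le_trans (lerD (ler_normD _ _) (lexx _)) _.
  apply: le_trans (lerD (lerD (hj o0) (hj o1)) (hj o2)) _.
  rewrite Ed /B le_eqVlt; apply/orP; left; apply/eqP; field.
  by rewrite gt_eqF.
have qb : `|lame_q mu lam U k x| * (1 - enorm x) <= D * B.
  rewrite /D mulrAC; apply: (lame_q_bound mu0 ml0 sU lU x1 r1) => s s01.
  have [s0 s1] := andP s01.
  have E : enorm (s *: x) = s * enorm x by rewrite enormZ ger0_norm.
  rewrite -E; apply: vB; last exact: cone_radial.
  by rewrite E; have := enorm_ge0 x; nra.
rewrite (lame_vE mu lam); apply: le_trans (ler_normD _ _) _.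
rewrite (mulrDl A); apply: lerD.
  by apply: vA => //; have := enorm_ge0 (x - xi); lra.
have x0 := enorm_ge0 x.
rewrite normrM ger0_norm ?subr_ge0 ?exprn_ile1// ?(ltW x1)//.
rewrite [leRHS](_ : _ = 2 * (D * B)); last by rewrite /B; ring.
have q0 := normr_ge0 (lame_q mu lam U k x).
apply: le_trans (_ : 2 * (`|lame_q mu lam U k x| * (1 - enorm x)) <= _); last by rewrite ler_wpM2l.
by rewrite [`|_| * _]mulrC mulrA ler_wpM2r//; move: (enorm x) x0 x1 {xxi qb} => a a0 a1; nra.
Qed.

(** The inequality defines a convex set that contains [xi], and also the half ball since
    [1 + |x| <= 3 * (1 - |x|)] for [|x| <= 1 / 2]. *)
Lemma Gamma_cone xi x : enorm xi = 1 -> Gamma xi x ->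
  enorm (x - xi) <= 3 * (1 - enorm x).
Proof.
move=> xi1 [_ /(_ [set x | enorm (x - xi) <= 3 * (1 - enorm x)])]; apply.
- move=> a b t /andP[t0 t1] /= ha hb.
  have h1 := enormD (t *: (a - xi)) ((1 - t) *: (b - xi)).
  have h2 := enormD (t *: a) ((1 - t) *: b).
  have t1' : 0 <= 1 - t by rewrite subr_ge0.
  have E : t *: (a - xi) + (1 - t) *: (b - xi) = t *: a + (1 - t) *: b - xi.
    by rewrite !scalerBr addrACA -opprD -scalerDl subrKC scale1r.
  rewrite E !enormZ !ger0_norm// in h1; rewrite !enormZ !ger0_norm// in h2.
  apply: le_trans h1 _.
  have := ler_wpM2l t0 ha; have := ler_wpM2l t1' hb; lra.
- move=> y [->|] /=; first by rewrite subrr enorm0 xi1 subrr mulr0.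
  rewrite /half_cball/= => y2; have := enormBD y xi; rewrite xi1; lra.
Qed.

End cone_bound.

(** * Smooth Lame solutions approximating a dilated solution *)

Section regularization.
Context {R : realType}.
Local Notation V := 'rV[R]_3.
Local Notation e_ := (ebase R).
Implicit Types (f : V -> R) (u : V -> V) (U : 'I_3 -> V -> R) (x y v : V) (mu lam : R).

Definition lame_eq mu lam (A : set V) U := forall k x, A x ->
  mu * lap (U k) x + (lam + mu) * \sum_j dd k (dd j (U j)) x = 0.

Lemma isd_component u x v (d : V) k : is_derive x v u d ->
  is_derive x v (fun y => u y 0 k) (d 0 k).
Proof.
move=> [du Du].
have C : (fun h : R => h^-1 *: (u (h *: v + x) - u x)) @ (0 : R)^' --> d.
  by rewrite -Du; exact: du.
have C' : (fun h : R => h^-1 *: (u (h *: v + x) 0 k - u x 0 k)) @ (0 : R)^' --> d 0 k.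
  rewrite (_ : (fun h : R => _) =
      (fun y : V => y 0 k) \o (fun h : R => h^-1 *: (u (h *: v + x) - u x))); last first.
    by apply/funext => h /=; rewrite !mxE.
  by apply: cvg_comp C _; exact: coord_continuous.
by apply: DeriveDef; [apply/cvg_ex; eexists; exact: C'|exact: cvg_lim C'].
Qed.

Lemma differentiable_isd u x v : differentiable u x -> is_derive x v u ('D_v u x).
Proof. by move=> du; split=> //; exact: diff_derivable. Qed.

Lemma lame_components mu lam u : lame_solution mu lam u ->
  (forall k, smooth (eball 1) 2 (fun x => u x 0 k)) /\
  lame_eq mu lam (eball 1) (fun k x => u x 0 k).
Proof.
move=> hu; have oB : open (eball 1 : set V) := open_eball (r := 1).
have d1 i k x : eball 1 x -> is_derive x (e_ i) (fun x => u x 0 k) (pd i u x 0 k).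
  by move=> /hu[du _ _ _ _]; apply: isd_component; exact: differentiable_isd.
have D1 i k x : eball 1 x -> dd i (fun x => u x 0 k) x = pd i u x 0 k.
  by move=> Bx; apply: isd_dd; exact: d1.
have d2 j i k x : eball 1 x ->
    is_derive x (e_ j) (dd i (fun x => u x 0 k)) (pd j (pd i u) x 0 k).
  move=> Bx; apply: (isd_ext oB Bx (f := fun x => pd i u x 0 k)).
    by move=> y By; rewrite D1.
  by have [_ dp _ _ _] := hu x Bx; apply: isd_component; exact: differentiable_isd.
have D2 j i k x : eball 1 x -> dd j (dd i (fun x => u x 0 k)) x = pd j (pd i u) x 0 k.
  by move=> Bx; apply: isd_dd; exact: d2.
have cc (g : V -> V) k x : {for x, continuous g} -> {for x, continuous (fun x => g x 0 k)}.
  by move=> cg; apply: (@continuous_comp _ _ _ g (fun y : V => y 0 k)); [exact: cg|exact: coord_continuous].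
split=> [k|k x Bx].
  split=> [x Bx|i].
    by have [du _ _ _ _] := hu x Bx; apply: cc; exact: differentiable_continuous.
  split=> [x Bx|]; first by have [] := d1 i k x Bx.
  split=> [x Bx|j].
    apply: (cont_ext oB (f := fun x => pd i u x 0 k)) => //; first by move=> y By; rewrite D1.
    by have [_ dp _ _ _] := hu x Bx; apply: cc; apply: differentiable_continuous; exact: dp.
  split=> [x Bx|]; first by have [] := d2 j i k x Bx.
  split=> // x Bx.
  apply: (cont_ext oB (f := fun x => pd j (pd i u) x 0 k)) => //; first by move=> y By; rewrite D2.
  by have [_ _ cp _ _] := hu x Bx; apply: cc; exact: cp.
have [_ _ _ _ /rowP/(_ k)] := hu x Bx.
rewrite /lame_op !mxE => H; rewrite -[RHS]H; congr (_ * _ + _ * _).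
  by rewrite /laplacian summxE; apply: eq_bigr => j _; rewrite D2.
have E y : eball 1 y -> divergence u y = \sum_j dd j (fun x => u x 0 j) y.
  by move=> By; apply: eq_bigr => j _; rewrite D1.
transitivity (dd k (fun y => \sum_j dd j (fun x => u x 0 j) y) x).
  apply/esym/isd_dd; apply: isd_sum => j.
  by have := d2 k j j x Bx; rewrite -D2.
rewrite -(dd_ext k oB E Bx); by rewrite dd.unlock.
Qed.

Section dilation.
Variables (rho : R) (rho0 : 0 < rho).
Let oB r : open (eball r : set V) := @open_eball R r.

Let dil_ball x : eball rho^-1 x -> eball 1 (rho *: x).
Proof.
by rewrite /eball/= => h; rewrite enormZ gtr0_norm// mulrC -ltr_pdivlMr// mul1r.
Qed.

Lemma dil_isd f n i x : smooth (eball 1) n.+1 f -> eball rho^-1 x ->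
  is_derive x (e_ i) (fun y => f (rho *: y)) (rho * dd i f (rho *: x)).
Proof.
move=> hf hx.
rewrite (_ : (fun y => _) = fun y => f (0 + rho *: y)); last by apply/funext => y; rewrite add0r.
apply: (isd_affine (L := fun y : V => rho *: y)).
  by move=> h y z; rewrite scalerDr !scalerA mulrC.
rewrite add0r; have := smooth_dir (rho *: e_ i) (@oB 1) hf (dil_ball hx).
move/is_derive_eq; apply.
rewrite (bigD1 i)//= big1 ?addr0; last by move=> k ki; rewrite mxE ebase_coord (negbTE ki) mulr0 mul0r.
by rewrite mxE ebase_coord eqxx mulr1.
Qed.

Lemma dil_smooth f n : smooth (eball 1) n f -> smooth (eball rho^-1) n (fun y => f (rho *: y)).
Proof.
elim: n f => [|n IH] f hf; (split=> [x hx|//]; first (apply: (cont_lip (K := rho) (G := fun y => rho *: y));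
  [by move=> y z; rewrite -scalerBr enormZ gtr0_norm|exact: (smooth_cont hf (dil_ball hx))])) => i.
split=> [x hx|]; first by have [] := dil_isd i hf hx.
apply: (smooth_ext (@oB _) _ (smoothZ rho (@oB _) (IH _ (smooth_dd i hf)))).
by move=> y hy; apply/esym/isd_dd; exact: (dil_isd i hf hy).
Qed.

Lemma dil_dd2 f i j x : smooth (eball 1) 2 f -> eball rho^-1 x ->
  dd i (dd j (fun y => f (rho *: y))) x = rho ^+ 2 * dd i (dd j f) (rho *: x).
Proof.
move=> hf hx.
rewrite (dd_ext i (@oB _) (g := fun y => rho * dd j f (rho *: y)) _ hx); last first.
  by move=> y hy; apply: isd_dd; exact: dil_isd hf hy.
by apply: isd_dd; rewrite expr2 -mulrA; apply: isdZ; exact: (dil_isd i (smooth_dd j hf) hx).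
Qed.

Lemma dil_lame mu lam U : (forall k, smooth (eball 1) 2 (U k)) ->
  lame_eq mu lam (eball 1) U -> lame_eq mu lam (eball rho^-1) (fun k x => U k (rho *: x)).
Proof.
move=> sU lU k x hx; rewrite /lap.
under eq_bigr do rewrite dil_dd2//.
under [X in _ + _ * X]eq_bigr do rewrite dil_dd2//.
rewrite -!mulr_sumr mulrCA [X in _ + X]mulrCA -mulrDr.
by have := lU k _ (dil_ball hx); rewrite /lap => ->; rewrite mulr0.
Qed.

End dilation.

(** Averages are linear and commute with second derivatives, so the averaged equation is the
    equation of the averages. *)
Lemma steklov3_lame mu lam U (r ep : R) : 0 <= ep ->
  (forall k, smooth (eball r) 2 (U k)) -> lame_eq mu lam (eball r) U ->
  lame_eq mu lam (eball (r - ep - ep - ep)) (fun k => steklov3 ep (U k)).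
Proof.
move=> ep0 sU lU k x hx.
have oB (a : R) : open (eball a : set V) := @open_eball R a.
have dd2 i j f : smooth (eball r) 2 f ->
    dd i (dd j (steklov3 ep f)) x = steklov3 ep (dd i (dd j f)) x.
  move=> hf; rewrite (dd_ext i (@oB _) (g := steklov3 ep (dd j f)) _ hx).
    by apply: steklov3_dd hx => //; exact: smooth_dd.
  by move=> y hy; apply: steklov3_dd hy => //; exact: smoothS.
pose C f := forall x, eball r x -> {for x, continuous f}.
have c2 i j l : C (dd i (dd j (U l))).
  by move=> y hy; exact: (smooth_cont (smooth_dd i (smooth_dd j (sU l))) hy).
have cs f g : C f -> C g -> C (fun z => f z + g z).
  by move=> cf cg y hy; apply: contD; [exact: cf|exact: cg].
have cz (c : R) f : C f -> C (fun z => c * f z).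
  by move=> cf y hy; apply: contM; [exact: cst_continuous|exact: cf].
have D f g : C f -> C g -> steklov3 ep (fun z => f z + g z) x = steklov3 ep f x + steklov3 ep g x.
  by move=> cf cg; exact: (steklov3D ep0 cf cg hx).
have Z (c : R) f : C f -> steklov3 ep (fun z => c * f z) x = c * steklov3 ep f x.
  by move=> cf; exact: (steklov3Z c ep0 cf hx).
have -> : lap (steklov3 ep (U k)) x = steklov3 ep (dd o0 (dd o0 (U k))) x +
    steklov3 ep (dd o1 (dd o1 (U k))) x + steklov3 ep (dd o2 (dd o2 (U k))) x.
  by rewrite -(dd2 o0 o0 _ (sU k)) -(dd2 o1 o1 _ (sU k)) -(dd2 o2 o2 _ (sU k)); exact: sum3.
have -> : \sum_j dd k (dd j (steklov3 ep (U j))) x = steklov3 ep (dd k (dd o0 (U o0))) x +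
    steklov3 ep (dd k (dd o1 (U o1))) x + steklov3 ep (dd k (dd o2 (U o2))) x.
  by rewrite -(dd2 k o0 _ (sU o0)) -(dd2 k o1 _ (sU o1)) -(dd2 k o2 _ (sU o2)); exact: sum3.
pose A i := dd i (dd i (U k)); pose B j := dd k (dd j (U j)).
have cA i : C (A i) by exact: c2.
have cB i : C (B i) by exact: c2.
have cA2 : C (fun z => A o0 z + A o1 z) by exact: cs.
have cB2 : C (fun z => B o0 z + B o1 z) by exact: cs.
have cA3 : C (fun z => A o0 z + A o1 z + A o2 z) by exact: cs.
have cB3 : C (fun z => B o0 z + B o1 z + B o2 z) by exact: cs.
have E := D _ _ (cz mu _ cA3) (cz (lam + mu) _ cB3).
rewrite (Z mu _ cA3) (Z (lam + mu) _ cB3) (D _ _ cA2 (cA o2)) (D _ _ cB2 (cB o2)) in E.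
rewrite (D _ _ (cA o0) (cA o1)) (D _ _ (cB o0) (cB o1)) in E.
apply: etrans (esym E) _; rewrite -[RHS](steklov3_0 ep x); apply: steklov3_ext hx => // y hy.
by rewrite -(lU k y hy) /lap !sum3.
Qed.

(** Two triple averages lift class C^2 to C^4. Their six shifts by [ep] add up to [d], chosen below
    a modulus of continuity common to the three components and below [rho^-1 - 1], so that the
    remaining radius exceeds [1]. *)
Lemma lame_regularize mu lam u (rho e : R) : lame_solution mu lam u -> 0 < rho < 1 -> 0 < e ->
  exists (r : R) U, [/\ 1 < r, forall k, smooth (eball r) 4 (U k), lame_eq mu lam (eball r) U &
    forall k x, enorm x <= 1 -> `|U k x - u (rho *: x) 0 k| <= e].
Proof.
move=> /lame_components[su lu] /andP[rho0 rho1] e0.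
have r1 : 1 < rho^-1 by rewrite invf_gt1.
pose g k x := u (rho *: x) 0 k.
have sg k : smooth (eball rho^-1) 2 (g k) by exact: (dil_smooth rho0 (su k)).
have lg : lame_eq mu lam (eball rho^-1) g by exact: (dil_lame rho0 su lu).
have cg k x : eball rho^-1 x -> {for x, continuous (g k)} by exact: (smooth_cont (sg k)).
have U1 k : exists2 eta : R, 0 < eta & forall x w, enorm w <= 1 -> enorm (x - w) < eta ->
    `|g k x - g k w| <= e.
  apply: (compact_uniform (K := [set x | enorm x <= 1])) => //; first exact: compact_eball.
  by move=> x x1; apply: cg; exact: le_lt_trans x1 r1.
have [a0 a00 h0] := U1 o0; have [a1 a10 h1] := U1 o1; have [a2 a20 h2] := U1 o2.
have [b [b0 ba0 ba1]] := exists_pos_lt2 a00 a10.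
have [c [c0 ca cb]] := exists_pos_lt2 a20 b0.
have [d [d0 dc dr]] : exists d : R, [/\ 0 < d, d < c & d < rho^-1 - 1].
  by apply: exists_pos_lt2 => //; rewrite subr_gt0.
pose ep := d / 6; have ep0 : 0 < ep by rewrite divr_gt0.
have Ed : d = 6 * ep by rewrite /ep; field.
exists (rho^-1 - ep - ep - ep - ep - ep - ep), (fun k => steklov3 ep (steklov3 ep (g k))); split.
- lra.
- by move=> k; apply: steklov3_smooth => //; exact: steklov3_smooth.
- apply: steklov3_lame; first exact: ltW.
    by move=> k; apply: smoothS; exact: steklov3_smooth.
  by apply: steklov3_lame => //; exact: ltW.
- move=> k x x1.
  have hk y : enorm (y - x) < c -> `|g k y - g k x| <= e.
    by move: k; apply: ord3P => yx; [apply: h0|apply: h1|apply: h2] => //; lra.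
  apply: (@steklov3_bound _ _ _ (rho^-1 - ep - ep - ep)); first exact: ltW.
  + by move=> y hy; apply: (smooth_cont (steklov3_smooth ep0 (sg k))) hy.
  + by rewrite /eball/=; lra.
  move=> y yx; apply: (@steklov3_bound _ _ _ rho^-1) => //; first exact: ltW.
  + exact: cg.
  + by rewrite /eball/=; have := enormD (y - x) x; rewrite subrK; lra.
  move=> z zy; apply: hk; have := enorm_tri z y x; lra.
Qed.

End regularization.

(** * The nontangential maximal function and its dilated versions *)

Section nontangential.
Context {R : realType}.
Local Notation V := 'rV[R]_3.
Local Notation T := (measurableTypeR R).
Local Notation mu2 := ((@lebesgue_measure R) \x (@lebesgue_measure R))%E.
Local Notation dom := (@sph_dom R).
Implicit Types (u : V -> V) (x y w xi : V) (z : R * R) (mu lam p : R).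

(** The constraints on [t] and [y] do not involve [xi], so a point of the cone can be carried along
    when [xi] moves. *)
Lemma GammaP xi x : Gamma xi x <-> enorm x < 1 /\
  exists (t : R) y, [/\ 0 <= t <= 1, enorm y <= (1 - t) / 2 & x = t *: xi + y].
Proof.
split=> [[x1 hx]|[x1 [t [y [/andP[t0 t1] yt xE]]]]]; split=> //.
  apply: (hx [set x | exists (t : R) y, [/\ 0 <= t <= 1, enorm y <= (1 - t) / 2 & x = t *: xi + y]]).
  - move=> _ _ s /andP[s0 s1] [t [y [/andP[t0 t1] yt ->]]] [t' [y' [/andP[t'0 t'1] yt' ->]]].
    exists (s * t + (1 - s) * t'), (s *: y + (1 - s) *: y'); split.
    + by apply/andP; split; nra.
    + have s1' : 0 <= 1 - s by rewrite subr_ge0.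
      apply: le_trans (enormD _ _) _; rewrite !enormZ !ger0_norm//.
      by have := ler_wpM2l s0 yt; have := ler_wpM2l s1' yt'; lra.
    + by rewrite !scalerDr !scalerA addrACA -scalerDl.
  - move=> y [->|y2]; first by exists 1, 0; rewrite enorm0 subrr mul0r scale1r addr0 ler01 lexx.
    by exists 0, y; rewrite scale0r add0r subr0 lexx ler01 mul1r.
move=> C cC sC; rewrite xE.
have [t1'|t1'] := eqVneq t 1.
  have -> : y = 0.
    apply/rowP => k; apply/eqP; rewrite [X in _ == X]mxE -normr_le0.
    apply: le_trans (coord_le_enorm _ _) _.
    by move: yt; rewrite t1' subrr mul0r.
  by rewrite t1' scale1r addr0; apply: sC; left.
have t1p : 0 < 1 - t by rewrite subr_gt0 lt_neqAle t1' t1.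
rewrite (_ : y = (1 - t) *: ((1 - t)^-1 *: y)); last by rewrite scalerA mulfV ?scale1r// gt_eqF.
apply: cC; [by rewrite t0| |]; apply: sC; first by left.
right; rewrite /half_cball/= enormZ gtr0_norm ?invr_gt0//.
by rewrite mulrC ler_pdivrMr// mulrC.
Qed.

Lemma Gamma_scale xi x (s : R) : 0 <= s <= 1 -> Gamma xi x -> Gamma xi (s *: x).
Proof.
move=> /andP[s0 s1] /GammaP[x1 [t [y [/andP[t0 t1] yt E]]]]; apply/GammaP; split.
  by rewrite enormZ ger0_norm//; have := enorm_ge0 x; nra.
exists (s * t), (s *: y); split; last by rewrite E scalerDr scalerA.
  by apply/andP; split; nra.
by rewrite enormZ ger0_norm//; have := ler_wpM2l s0 yt; nra.
Qed.

Lemma Gamma_radial w (r : R) : enorm w = 1 -> 0 <= r < 1 -> Gamma w (r *: w).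
Proof.
move=> w1 /andP[r0 r1]; apply/GammaP; rewrite enormZ w1 mulr1 ger0_norm//; split=> //.
exists r, 0; rewrite addr0 enorm0; split=> //; first by rewrite r0 ltW.
by rewrite divr_ge0// subr_ge0 ltW.
Qed.

Lemma Gamma0 xi : Gamma xi 0.
Proof.
apply/GammaP; rewrite enorm0 ltr01; split=> //; exists 0, 0.
by rewrite enorm0 scale0r addr0 lexx ler01 subr0 divr_ge0.
Qed.

Lemma ntmax_ge0 u xi : (0 <= ntmax u xi)%E.
Proof.
apply: le_trans (_ : (enorm (u 0))%:E <= _)%E; first by rewrite lee_fin enorm_ge0.
by apply: ereal_sup_ubound; exists 0 => //; exact: Gamma0.
Qed.

Definition cont_ball u := forall x, enorm x < 1 -> {for x, continuous (fun x => enorm (u x))}.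

(** Lower semicontinuity: a point of the cone with [|u| > a] moves continuously with the vertex when
    [t] and [y] are kept, and stays in the ball for nearby vertices. *)
Lemma open_ntmax u (a : R) : cont_ball u -> open [set z | (a%:E < ntmax u (sph z))%E].
Proof.
move=> cu; rewrite openE => z0 /= /ereal_sup_gt[_ [x /GammaP[x1 [t [y [t01 yt E]]]] <-]].
rewrite lte_fin => ax.
have lip (v w : V) : enorm (t *: v + y - (t *: w + y)) <= 1 * enorm (v - w).
  rewrite (_ : t *: v + y - (t *: w + y) = t *: (v - w)); last first.
    by rewrite opprD addrACA subrr addr0 scalerBr.
  rewrite enormZ ger0_norm; last by case/andP: t01.
  by rewrite ler_wpM2r ?enorm_ge0//; case/andP: t01.
have C1 : {for z0, continuous (fun z => enorm (t *: sph z + y))}.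
  apply: (continuous_sph_comp (g := fun w => enorm (t *: w + y))).
  by apply: (cont_lip (G := fun w => t *: w + y) lip); exact: continuous_enorm.
have C2 : {for z0, continuous (fun z => enorm (u (t *: sph z + y)))}.
  apply: (continuous_sph_comp (g := fun w => enorm (u (t *: w + y)))).
  apply: (cont_lip (G := fun w => t *: w + y) (f := fun x => enorm (u x)) lip).
  by rewrite -E; exact: cu.
have N1 : \forall z \near z0, enorm (t *: sph z + y) < 1.
  by apply: (cvgr_lt _ C1); rewrite -E.
have N2 : \forall z \near z0, a < enorm (u (t *: sph z + y)).
  by apply: (cvgr_gt _ C2); rewrite -E.
apply: filterS2 N1 N2 => z z1 za /=; apply: lt_le_trans (_ : (enorm (u (t *: sph z + y)))%:E <= _)%E.
  by rewrite lte_fin.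
by apply: ereal_sup_ubound; exists (t *: sph z + y) => //; apply/GammaP; split=> //; exists t, y.
Qed.

Lemma measurable_ntmax u : cont_ball u ->
  measurable_fun (setT : set (T * T)) (fun z => ntmax u (sph z)).
Proof.
move=> cu; apply: (measurability _ (ErealGenOInfty.measurableE R)).
move=> /= _ [_ [a ->]] <-; rewrite setTI; apply: open_measurable2.
by rewrite preimage_itvoy; exact: open_ntmax.
Qed.

Lemma bm_sphere (g : V -> R) : (forall w, enorm w = 1 -> {for w, continuous g}) ->
  bounded_measurable (fun z => g (sph z)).
Proof.
move=> cg; apply: (kernel_bm (K := fun _ w => g w) (x := 0)); last by rewrite enorm0.
split=> x w _ w1; apply: (@continuous_comp _ _ _ fst g (w, x)); first exact: cvg_fst.
exact: cg.
Qed.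

Lemma lame_cont_ball mu lam u : lame_solution mu lam u -> cont_ball u.
Proof.
move=> hu x x1; have [du _ _ _ _] := hu x x1.
apply: (@continuous_comp _ _ _ u (@enorm R)); last exact: continuous_enorm.
exact: differentiable_continuous.
Qed.

Lemma cont_dil u (rho : R) x : cont_ball u -> 0 < rho < 1 -> enorm x <= 1 ->
  {for x, continuous (fun x => enorm (u (rho *: x)))}.
Proof.
move=> cu /andP[r0 r1] x1.
apply: (cont_lip (G := fun x => rho *: x) (f := fun x => enorm (u x)) (K := rho)).
  by move=> y z; rewrite -scalerBr enormZ gtr0_norm.
by apply: cu; rewrite enormZ gtr0_norm//; have := enorm_ge0 x; nra.
Qed.

(** [fine] loses nothing for [0 < rho < 1], where the dilate is bounded on the closed ball. *)
Definition ndil u (rho : R) z : R := fine (ntmax (fun x => u (rho *: x)) (sph z)).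

Lemma ndil_bounded u (rho : R) : cont_ball u -> 0 < rho < 1 ->
  exists M : R, forall x, enorm x <= 1 -> enorm (u (rho *: x)) <= M.
Proof.
move=> cu r01; set h := fun x => enorm (u (rho *: x)).
have cK : compact (h @` [set x | enorm x <= 1]).
  apply: continuous_compact; last exact: compact_eball.
  by apply: continuous_in_subspaceT => w; rewrite inE => w1; exact: cont_dil.
have [M [_ hM]] := compact_bounded cK.
exists (M + 1) => x x1; apply: le_trans (ler_norm _) _; apply: hM; first by rewrite ltrDl.
by exists x.
Qed.

Lemma ntmax_le u xi (M : R) : (forall x, Gamma xi x -> enorm (u x) <= M) ->
  (ntmax u xi <= M%:E)%E.
Proof. by move=> h; apply: ge_ereal_sup => _ [x Gx <-]; rewrite lee_fin; exact: h. Qed.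

Lemma ndilE u (rho : R) z : cont_ball u -> 0 < rho < 1 ->
  ((ndil u rho z)%:E = ntmax (fun x => u (rho *: x)) (sph z))%E.
Proof.
move=> cu r01; have [M hM] := ndil_bounded cu r01.
rewrite /ndil fineK// ge0_fin_numE ?ntmax_ge0//.
apply: le_lt_trans (ltry M); apply: ntmax_le => x [x1 _]; apply: hM; exact: ltW.
Qed.

Lemma ndil_ge0 u (rho : R) z : 0 <= ndil u rho z.
Proof. by rewrite fine_ge0// ntmax_ge0. Qed.

Lemma bm_ndil u (rho : R) : cont_ball u -> 0 < rho < 1 -> bounded_measurable (ndil u rho).
Proof.
move=> cu r01; have [M hM] := ndil_bounded cu r01; split.
  apply/measurable_EFinP; rewrite (_ : _ \o _ = fun z => ntmax (fun x => u (rho *: x)) (sph z)).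
    by apply: measurable_ntmax => x x1; apply: cont_dil => //; exact: ltW.
  by apply/funext => z; exact: ndilE.
exists M => z; rewrite ger0_norm ?ndil_ge0// -lee_fin ndilE//.
by apply: ntmax_le => x [x1 _]; apply: hM; exact: ltW.
Qed.

Lemma ndil_le u (rho rho' : R) z : cont_ball u -> 0 < rho -> rho <= rho' -> rho' < 1 ->
  ndil u rho z <= ndil u rho' z.
Proof.
move=> cu r0 rr r1; have r'0 : 0 < rho' := lt_le_trans r0 rr.
rewrite -lee_fin !ndilE ?r0 ?r'0 ?r1 ?(le_lt_trans rr)//.
apply: ge_ereal_sup => _ [x Gx <-]; apply: ereal_sup_ubound; exists ((rho / rho') *: x).
  apply: Gamma_scale Gx; rewrite divr_ge0 ?(ltW r0) ?(ltW r'0)//=.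
  by rewrite ler_pdivrMr// mul1r.
by rewrite scalerA mulrC divfK// gt_eqF.
Qed.

Lemma dilated_estimate mu lam p : 0 < mu -> 0 < mu *+ 2 + lam -> 1 < p ->
  exists2 K : R, 0 <= K & forall u (rho : R), lame_solution mu lam u -> 0 < rho < 1 ->
    sphere_int (fun z => ndil u rho z `^ p) <=
      K * (1 + sphere_int (fun z => (enorm (u (rho *: sph z)) + 1) `^ p)).
Proof.
move=> mu0 ml0 p1; have [C C0 HC] := lame_cone_bound mu0 ml0.
have [c c0 hc] : exists2 c : R, 0 < c & forall xi, enorm xi = 1 -> c <= sphere_int \1_(cap xi 1).
  exists (1 ^+ 2 / 768) => [|xi xi1]; first by lra.
  by apply: cap_lower => //; rewrite ltr01 ler1n.
(* [2] passes from the largest component to the Euclidean norm, [C] bounds the regularised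
   components, and [c^-1] accounts for their error. *)
have D0 : 0 < 2 * (C + c^-1) by rewrite mulr_gt0// ltr_wpDl// invr_gt0.
have [K K0 HK] := strong_type p1 D0; exists K => // u rho hu r01.
have cu := lame_cont_ball hu.
pose f z := enorm (u (rho *: sph z)) + 1.
have bf : bounded_measurable f.
  apply: bmD; last exact: bm_cst.
  by apply: (bm_sphere (g := fun w => enorm (u (rho *: w)))) => w w1; apply: cont_dil => //; rewrite w1.
have f0 z : 0 <= f z by rewrite addr_ge0// enorm_ge0.
apply: (HK f) => //; [exact: bm_ndil|by move=> z; exact: ndil_ge0|].
move=> z t dz t0 ht.
(* The summand [1] of [f] keeps [t] away from [0], so that [C * t] can absorb the
   error of the regularization. *)
have ct : 1 <= c^-1 * t.
  rewrite mulrC ler_pdivlMr// mul1r; apply: le_trans (hc _ (enorm_sph z)) _.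
  have := ht 1 ltr01; rewrite expr1n mulr1; apply: le_trans.
  apply: J_le; [exact: bm_cap|by apply: bmM => //; exact: bm_cap|].
  by move=> w _; rewrite ler_peMl// lerDr enorm_ge0.
(* Used twice, as the accuracy of the regularisation and as the slack of the cone bound; together
   they exhaust the [1] in [f]. *)
have e0 : (0 : R) < 2^-1 by rewrite invr_gt0.
have [r [U [r1 sU lU hU]]] := lame_regularize hu r01 e0.
rewrite -lee_fin ndilE//; apply: ntmax_le => x Gx.
have x1 : enorm x < 1 by case: Gx.
apply: le_trans (enorm_le_norm _) _; rewrite -mulrA ler_wpM2l//.
apply: norm_leP => [|k]; first by rewrite mulr_ge0 ?(ltW t0)// addr_ge0// invr_ge0 ltW.
have : `|U k x| <= C * t.
  apply: (HC r U f 2^-1 r1 sU lU bf f0 e0 _ (sph z) t) => //; last exact: Gamma_cone (enorm_sph z) Gx.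
    move=> j w; have := hU j (sph w); rewrite enorm_sph lexx => /(_ isT).
    have := coord_le_enorm (u (rho *: sph w)) j; rewrite /f.
    have := ler_normD (U j (sph w) - u (rho *: sph w) 0 j) (u (rho *: sph w) 0 j); rewrite subrK.
    by lra.
  exact: enorm_sph.
have := hU k x (ltW x1); have := ler_normB (U k x) (U k x - u (rho *: x) 0 k); rewrite subKr.
by rewrite mulrDl; lra.
Qed.

End nontangential.

(** * The two inclusions *)

Section inclusions.
Context {R : realType}.
Local Notation V := 'rV[R]_3.
Local Notation T := (measurableTypeR R).
Local Notation mu2 := ((@lebesgue_measure R) \x (@lebesgue_measure R))%E.
Local Notation dom := (@sph_dom R).
Implicit Types (u : V -> V) (x w : V) (z : R * R) (mu lam p : R).

Lemma ratio_lt1 n : 0 < (n.+1%:R / n.+2%:R : R) < 1.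
Proof. by rewrite divr_gt0 ?ltr0n//= ltr_pdivrMr ?ltr0n// mul1r ltr_nat. Qed.

Lemma powRD1_le (a p : R) : 0 <= a -> 0 <= p -> (a + 1) `^ p <= 2 `^ p * (a `^ p + 1).
Proof.
move=> a0 p0; have [a1|/ltW a1] := leP a 1.
  apply: (@le_trans _ _ (2 `^ p)); first by rewrite ge0_ler_powR ?nnegrE//; lra.
  by rewrite ler_peMr ?powR_ge0// lerDr powR_ge0.
apply: (@le_trans _ _ ((2 * a) `^ p)); first by rewrite ge0_ler_powR ?nnegrE//; lra.
by rewrite powRM// ler_wpM2l ?powR_ge0// lerDl.
Qed.

Lemma measurable_ntmax_pow u p : cont_ball u ->
  measurable_fun (dom : set (T * T))
    (fun z => poweR `|ntmax u (sph z)|%E p * (sin z.1)%:E)%E.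
Proof.
move=> cu; apply: measurable_funTS; apply: emeasurable_funM; last first.
  by apply/measurable_EFinP; exact: measurable_sin1.
rewrite (_ : (fun z => _) = (fun y : \bar R => poweR y p) \o (fun z => ntmax u (sph z))).
  by apply: measurableT_comp; [exact: measurable_poweR|exact: measurable_ntmax].
by apply/funext => z /=; rewrite gee0_abs// ntmax_ge0.
Qed.

Lemma ball_slice u (r : R) w : cont_ball u -> 0 <= r < 1 -> enorm w = 1 ->
  {for w, continuous (fun w => enorm (u (r *: w)))}.
Proof.
move=> cu /andP[r0 r1] w1.
apply: (cont_lip (G := fun x => r *: x) (f := fun x => enorm (u x)) (K := r)).
  by move=> y z; rewrite -scalerBr enormZ ger0_norm.
by apply: cu; rewrite enormZ ger0_norm// w1 mulr1.
Qed.

Lemma bm_slice u p (r : R) : cont_ball u -> 0 <= p -> 0 <= r < 1 ->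
  bounded_measurable (fun z => enorm (u (r *: sph z)) `^ p).
Proof.
move=> cu p0 r01; apply: bm_powR => //; last by move=> z; exact: enorm_ge0.
by apply: (bm_sphere (g := fun w => enorm (u (r *: w)))) => w w1; exact: ball_slice.
Qed.

Lemma slice_integral u p (r : R) : cont_ball u -> 0 <= p -> 0 <= r < 1 ->
  (sphere_integral (fun w => (enorm (u (r *: w)) `^ p)%:E) =
   (sphere_int (fun z => enorm (u (r *: sph z)) `^ p))%:E)%E.
Proof.
move=> cu p0 r01; rewrite JE; last exact: bm_slice.
by apply: eq_integral => z _; rewrite EFinM.
Qed.

Lemma Hpe_sub_hpe mu lam p : 1 < p -> Hpe mu lam p `<=` hpe mu lam p.
Proof.
move=> p1 u [hu [_ fu]]; split=> //; have cu := lame_cont_ball hu.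
have p0 : 0 <= p by lra.
set I := sphere_integral _ in fu.
have I0 : (0 <= I)%E.
  by apply: integral_ge0 => z dz; rewrite mule_ge0 ?poweR_ge0// lee_fin sin_dom.
have Ifin : (poweR I p^-1 \is a fin_num)%E.
  by rewrite ge0_fin_numE ?poweR_ge0// poweR_lty.
exists (fine (poweR I p^-1)) => r r01; rewrite fineK// /int_mean.
apply: gt0_ler_poweR; rewrite ?invr_ge0// ?in_itv/= ?leey ?andbT//.
  by apply: integral_ge0 => z dz; rewrite mule_ge0// lee_fin ?powR_ge0 ?sin_dom.
apply: ge0_le_integral.
- exact: measurable_dom.
- by move=> z dz; rewrite mule_ge0// lee_fin ?powR_ge0 ?sin_dom.
- have [mb _] := bmM (bm_slice cu p0 r01) bm_sin.
  rewrite (_ : (fun z => _) = EFin \o (fun z => enorm (u (r *: sph z)) `^ p * sin z.1)).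
    by apply/measurable_EFinP; exact: measurable_funTS.
  by apply/funext => z /=; rewrite EFinM.
- exact: measurable_ntmax_pow.
- move=> z dz; rewrite lee_wpmul2r ?lee_fin ?sin_dom// -poweR_EFin.
  apply: gt0_ler_poweR; rewrite ?in_itv/= ?leey ?andbT ?abse_ge0 ?lee_fin ?enorm_ge0//.
  rewrite gee0_abs ?ntmax_ge0//; apply: ereal_sup_ubound.
  by exists (r *: sph z) => //; apply: Gamma_radial => //; exact: enorm_sph.
Qed.

(** By continuity each point of the cone is approached through its dilates, so a bound on all [ndil]
    bounds [ntmax]. The real bound [M] is extracted from [L] by dividing by the sine; where the sine
    vanishes the left side is [0], even if [ntmax] is infinite. *)
Lemma ntmax_pow_le u p z (L : \bar R) : cont_ball u -> 0 < p -> dom z ->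
  (forall n, ((ndil u (n.+1%:R / n.+2%:R) z `^ p * sin z.1)%:E <= L)%E) ->
  (poweR `|ntmax u (sph z)| p * (sin z.1)%:E <= L)%E.
Proof.
move=> cu p0 dz hL; have s0 := sin_dom dz.
have L0 : (0 <= L)%E by apply: le_trans (hL 0%N); rewrite lee_fin mulr_ge0 ?powR_ge0.
have [sz|sz] := eqVneq (sin z.1) 0; first by rewrite sz mule0.
have sp : 0 < sin z.1 by rewrite lt_neqAle eq_sym sz.
case: L hL L0 => [l hL|_ _|//]; last by rewrite leey.
rewrite lee_fin => l0; pose M := (l / sin z.1) `^ p^-1.
have Mp : M `^ p = l / sin z.1 by rewrite -powRrM mulVf ?gt_eqF// powRr1// divr_ge0.
have nM n : ndil u (n.+1%:R / n.+2%:R) z <= M.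
  rewrite leNgt; apply/negP => Mn.
  have := hL n; rewrite lee_fin -ler_pdivlMr// -Mp leNgt; case/negP.
  by rewrite gt0_ltr_powR ?nnegrE ?powR_ge0 ?ndil_ge0.
have NM : (ntmax u (sph z) <= M%:E)%E.
  apply: ntmax_le => x Gx; have x1 : enorm x < 1 by case: Gx.
  apply/ler_addgt0Pr => e e0.
  have /cont_enormP/(_ e e0)[d d0 hd] := cu x x1.
  have [n hn] : exists n : nat, (n.+2%:R^-1 : R) < d.
    exists (Num.bound d^-1); rewrite invf_plt ?posrE ?ltr0n//.
    apply: lt_le_trans (archi_boundP _) _; first by rewrite invr_ge0 ltW.
    by rewrite ler_nat -addn2 leq_addr.
  have := hd (n.+1%:R / n.+2%:R *: x); rewrite (_ : _ - x = - n.+2%:R^-1 *: x); last first.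
    rewrite -[X in _ - X]scale1r -scalerBl; congr (_ *: _).
    rewrite (_ : n.+1%:R = n.+2%:R - 1); last by rewrite -[n.+2%:R]natr1 addrK.
    by rewrite mulrBl mulfV ?pnatr_eq0// mul1r addrAC subrr sub0r.
  rewrite enormZ normrN ger0_norm ?invr_ge0//.
  have i0 : (0 : R) <= n.+2%:R^-1 by rewrite invr_ge0.
  have xd : n.+2%:R^-1 * enorm x < d by apply: le_lt_trans hn; rewrite ler_piMr// ltW.
  move/(_ xd).
  have : enorm (u (n.+1%:R / n.+2%:R *: x)) <= M.
    apply: le_trans (nM n); rewrite -lee_fin ndilE ?ratio_lt1//.
    by apply: ereal_sup_ubound; exists x.
  by rewrite ltr_norml => h1 /andP[h2 h3]; lra.
rewrite gee0_abs ?ntmax_ge0//.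
have Nf : (ntmax u (sph z) \is a fin_num)%E.
  by rewrite ge0_fin_numE ?ntmax_ge0// (le_lt_trans NM) ?ltry.
rewrite -(fineK Nf) poweR_EFin -EFinM lee_fin -ler_pdivlMr// -Mp.
by rewrite ge0_ler_powR ?nnegrE ?fine_ge0 ?ntmax_ge0 ?powR_ge0 ?(ltW p0)// -lee_fin fineK.
Qed.

(** The dilated maximal functions increase with the radius because the cones are star shaped about
    [0], so monotone convergence carries their uniform bound to the limit. Measurability is lower
    semicontinuity. *)
Lemma hpe_sub_Hpe mu lam p : 0 < mu -> 0 < mu *+ 2 + lam -> 1 < p ->
  hpe mu lam p `<=` Hpe mu lam p.
Proof.
move=> mu0 ml0 p1 u [hu [C hC]]; split=> //; have cu := lame_cont_ball hu.
have p0 : 0 < p by lra.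
split; first by apply: measurable_funTS; exact: measurable_ntmax.
have [K K0 HK] := dilated_estimate mu0 ml0 p1.
pose rho n : R := n.+1%:R / n.+2%:R.
have r01 n : 0 < rho n < 1 by exact: ratio_lt1.
have r01' n : 0 <= rho n < 1 by have /andP[/ltW -> ->] := r01 n.
pose A n := sphere_int (fun z => enorm (u (rho n *: sph z)) `^ p).
have A0 n : 0 <= A n.
  by apply: J_ge0 => [|z _]; [exact: bm_slice (ltW p0) (r01' n)|exact: powR_ge0].
have AC n : A n <= C `^ p.
  have := hC _ (r01' n); rewrite /int_mean slice_integral ?(ltW p0)// poweR_EFin lee_fin => h.
  rewrite -[A n](_ : (A n `^ p^-1) `^ p = _); last by rewrite -powRrM mulVf ?gt_eqF// powRr1.
  by rewrite ge0_ler_powR ?nnegrE ?powR_ge0 ?(ltW p0)// (le_trans _ h) ?powR_ge0.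
pose L : R := sphere_int (fun=> 1).
pose B := K * (1 + 2 `^ p * (C `^ p + L)).
have JB n : sphere_int (fun z => ndil u (rho n) z `^ p) <= B.
  apply: le_trans (HK u (rho n) hu (r01 n)) _; rewrite ler_wpM2l// lerD2l.
  have bs := bm_slice cu (ltW p0) (r01' n).
  apply: (@le_trans _ _ (sphere_int (fun z => 2 `^ p * (enorm (u (rho n *: sph z)) `^ p + 1)))).
    apply: J_le.
    - apply: bm_powR; [exact: ltW| |by move=> z; rewrite addr_ge0// enorm_ge0].
      apply: bmD; last exact: bm_cst.
      by apply: (bm_sphere (g := fun w => enorm (u (rho n *: w)))) => w w1; exact: ball_slice.
    - by apply: bmZ; apply: bmD => //; exact: bm_cst.
    - by move=> z _; apply: powRD1_le; [exact: enorm_ge0|exact: ltW].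
  rewrite JZ; last by apply: bmD => //; exact: bm_cst.
  rewrite JD//; last exact: bm_cst.
  by rewrite ler_wpM2l ?powR_ge0// lerD2r; exact: AC.
have bn n : bounded_measurable (fun z => ndil u (rho n) z `^ p).
  by apply: bm_powR; [exact: ltW|exact: bm_ndil|move=> z; exact: ndil_ge0].
pose g n (z : T * T) := (ndil u (rho n) z `^ p * sin z.1)%:E.
have mg n : measurable_fun (dom : set (T * T)) (g n).
  by apply/measurable_EFinP/measurable_funTS; exact: (bmM (bn n) bm_sin).1.
have g0 n z : dom z -> (0 <= g n z)%E.
  by move=> dz; rewrite lee_fin mulr_ge0 ?powR_ge0 ?sin_dom.
have ndg z : dom z -> {homo g^~ z : n m / (n <= m)%N >-> (n <= m)%E}.
  move=> dz n m nm; rewrite lee_fin; apply: ler_wpM2r; first exact: sin_dom.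
  apply: ge0_ler_powR; [exact: ltW|by rewrite nnegrE ndil_ge0|by rewrite nnegrE ndil_ge0|].
  apply: ndil_le; [exact: cu|by have /andP[] := r01 n| |by have /andP[] := r01 m].
  rewrite /rho ler_pdivrMr ?ltr0n// mulrAC ler_pdivlMr ?ltr0n//.
  have : (n%:R <= m%:R :> R) by rewrite ler_nat.
  by rewrite -!natr1; lra.
have Cv := @cvg_monotone_convergence _ _ _ mu2 _ measurable_dom g mg g0 ndg.
apply: (@le_lt_trans _ _ (\int[mu2]_(z in dom) limn (g^~ z))%E).
  apply: ge0_le_integral.
  - exact: measurable_dom.
  - by move=> z dz; rewrite mule_ge0 ?poweR_ge0// lee_fin sin_dom.
  - exact: measurable_ntmax_pow.
  - apply: (emeasurable_fun_cvg g) => // z dz.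
    exact: (ereal_nondecreasing_is_cvgn (ndg z dz)).
  - move=> z dz; have /cvg_lim -> // := ereal_nondecreasing_cvgn (ndg z dz).
    by apply: ntmax_pow_le => // n; apply: ereal_sup_ubound; exists n.
rewrite -(cvg_lim _ Cv)//; apply: (@le_lt_trans _ _ B%:E); last exact: ltry.
apply: lime_le; first by apply/cvg_ex; eexists; exact: Cv.
by apply: nearW => n; rewrite -JE ?lee_fin.
Qed.

End inclusions.

Theorem mainTheorem5 (R : realType) (mu lam p : R) :
  0 < mu -> 0 < mu *+ 2 + lam -> 1 < p ->
  hpe mu lam p = Hpe mu lam p.
Proof.
move=> mu0 ml0 p1; apply/seteqP; split; first exact: hpe_sub_Hpe.
exact: Hpe_sub_hpe.
Qed.
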